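(* Let $J\in\mathbb N$ and let $\boldsymbol M=(M^{(1)},\dots,M^{(J)})$ be the $J$-dimensional process whose components, all modulated by the same background chain $X$, satisfy $$\mathrm dM^{(j)}(t)=\left(\alpha^{(j)}_{X(t)}-\gamma^{(j)}_{X(t)}M^{(j)}(t)\right)\mathrm dt+\sigma^{(j)}_{X(t)}\,\mathrm dB_j(t),\qquad j=1,\dots,J,$$ with deterministic initial value $\boldsymbol M(0)\in\mathbb R^J$. For $\boldsymbol\vartheta\in\mathbb R^J$ and $t\ge0$ let $\boldsymbol g(\boldsymbol\vartheta,t)=(g_1,\dots,g_d)^{\rm T}$ with $$g_i(\boldsymbol\vartheta,t):=\mathbb E\left[e^{-\sum_{j=1}^J\vartheta_jM^{(j)}(t)}\mathbf 1\{X(t)=i\}\right].$$ Then $$\frac{\partial}{\partial t}\boldsymbol g(\boldsymbol\vartheta,t)=Q^{\rm T}\boldsymbol g(\boldsymbol\vartheta,t)-\sum_{j=1}^J\left(\vartheta_j\,\mathrm{diag}\{\boldsymbol\alpha^{(j)}\}-\tfrac12\vartheta_j^2\,\mathrm{diag}\{(\boldsymbol\sigma^{(j)})^2\}\right)\boldsymbol g(\boldsymbol\vartheta,t)-\sum_{j=1}^J\vartheta_j\,\mathrm{diag}\{\boldsymbol\gamma^{(j)}\}\frac{\partial}{\partial\vartheta_j}\boldsymbol g(\boldsymbol\vartheta,t).$$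
   Context: $X$ is a continuous-time Markov chain on $\{1,\dots,d\}$ with generator $Q$ (arbitrary initial law); $B_1,\dots,B_J$ are independent standard Brownian motions, independent of $X$. For each $j$, $\boldsymbol\alpha^{(j)},\boldsymbol\gamma^{(j)},\boldsymbol\sigma^{(j)}\in\mathbb R^d$ with $\gamma^{(j)}_i>0$, and $(\boldsymbol\sigma^{(j)})^2$ denotes the vector of squared entries. *)

(* Defs.v *)
From HB Require Import structures.
From mathcomp Require Import all_boot all_order all_algebra.
From mathcomp Require Import all_classical all_reals all_analysis.

Set Implicit Arguments.
Unset Strict Implicit.
Unset Printing Implicit Defensive.

Import Order.TTheory GRing.Theory Num.Theory numFieldNormedType.Exports.

Local Open Scope classical_set_scope.
Local Open Scope ring_scope.

(* Processes are indexed by the whole of R, but only their values at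
   nonnegative times are ever constrained or used. *)

(* Limit of the difference quotients of [f] at [t] along the increments that
   keep the argument in [0, +oo): the two-sided derivative when [0 < t], the
   right derivative when [t = 0]. *)
Definition is_derive_ge0 (R : realType) (V : normedModType R) (f : R -> V)
    (t : R) (l : V) : Prop :=
  h^-1 *: (f (t + h) - f t) @[h --> within [set h | 0 <= t + h] 0^'] --> l.

Section Probability.
Context {disp : measure_display} {Omega : measurableType disp} {R : realType}.
Variable P : probability Omega R.

(* The sigma-algebra on Omega generated by the variables [Y u], [u \in D],
   where the state space of [Y] carries the measurable sets [G]. *)
Definition sigma_process (S : Type) (G : set (set S)) (D : set R)
    (Y : R -> Omega -> S) : set (set Omega) :=
  <<s \bigcup_(u in D) preimage_set_system setT (Y u) G >>.

Definition mutual_independence (I : finType) (F : I -> set (set Omega)) : Prop :=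
  forall (S : {set I}) (A : I -> set Omega),
    (forall i, i \in S -> F i (A i)) ->
    (P (\bigcap_(i in [set` S]) A i) = \prod_(i in S) P (A i))%E.

Section MarkovChain.
Variable d : nat.

(* The last field makes [Q] the generator of the semigroup; together with the
   others it forces [Q] to have nonnegative off-diagonal entries and zero row
   sums. *)
Record transition_semigroup (Q : 'M[R]_d) (p : R -> 'M[R]_d) : Prop := {
  semigroup_ge0 : forall t, 0 <= t -> forall i k, 0 <= p t i k;
  semigroup_sum1 : forall t, 0 <= t -> forall i, \sum_(k < d) p t i k = 1;
  semigroup0 : p 0 = 1%:M;
  semigroupD : forall s t, 0 <= s -> 0 <= t -> p (s + t) = p s *m p t;
  semigroup_generator : h^-1 *: (p h - 1%:M) @[h --> 0^'+] --> Q }.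

(* All subsets of the state space are measurable. The Markov property says that,
   conditionally on the past up to time [s], the probability of being in [k] at
   time [t] is [p (t - s) (X s) k]. Paths are right-continuous with left limits
   for the discrete topology, hence piecewise constant. *)
Record markov_chain (Q : 'M[R]_d) (X : R -> Omega -> 'I_d) : Prop := {
  chain_measurable : forall t, 0 <= t -> forall i, measurable (X t @^-1` [set i]);
  chain_markov : exists p : R -> 'M[R]_d, transition_semigroup Q p /\
    forall (s t : R) (A : set Omega) (i k : 'I_d), 0 <= s -> s <= t ->
      sigma_process setT `[0, s] X A ->
      P (A `&` X s @^-1` [set i] `&` X t @^-1` [set k]) =
      (P (A `&` X s @^-1` [set i]) * (p (t - s) i k)%:E)%E;
  chain_cadlag : {ae P, forall w,
    (forall t, 0 <= t -> \forall u \near t^'+, X u w = X t w) /\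
    (forall t, 0 < t -> exists i, \forall u \near t^'-, X u w = i)} }.

End MarkovChain.

Record brownian_motion (B : R -> {RV P >-> R}) : Prop := {
  brownian0 : {ae P, forall w, B 0 w = 0};
  brownian_normal : forall s t, 0 <= s -> s < t ->
    forall A, measurable A ->
      P ((fun w => B t w - B s w) @^-1` A) = normal_prob 0 (Num.sqrt (t - s)) A;
  brownian_indep : forall (n : nat) (u : nat -> R),
    0 <= u 0%N -> (forall k, (k < n)%N -> u k <= u k.+1) ->
    mutual_independence (fun k : 'I_n =>
      preimage_set_system setT (fun w => B (u k.+1) w - B (u k) w) measurable);
  brownian_continuous : {ae P, forall w,
    {within `[0, +oo[, continuous (fun t => B t w)}} }.

(* [None] stands for [X] and [Some j] for [B j]. *)
Definition chain_and_noises (d J : nat) (X : R -> Omega -> 'I_d)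
    (B : 'I_J -> R -> {RV P >-> R}) (D : set R) (c : option 'I_J) :
    set (set Omega) :=
  if c is Some j then sigma_process measurable D (fun u => B j u : Omega -> R)
  else sigma_process setT D X.

Definition natural_filtration (d J : nat) (X : R -> Omega -> 'I_d)
    (B : 'I_J -> R -> {RV P >-> R}) (t : R) : set (set Omega) :=
  <<s \bigcup_(c in [set: option 'I_J]) chain_and_noises X B `[0, t] c >>.

Section ItoIntegral.

(* The process \sum_(k < n) xi_k 1_(t_k, t_(k+1)]. *)
Record simple_process := SimpleProcess {
  sp_size : nat;
  sp_time : nat -> R;
  sp_coef : nat -> Omega -> R }.

(* [F t] is the family of events observable up to time [t]. *)
Definition admissible (F : R -> set (set Omega)) (T : R) (H : simple_process) :
    Prop :=
  [/\ 0 <= sp_time H 0%N, sp_time H (sp_size H) <= T,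
      forall k, (k < sp_size H)%N -> sp_time H k <= sp_time H k.+1,
      forall k, (k < sp_size H)%N ->
        preimage_set_system setT (sp_coef H k) measurable `<=` F (sp_time H k) &
      forall k, (k < sp_size H)%N -> exists c, forall w, `|sp_coef H k w| <= c].

Definition sp_eval (H : simple_process) (u : R) (w : Omega) : R :=
  \sum_(k < sp_size H)
    sp_coef H k w * \1_(`]sp_time H k, sp_time H k.+1]) u.

Definition sp_integral (B : R -> Omega -> R) (H : simple_process) (w : Omega) :
    R :=
  \sum_(k < sp_size H)
    sp_coef H k w * (B (sp_time H k.+1) w - B (sp_time H k) w).

(* [I] is (a version of) the Ito integral of [H] against [B] over [0, T]: the
   L^2(P) limit of the integrals of simple processes that approximate [H] in
   L^2(du (x) P). *)
Definition is_ito_integral (F : R -> set (set Omega)) (B : R -> Omega -> R)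
    (H : R -> Omega -> R) (T : R) (I : {RV P >-> R}) : Prop :=
  exists Hn : nat -> simple_process,
    [/\ forall n, admissible F T (Hn n),
        (\int[P]_w \int[lebesgue_measure]_(u in `[0%R, T])
           ((H u w - sp_eval (Hn n) u w) ^+ 2)%R%:E)%E @[n --> \oo] --> 0%E &
        'E_P[fun w => ((I w - sp_integral B (Hn n) w) ^+ 2)%R]%E @[n --> \oo] --> 0%E].

End ItoIntegral.

(* Continuous solution of
   dM(t) = (alpha_X(t) - gamma_X(t) M(t)) dt + sigma_X(t) dB(t), M(0) = m0. *)
Record modulated_OU (d : nat) (F : R -> set (set Omega))
    (X : R -> Omega -> 'I_d) (B : R -> {RV P >-> R})
    (alpha gamma sigma : 'rV[R]_d) (m0 : R) (M : R -> {RV P >-> R}) : Prop := {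
  OU_continuous : {ae P, forall w,
    {within `[0, +oo[, continuous (fun t => M t w)}};
  OU_sde : forall t, 0 <= t -> exists I : {RV P >-> R},
    is_ito_integral F (fun u => B u : Omega -> R)
      (fun u w => sigma 0 (X u w)) t I /\
    {ae P, forall w, M t w = m0
      + \int[lebesgue_measure]_(u in `[0, t])
          (alpha 0 (X u w) - gamma 0 (X u w) * M u w)
      + I w} }.

Section Transform.
Variables (d J : nat) (X : R -> Omega -> 'I_d) (M : 'I_J -> R -> {RV P >-> R}).

Definition transform_integrand (theta : 'rV[R]_J) (t : R) (i : 'I_d)
    (w : Omega) : R :=
  expR (- \sum_(j < J) theta 0 j * M j t w) * \1_(X t @^-1` [set i]) w.

Definition transform (theta : 'rV[R]_J) (t : R) : 'cV[R]_d :=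
  \col_i fine 'E_P[transform_integrand theta t i]%E.

End Transform.

End Probability.

(* Main.v *)
Require Import Defs.
From HB Require Import structures.
From mathcomp Require Import all_boot all_order all_algebra.
From mathcomp Require Import all_classical all_reals all_analysis.
From mathcomp Require Import measurable_realfun.
From mathcomp Require Import ring lra.

(* Given the path of the chain, the Euler scheme m_j of M^(j) along a grid is
   Gaussian, and its mean mu_j and variance v_j are explicit functionals of the
   chain. Integrating out one Brownian increment at a time gives
     E[exp(- sum_j theta_j m_j) 1{X = i}] = E[exp(phi) 1{X = i}],
     phi = sum_j (- theta_j mu_j + theta_j^2 v_j / 2).
   The right-hand side involves bounded functionals of the chain only: it is
   twice differentiable in theta, and by the Markov property it satisfies the
   stated equation up to o(step) over one step, both uniformly in the grid.

   Along grids of mesh O(4^-n) the scheme converges almost surely to M. The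
   error in the drift comes from the modulus of continuity of the path of M and
   from the time spent by the chain away from its value at the left end of each
   cell, O(step^2) in mean; the error in the noise comes from the same
   occupation times through the Ito isometry. The formula at 2 theta bounds the
   second moments of exp(- sum_j theta_j m_j), so the expectations converge.
   In the limit, for g_i with generator L,
     |g_i(t) - g_i(s) - (t - s) (L g)_i| <= C (t - s)^2
   with L g taken at either end of [s, t]. *)

Set Implicit Arguments.
Unset Strict Implicit.
Unset Printing Implicit Defensive.

Import Order.TTheory GRing.Theory Num.Theory numFieldNormedType.Exports.

Local Open Scope classical_set_scope.
Local Open Scope ring_scope.

(** * Independence of sigma-algebras *)

(** The noise integral is given at each time separately, as an [L^2] limit of simple integrals, so
    the scheme is compared with [M] through those limits. To integrate out the increments of one
    [B j] while the path of the chain is held fixed, the past is enlarged: [past_system j s]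
    contains the whole chain and every other noise at all times, and [B j] up to [s] only. By
    independence [B j] remains a Brownian motion for this larger past. Two interchanges of limits
    shape the rest. The [theta]-derivative of the limit comes from expansions
    [F(theta + h) = F(theta) + h F' + O(h^2)] whose remainder does not depend on the grid: such a
    bound survives the limit and forces the derivatives to converge. The time increment is computed
    along grids that pass through both [s] and [t], so that one-step errors telescope between two
    indices of the same grid. Having [L g] at either end of [[s, t]] lets both one-sided difference
    quotients at [t] be compared with [L g] at [t] itself. *)

Section SubSigmaAlgebra.
Context {disp : measure_display} {T : measurableType disp} {R : realType}.
Variable P : probability T R.
Local Open Scope ereal_scope.

(** Both sides are finite measures of [A], namely [P] restricted to [E] and [P] scaled by [P E], so
    agreement on a generating pi-system suffices. *)
Lemma indep_pi_system (G : set (set T)) (E : set T) :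
  G `<=` measurable -> setI_closed G -> G setT -> measurable E ->
  (forall A, G A -> P (A `&` E) = P A * P E) ->
  forall A, <<s G >> A -> P (A `&` E) = P A * P E.
Proof.
move=> mG GI GT mE GE A sGA.
have PE0 : (0 <= fine (P E))%R by rewrite fine_ge0.
pose m1 := mrestr P mE.
pose m2 := mscale (NngNum PE0) P.
have PEE : (fine (P E))%:E = P E by rewrite fineK// fin_num_measure.
have m2E B : m2 B = P B * P E by rewrite -PEE muleC.
suff : m1 A = m2 A by rewrite m2E.
apply: (@g_sigma_algebra_measure_unique _ R T G mG (fun=> setT)) => //.
- by apply/seteqP; split=> // x _; exists 0%N.
- by move=> B GB; exact: (etrans (GE _ GB) (esym (m2E B))).
- by move=> _; rewrite /m1 /= /mrestr setTI (le_lt_trans (probability_le1 _ _))// ltry.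
Qed.

(** Intersections of one event from each family form a pi-system; it contains every family because
    the other factors may be [setT]. *)
Lemma indep_bigcup (I : finType) (F : I -> set (set T)) (E : set T) :
  (forall i, F i `<=` measurable) -> (forall i, setI_closed (F i)) ->
  (forall i, F i setT) -> measurable E ->
  (forall A : I -> set T, (forall i, F i (A i)) ->
    P (\bigcap_i A i `&` E) = P (\bigcap_i A i) * P E) ->
  forall A, <<s \bigcup_i F i >> A -> P (A `&` E) = P A * P E.
Proof.
move=> mF FI FT mE FE A sA.
pose G : set (set T) := [set \bigcap_i B i | B in [set B | forall i, F i (B i)]].
have : <<s G >> A.
  apply: (smallest_sub _ _ sA); first exact: smallest_sigma_algebra.
  apply: subset_trans (@sub_sigma_algebra _ _ _) => B [i _ FB].
  exists (fun k => if k == i then B else setT).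
    by move=> k /=; case: eqP => [->//|_]; exact: FT.
  apply/seteqP; split=> [x /(_ i Logic.I)|x Bx k _]; first by rewrite eqxx.
  by case: eqP.
apply: indep_pi_system => //.
- by move=> _ [B FB <-]; apply: fin_bigcap_measurable => [|i _]; [exact: finite_finset|exact/mF/FB].
- move=> _ _ [B FB <-] [C FC <-]; exists (fun i => B i `&` C i).
    by move=> i; exact: FI.
  by rewrite bigcapI.
- by exists (fun=> setT) => //; rewrite bigcapT.
- by move=> _ [B FB <-]; exact: FE.
Qed.

End SubSigmaAlgebra.

(** * Integrating out a variable independent of a sigma-algebra *)

Section Freezing.
Context {d} {T : measurableType d} {d'} {T' : measurableType d'} {R : realType}.
Variable P : probability T R.
Variable G : set (set T).
Hypothesis mG : G `<=` measurable.
Local Notation TG := (g_sigma_algebraType G).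
Local Open Scope ereal_scope.

Lemma sub_measurable_fun {dd} {V : measurableType dd} (f : T -> V) :
  measurable_fun [set: TG] (f : TG -> V) -> measurable_fun [set: T] f.
Proof.
move=> mf _ B mB; rewrite setTI; apply: (smallest_sub (@sigma_algebra_measurable _ T) mG).
by have := mf measurableT B mB; rewrite setTI.
Qed.

Variable Y : {mfun T >-> T'}.
Hypothesis indGY : forall A C, <<s G >> A -> measurable C ->
  P (A `&` Y @^-1` C) = P A * P (Y @^-1` C).

(** The first factor is the sample space itself, carrying only [<<s G>>]: a [G]-measurable function
    of [w] is then a function of the first coordinate, and independence says exactly that the law of
    [(w, Y w)] is a product. *)
Lemma indep_joint_law : exists pm : {mfun T >-> (TG * T')%type},
  exists idm : {mfun T >-> TG},
  [/\ forall w, pm w = (w, Y w), forall w, idm w = w &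
   forall A, measurable A ->
     distribution P pm A = (distribution P idm \x distribution P Y) A].
Proof.
have mid : measurable_fun [set: T] (id : T -> TG).
  exact: (@sub_measurable_fun _ TG (id : T -> TG)).
pose idm : {mfun T >-> TG} := HB.pack (id : T -> TG) (isMeasurableFun.Build _ _ _ _ _ mid).
have mp : measurable_fun [set: T] (fun w => (w, Y w) : (TG * T')%type).
  exact: measurable_fun_pair.
pose pm : {mfun T >-> (TG * T')%type} :=
  HB.pack (fun w => (w, Y w) : (TG * T')%type) (isMeasurableFun.Build _ _ _ _ _ mp).
exists pm, idm; split=> // A mA; apply/esym.
by apply: product_measure_unique.
Qed.

(** Does the work of conditioning on [G]: what is [G]-measurable is frozen and [Y] alone is
    integrated, by Tonelli for the product law. *)
Lemma freezing (f : TG * T' -> \bar R) :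
  measurable_fun setT f -> (forall z, 0 <= f z) ->
  \int[P]_w f (w, Y w) = \int[P]_w \int[distribution P Y]_y f (w, y).
Proof.
move=> mf f0; have [pm [idm [pmE idmE law]]] := indep_joint_law.
transitivity (\int[distribution P pm]_z f z).
  by rewrite ge0_integral_distribution//; apply: eq_integral => w _ /=; rewrite pmE.
rewrite (eq_measure_integral (distribution P idm \x distribution P Y)); last first.
  by move=> A mA _; exact: law.
rewrite fubini_tonelli1// ge0_integral_distribution//.
- by apply: eq_integral => w _ /=; rewrite idmE.
- exact: measurable_fun_fubini_tonelli_F.
- by move=> y; exact: integral_ge0.
Qed.

Lemma indep_integralM (V : T -> R) (h : T' -> R) :
  measurable_fun [set: TG] (V : TG -> R) -> measurable_fun setT h ->
  P.-integrable setT (EFin \o V) ->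
  (distribution P Y).-integrable setT (EFin \o h) ->
  P.-integrable setT (fun w => (V w * h (Y w))%:E) /\
  \int[P]_w (V w * h (Y w))%:E =
    \int[P]_w (V w)%:E * \int[distribution P Y]_y (h y)%:E.
Proof.
move=> mV mh iV ih; have [pm [idm [pmE idmE law]]] := indep_joint_law.
pose F (z : TG * T') : \bar R := (V z.1)%:E * (h z.2)%:E.
have mF : measurable_fun setT F.
  apply: emeasurable_funM; apply/measurable_EFinP.
    exact: (measurableT_comp mV (@measurable_fst _ _ TG T')).
  exact: (measurableT_comp mh (@measurable_snd _ _ TG T')).
have hfin := integrable_fin_num measurableT ih.
have := ih => /integrableP[_ hoo]; have := iV => /integrableP[_ Voo].
(* Integrability comes first, from [freezing] applied to the absolute value; Fubini for the signed
   product relies on it. *)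
have iF : P.-integrable setT (fun w => (V w * h (Y w))%:E).
  apply/integrableP; split.
    apply/measurable_EFinP; apply: measurable_funM; first exact: sub_measurable_fun mV.
    exact: measurableT_comp.
  have -> : \int[P]_w `|(V w * h (Y w))%:E| = \int[P]_w (abse \o F) (w, Y w).
    by [].
  have mabsF : measurable_fun setT (abse \o F) by exact: measurableT_comp.
  rewrite (freezing mabsF); last by move=> z; exact: abse_ge0.
  have abshE w : \int[distribution P Y]_y (abse \o F) (w, y) =
      `|(V w)%:E| * \int[distribution P Y]_y `|(h y)%:E|.
    rewrite -ge0_integralZl//; first by apply: eq_integral => y _; rewrite -abseM.
    by do 2 apply: measurableT_comp => //.
  under eq_integral do rewrite abshE.
  rewrite ge0_integralZr//.
  - by rewrite lte_mul_pinfty// ?ge0_fin_numE// integral_ge0.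
  - by do 2 apply: measurableT_comp => //; exact: sub_measurable_fun mV.
  - exact: integral_ge0.
split=> //.
have iFpm : P.-integrable setT (F \o pm).
  by apply: eq_integrable iF => // w _ /=; rewrite pmE.
transitivity (\int[distribution P pm]_z F z).
  rewrite integral_distribution//.
  by apply: eq_integral => w _ /=; rewrite pmE.
have iFprod : (distribution P idm \x distribution P Y).-integrable setT F.
  apply/integrableP; split=> //.
  rewrite (eq_measure_integral (distribution P pm)); last by move=> A mA _; exact/esym/law.
  have /integrableP[_ +] := iFpm; rewrite ge0_integral_distribution//.
  exact: measurableT_comp.
rewrite (eq_measure_integral (distribution P idm \x distribution P Y)); last first.
  by move=> A mA _; exact: law.
rewrite -integral12_prod_meas1//.
have iVidm : (distribution P idm).-integrable setT (EFin \o (V : TG -> R)).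
  apply/integrableP; split; first exact/measurable_EFinP.
  rewrite ge0_integral_distribution//.
    apply: le_lt_trans Voo; rewrite le_eqVlt; apply/orP; left; apply/eqP.
    by apply: eq_integral => w _ /=; rewrite idmE.
  by apply: measurableT_comp => //; exact/measurable_EFinP.
rewrite -(fineK hfin) -integralZr//.
transitivity (\int[distribution P idm]_w ((V w)%:E * (fine (\int[distribution P Y]_y (h y)%:E))%:E)).
  apply: eq_integral => w _; rewrite /fubini_F /F /= fineK// integralZl//.
rewrite integral_distribution//.
- by apply: eq_integral => w _ /=; rewrite idmE.
- by apply: emeasurable_funM => //; exact/measurable_EFinP.
- by apply: eq_integrable (integrableZr measurableT _ iV) => // w _ /=; rewrite idmE.
Qed.

End Freezing.

Section Density.
Context {d} {T : measurableType d} {R : realType}.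
Import HBNNSimple.
Variables (mu nu : {measure set T -> \bar R}) (g : T -> R).
Hypotheses (mg : measurable_fun setT g) (g0 : forall x, 0 <= g x).
Hypothesis nuE : forall A, measurable A -> nu A = (\int[mu]_(x in A) (g x)%:E)%E.
Local Open Scope ereal_scope.

Lemma ge0_integral_density (f : T -> \bar R) : measurable_fun setT f ->
  (forall x, 0 <= f x) -> \int[nu]_x f x = \int[mu]_x (f x * (g x)%:E).
Proof.
move=> mf f0.
have g0E x : 0 <= (g x)%:E by rewrite lee_fin.
pose h := nnsfun_approx measurableT mf.
(* Used with weight [1] against [nu] and with weight [g] against [mu], so that both sides become
   limits along the same simple functions. *)
have hfun (m : {measure set T -> \bar R}) (k : T -> R) : measurable_fun setT k -> (forall x, (0 <= k x)%R) ->
    \int[m]_x (f x * (k x)%:E) = limn (fun n => \int[m]_x ((h n x)%:E * (k x)%:E)).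
  move=> mk k0; rewrite -monotone_convergence//.
  - apply: eq_integral => x _; apply/esym/cvg_lim => //.
    by apply: cvgeZr => //; exact: cvg_nnsfun_approx.
  - by move=> n; apply: emeasurable_funM; exact/measurable_EFinP.
  - by move=> n x _; rewrite mule_ge0// lee_fin.
  - move=> x _ m1 n1 mn; rewrite lee_pmul// ?lee_fin//.
    exact/lefP/nd_nnsfun_approx.
transitivity (\int[nu]_x (f x * (cst 1%R x)%:E)).
  by apply: eq_integral => x _; rewrite mule1.
rewrite !hfun//; congr (limn _); apply/funext => n.
under eq_integral do rewrite mule1 fimfunE -fsumEFin//.
rewrite [RHS](eq_integral (fun x => \sum_(y \in range (h n))
    (y * \1_(h n @^-1` [set y]) x * g x)%:E)); last first.
  by move=> x _; rewrite -EFinM fimfunE mulr_fsuml fsumEFin.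
rewrite !ge0_integral_fsum//.
- apply: eq_fsbigr => y.
  rewrite inE => -[z _ <-{y}].
  rewrite integralZl_indic_nnsfun// integral_indic// setIT nuE//.
  under [in RHS]eq_integral do rewrite -mulrA EFinM.
  rewrite ge0_integralZl//; [congr *%E| | |].
  + rewrite [LHS]integral_mkcond; apply: eq_integral => x _.
    by rewrite patchE indicE; case: ifP; rewrite ?mul1r ?mul0r.
  + by apply/measurable_EFinP/measurable_funM.
  + by move=> x _; rewrite lee_fin mulr_ge0.
  + by rewrite lee_fin.
- by move=> y; apply/measurable_EFinP/measurable_funM => //; apply: measurable_funM.
- by move=> y x _; rewrite lee_fin mulr_ge0// -lee_fin EFinM; exact: nnfun_muleindic_ge0.
- by move=> y; apply/measurable_EFinP; apply: measurable_funM.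
- by move=> y x _; exact: nnfun_muleindic_ge0.
Qed.

End Density.

(** * Gaussian moments *)

Section ExpBounds.
Context {R : realType}.
Implicit Types x : R.

Lemma expR_subDx_ge0 x : 0 <= expR x - 1 - x.
Proof. by rewrite -addrA -opprD subr_ge0 expR_ge1Dx. Qed.

(** Everything follows from [1 + y <= exp y] at [y = - x]. For [x >= 0] it gives
    [exp x - 1 <= x exp x]; for [x < 0] it gives [exp x <= 1 / (1 - x)], and
    [(1 + x + x^2) (1 - x) = 1 - x^3 >= 1]. *)
Lemma expR_subDx_le x : expR x - 1 - x <= x ^+ 2 * expR `|x|.
Proof.
have [x0|x0] := leP 0 x.
  rewrite ger0_norm//.
  have h1 : 1 <= expR x by rewrite -expR0 ler_expR.
  have h2 : expR x - 1 <= x * expR x.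
    have := expR_ge1Dx (- x); rewrite -(ler_pM2r (expR_gt0 x)) -expRD addNr expR0.
    lra.
  have := ler_wpM2l x0 h2; rewrite expr2; lra.
rewrite ltr0_norm//.
have h1 : 1 <= expR (- x) by rewrite -expR0 ler_expR oppr_ge0 ltW.
have h2 : expR x * (1 - x) <= 1.
  have := expR_ge1Dx (- x); rewrite -(ler_pM2l (expR_gt0 x)) -expRD subrr expR0.
  lra.
have h3 : expR x <= 1 + x + x ^+ 2.
  have x1 : 0 < 1 - x by lra.
  rewrite -(ler_pM2r x1); apply: (le_trans h2); nra.
have : 0 <= x ^+ 2 by exact: sqr_ge0.
nra.
Qed.

End ExpBounds.

(** * Laplace transform and scaling of the normal law *)

Section Normal.
Context {R : realType}.
Notation mu := (@lebesgue_measure R).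
Local Open Scope ereal_scope.

Lemma ge0_integral_normal_prob (m s : R) (f : R -> \bar R) :
  measurable_fun setT f -> (forall x, 0 <= f x) ->
  \int[normal_prob m s]_x f x = \int[mu]_x (f x * (normal_pdf m s x)%:E).
Proof.
move=> mf f0; apply: ge0_integral_density => //.
- exact: measurable_normal_pdf.
- by move=> x; exact: normal_pdf_ge0.
Qed.

(* completing the square: [exp (c y)] times the centred density is a multiple
   of the density centred at [c v] *)
Lemma normal_mgf (v c : R) : (0 < v)%R ->
  \int[normal_prob 0 (Num.sqrt v)]_y (expR (c * y))%:E = (expR (c ^+ 2 * v / 2))%:E.
Proof.
move=> v0; have s0 : Num.sqrt v != 0%R by rewrite gt_eqF// sqrtr_gt0.
have mexp : measurable_fun setT (fun y : R => (expR (c * y))%:E).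
  apply/measurable_EFinP; apply: measurableT_comp => //; exact: mulrl_measurable.
rewrite ge0_integral_normal_prob//.
transitivity (\int[mu]_y ((expR (c ^+ 2 * v / 2))%:E * (normal_pdf (c * v) (Num.sqrt v) y)%:E)).
  apply: eq_integral => y _; rewrite -!EFinM; congr EFin.
  rewrite !normal_pdfE// /normal_fun mulrCA [RHS]mulrCA; congr (_ * _)%R.
  rewrite -!expRD; congr expR.
  rewrite sqr_sqrtr ?ltW//.
  by field; rewrite gt_eqF.
rewrite ge0_integralZl//.
- by rewrite integral_normal_pdf mule1.
- by apply/measurable_EFinP; exact: measurable_normal_pdf.
- by move=> x _; rewrite lee_fin normal_pdf_ge0.
Qed.

(** Substitution [y = sqrt v * x]: only the proportionality to [v] is extracted here. *)
Lemma normal_second_moment (v : R) : (0 < v)%R ->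
  \int[normal_prob 0 (Num.sqrt v)]_y (y ^+ 2)%:E =
  v%:E * \int[normal_prob 0 (Num.sqrt 1)]_y (y ^+ 2)%:E.
Proof.
move=> v0; have sv0 : (0 < Num.sqrt v)%R by rewrite sqrtr_gt0.
have s0 : Num.sqrt v != 0%R by rewrite gt_eqF.
set s := Num.sqrt v in sv0 s0 *.
have mpdf (a : R) : measurable_fun setT (fun y : R => (y ^+ 2 * normal_pdf 0 a y)%R).
  apply: measurable_funM; first exact: exprn_measurable.
  exact: measurable_normal_pdf.
have msqr : measurable_fun setT (fun y : R => (y ^+ 2)%:E).
  by apply/measurable_EFinP; exact: exprn_measurable.
have sqrE (a : R) : \int[normal_prob 0 a]_y (y ^+ 2)%:E =
    \int[mu]_y (y ^+ 2 * normal_pdf 0 a y)%:E.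
  by rewrite ge0_integral_normal_prob// => y; rewrite lee_fin sqr_ge0.
rewrite [LHS]sqrE [in RHS]sqrE.
have dF : ( *%R s : R -> R)^`()%classic = cst s.
  by apply/funext => x; rewrite derive1E deriveM// derive_id derive_cst scaler0 addr0 scaler1.
rewrite (@increasing_ge0_integration_by_substitutionT R ( *%R s))//.
- rewrite -ge0_integralZl//.
  + apply: eq_integral => x _; rewrite dF !fctE/= -EFinM; congr EFin.
    rewrite !normal_pdfE ?sqrtr1 ?oner_neq0// /normal_fun /normal_peak !subr0 expr1n.
    rewrite mul1r !sqr_sqrtr ?ltW//.
    rewrite -(mulrnAr v) sqrtrM ?ltW// -/s invfM.
    have -> : (- (s * x) ^+ 2 / (v *+ 2) = - x ^+ 2 / 2)%R.
      by rewrite exprMn sqr_sqrtr ?ltW//; field; rewrite gt_eqF.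
    rewrite exprMn sqr_sqrtr ?ltW//; field.
    by rewrite s0 sqrtr_eq0 -ltNge pmulrn_lgt0// pi_gt0.
  + by apply/measurable_EFinP; exact: mpdf.
  + by move=> x _; rewrite lee_fin mulr_ge0 ?sqr_ge0 ?normal_pdf_ge0.
  + by rewrite lee_fin ltW.
- by move=> x y xy; rewrite ltr_pM2l.
- by rewrite dF => x; exact: cvg_cst.
- by rewrite dF; exact: is_cvg_cst.
- by rewrite dF; exact: is_cvg_cst.
- by apply: gt0_cvgMrNy => //; exact: cvg_id.
- by apply: gt0_cvgMry => //; exact: cvg_id.
- move=> x; apply: cvgM; last exact: continuous_normal_pdf.
  exact: exprn_continuous.
- by move=> x; rewrite mulr_ge0 ?sqr_ge0 ?normal_pdf_ge0.
Qed.

End Normal.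

Section GaussianMoments.
Context {disp : measure_display} {Omega : measurableType disp} {R : realType}.
Variable P : probability Omega R.

(** Kept as an unevaluated constant: it enters the estimates as the factor [kappa] of the Ito
    isometry. *)
Definition std_second_moment : R :=
  fine (\int[normal_prob 0 (Num.sqrt 1)]_y (y ^+ 2)%:E)%E.

(* [v = 0] is the degenerate case, which [normal_prob] does not cover. *)
Definition centered_gaussian (Y : Omega -> R) (v : R) : Prop :=
  (v = 0 /\ forall w, Y w = 0) \/
  (0 < v /\ forall A, measurable A -> P (Y @^-1` A) = normal_prob 0 (Num.sqrt v) A).

(** Domination by exponentials reduces integrability of the moments to the moment generating
    function. *)
Lemma sqr_le_expR (y : R) : y ^+ 2 <= 4 * (expR y + expR (- y)).
Proof.
wlog y0 : y / 0 <= y => [hw|].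
  have [|y0] := leP 0 y; first exact: hw.
  by have := hw (- y); rewrite oppr_ge0 sqrrN opprK addrC => /(_ (ltW y0)).
have h1 : 1 + y / 2 <= expR (y / 2) by exact: expR_ge1Dx.
have h2 : expR y = expR (y / 2) ^+ 2 by rewrite expr2 -expRD -splitr.
have h3 := expR_ge0 (- y).
rewrite h2; nra.
Qed.

Lemma norm_le_expR (y : R) : `|y| <= expR y + expR (- y).
Proof.
have h1 := expR_ge1Dx y; have h2 := expR_ge1Dx (- y).
have h3 := expR_gt0 y; have h4 := expR_gt0 (- y).
by rewrite ler_norml; apply/andP; split; lra.
Qed.

Variables (Y : {RV P >-> R}) (v : R).
Hypothesis GY : centered_gaussian Y v.
Local Open Scope ereal_scope.

Lemma gaussian_var_ge0 : (0 <= v)%R.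
Proof. by case: GY => [[->]//|[/ltW]]. Qed.

(* The Borel structure of [R] and the one carrying [normal_prob] are distinct
   canonical instances on the same sets, hence the transfer along the identity. *)
Lemma gaussian_integral (f : R -> \bar R) : (0 < v)%R ->
  measurable_fun setT f -> (forall y, 0 <= f y) ->
  \int[distribution P Y]_y f y = \int[normal_prob 0 (Num.sqrt v)]_y f y.
Proof.
move=> v0 mf f0; case: GY => [[v00]|[_ law]]; first by rewrite v00 ltxx in v0.
have mid : measurable_fun [set: measurableTypeR R] (id : measurableTypeR R -> R).
  by move=> _ A mA; rewrite setTI.
pose idm : {mfun (measurableTypeR R) >-> R} :=
  HB.pack (id : measurableTypeR R -> R) (isMeasurableFun.Build _ _ _ _ _ mid).
transitivity (\int[distribution (normal_prob 0 (Num.sqrt v)) idm]_y f y).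
  by apply: eq_measure_integral => A mA _; exact: law.
by rewrite ge0_integral_distribution.
Qed.

Lemma gaussian_integral0 (f : R -> \bar R) : v = 0%R -> measurable_fun setT f ->
  (forall y, 0 <= f y) -> \int[distribution P Y]_y f y = f 0%R.
Proof.
move=> v0 mf f0; case: GY => [[_ Y0]|[]]; last by rewrite v0 ltxx.
rewrite ge0_integral_distribution//.
transitivity (\int[P]_w (cst (f 0%R) w)).
  by apply: eq_integral => w _ /=; rewrite Y0.
by rewrite /= integral_cst//= probability_setT mule1.
Qed.

Let mexp (c : R) : measurable_fun setT (fun y : R => (expR (c * y))%:E).
Proof.
by apply/measurable_EFinP; apply: measurableT_comp => //; exact: mulrl_measurable.
Qed.

Let msqr : measurable_fun setT (fun y : R => (y ^+ 2)%:E).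
Proof. by apply/measurable_EFinP; exact: exprn_measurable. Qed.

Lemma gaussian_mgf (c : R) :
  \int[distribution P Y]_y (expR (c * y))%:E = (expR (c ^+ 2 * v / 2))%:E.
Proof.
have := gaussian_var_ge0; rewrite le_eqVlt => /predU1P[v0|v0].
  rewrite gaussian_integral0//.
  by rewrite -v0 !mulr0 mul0r.
by rewrite gaussian_integral// normal_mgf.
Qed.

Lemma std_second_moment_fin :
  \int[normal_prob 0 (Num.sqrt 1)]_y (y ^+ 2)%:E = (std_second_moment)%:E.
Proof.
rewrite /std_second_moment fineK// ge0_fin_numE; last first.
  by apply: integral_ge0 => y _; rewrite lee_fin sqr_ge0.
apply: (@le_lt_trans _ _ (\int[normal_prob 0 (Num.sqrt 1)]_y
   (4%:E * ((expR (1 * y))%:E + (expR (-1 * y))%:E)))).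
  apply: ge0_le_integral => //.
  - by move=> y _; rewrite lee_fin sqr_ge0.
  - by apply: measurable_funeM; apply: emeasurable_funD; exact: mexp.
  - by move=> y _; rewrite -EFinD -EFinM lee_fin mul1r mulN1r sqr_le_expR.
rewrite ge0_integralZl//.
- rewrite ge0_integralD//.
  + by rewrite !normal_mgf// -EFinD -EFinM ltry.
  + exact: mexp.
  + exact: mexp.
- by apply: emeasurable_funD; exact: mexp.
- by move=> y _; rewrite adde_ge0// lee_fin expR_ge0.
Qed.

Lemma gaussian_sqr :
  \int[distribution P Y]_y (y ^+ 2)%:E = (std_second_moment * v)%:E.
Proof.
have := gaussian_var_ge0; rewrite le_eqVlt => /predU1P[v0|v0].
  rewrite gaussian_integral0//; last by move=> y; rewrite lee_fin sqr_ge0.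
  by rewrite -v0 mulr0 expr2 mulr0.
rewrite gaussian_integral//; last by move=> y; rewrite lee_fin sqr_ge0.
by rewrite normal_second_moment// std_second_moment_fin -EFinM mulrC.
Qed.

Lemma gaussian_sqr_integrable :
  (distribution P Y).-integrable setT (fun y => (y ^+ 2)%:E).
Proof.
apply/integrableP; split => //.
by under eq_integral do rewrite gee0_abs ?lee_fin ?sqr_ge0//; rewrite gaussian_sqr ltry.
Qed.

Lemma gaussian_exp_integrable (c : R) :
  (distribution P Y).-integrable setT (fun y => (expR (c * y))%:E).
Proof.
apply/integrableP; split => //.
by under eq_integral do rewrite gee0_abs ?lee_fin ?expR_ge0//; rewrite gaussian_mgf ltry.
Qed.

Lemma gaussian_integrable : (distribution P Y).-integrable setT (EFin \o (@idfun R)).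
Proof.
have iE : (distribution P Y).-integrable setT
    (fun y => (expR (1 * y))%:E + (expR (-1 * y))%:E).
  by apply: integrableD => //; exact: gaussian_exp_integrable.
apply: le_integrable iE => //.
- exact/measurable_EFinP/measurable_id.
- move=> y _ /=; rewrite lee_fin [leRHS]ger0_norm ?addr_ge0 ?expR_ge0//.
  by rewrite mul1r mulN1r norm_le_expR.
Qed.

(* [c Y <= exp (c Y) - 1] gives [c E Y <= exp (c^2 v / 2) - 1] for every [c];
   let [c] tend to [0] from both sides. *)
Lemma gaussian_mean0 : \int[distribution P Y]_y (y%:E) = 0.
Proof.
have := gaussian_integrable; move=> iY.
have mfin := integrable_fin_num measurableT iY.
set m := \int[distribution P Y]_y (y%:E) in mfin *.
have key (c : R) : (c * fine m <= expR (c ^+ 2 * v / 2) - 1)%R.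
  rewrite -lee_fin EFinM fineK// EFinB -gaussian_mgf -integralZl//.
  rewrite leeBrDr//.
  have -> : \int[distribution P Y]_y (c%:E * y%:E) + 1 =
      \int[distribution P Y]_y (c%:E * y%:E + (1%R : R)%:E).
    rewrite integralD//.
    - by rewrite integral_cst//= probability_setT mule1.
    - exact: integrableZl.
    - exact: finite_measure_integrable_cst.
  apply: le_integral => //.
  - apply: integrableD => //; first exact: integrableZl.
    exact: finite_measure_integrable_cst.
  - exact: gaussian_exp_integrable.
  - by move=> y _; rewrite -EFinM -EFinD lee_fin addrC expR_ge1Dx.
have v0 := gaussian_var_ge0.
have bnd (c : R) : (0 < c -> c ^+ 2 * v <= 1 -> `|fine m| <= c * v)%R.
  move=> c0 cv.
  have h : (expR (c ^+ 2 * v / 2) - 1 <= c ^+ 2 * v)%R.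
    set x := (c ^+ 2 * v / 2)%R.
    have x0 : (0 <= x)%R by rewrite divr_ge0// mulr_ge0// sqr_ge0.
    have x1 : (x <= 1 / 2)%R by rewrite /x; lra.
    have h1 : (expR x * (1 - x) <= 1)%R.
      by have := expR_ge1Dx (- x); rewrite -(ler_pM2l (expR_gt0 x)) -expRD subrr expR0.
    have h2 : (1 <= expR x)%R by rewrite -expR0 ler_expR.
    have -> : (c ^+ 2 * v = 2 * x)%R by rewrite /x; field.
    nra.
  rewrite ler_norml; apply/andP; split.
    rewrite -(ler_pM2l c0); have := key (- c)%R; rewrite sqrrN; nra.
  by rewrite -(ler_pM2l c0); have := key c; nra.
have m0 : fine m = 0%R.
  apply/eqP; rewrite -normr_le0; apply/ler_addgt0Pr => e e0; rewrite add0r.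
  have v1 : (0 < v + 1)%R by lra.
  (* Chosen so that [c <= 1], [c ^+ 2 * v <= 1] and [c * v <= e] all hold, including for [v = 0]. *)
  pose c := (Num.min 1 e / (v + 1))%R.
  have me0 : (0 < Num.min 1 e)%R by rewrite lt_min ltr01.
  have c0 : (0 < c)%R by rewrite divr_gt0.
  have cv1 : (c * (v + 1) = Num.min 1 e)%R by rewrite /c divfK// gt_eqF.
  have h1 : (Num.min 1 e <= 1)%R by rewrite ge_min lexx.
  have h2 : (Num.min 1 e <= e)%R by rewrite ge_min lexx orbT.
  have c1 : (c <= 1)%R by nra.
  apply: le_trans (bnd c c0 _) _; nra.
by rewrite -(fineK mfin) m0.
Qed.

End GaussianMoments.

(** * Brownian motion and its past *)

Section OneBrownianMotion.
Context {disp : measure_display} {Omega : measurableType disp} {R : realType}.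
Variable P : probability Omega R.
Variable B : R -> {RV P >-> R}.
Hypothesis hB : brownian_motion B.
Local Open Scope ereal_scope.

Let preim (Y : Omega -> R) : set (set Omega) := preimage_set_system setT Y measurable.

Lemma preimage_system_measurable (Y : {RV P >-> R}) : preim Y `<=` measurable.
Proof. by move=> _ [C mC <-]; apply: measurable_funP. Qed.

Lemma preimage_system_setI (Y : Omega -> R) : setI_closed (preim Y).
Proof.
move=> _ _ [C mC <-] [D mD <-]; exists (C `&` D); first exact: measurableI.
by rewrite !setTI.
Qed.

Lemma preimage_system_setT (Y : Omega -> R) : preim Y setT.
Proof. by exists setT => //; rewrite setTI. Qed.

(** Slot [0] holds [B 0], which vanishes only almost surely; with it the values of [B] on the grid
    are recovered exactly as partial sums. *)
Let incr (u : nat -> R) (k : nat) : {RV P >-> R} :=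
  if k is k'.+1 then (B (u k'.+1) - B (u k'))%R else B 0.

(** An event of [B 0] has probability 0 or 1, according to whether [C] contains [0], hence is
    independent of everything. *)
Lemma brownian0_indep (C : set R) (A : set Omega) : measurable C -> measurable A ->
  P (B 0 @^-1` C `&` A) = P (B 0 @^-1` C) * P A.
Proof.
move=> mC mA; have [N [mN N0 sN]] := brownian0 hB.
have B0 w : ~ N w -> B 0 w = 0%R by move=> Nw; apply: contrapT => /sN.
have mB : measurable (B 0 @^-1` C) by rewrite -[X in measurable X]setTI; exact: measurable_funP.
have [C0|C0] := pselect (C 0%R).
  have nC : P (~` (B 0 @^-1` C)) = 0.
    apply: subset_measure0 N0 => //; first exact: measurableC.
    by move=> w /= nCw; apply: contrapT => /B0 h; apply: nCw; rewrite h.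
  have P1 : P (B 0 @^-1` C) = 1.
    by have := probability_setC P mB; rewrite nC => /eqP; rewrite eq_sym sube_eq ?fin_num_measure// add0e => /eqP <-.
  rewrite P1 mul1e.
  apply/eqP; rewrite eq_le; apply/andP; split.
    by apply: le_measure; rewrite ?inE//; exact: measurableI.
  have -> : P A = P (B 0 @^-1` C `&` A) + P (~` (B 0 @^-1` C) `&` A).
    rewrite -measureU//; [|exact: measurableI|by apply: measurableI => //; exact: measurableC|].
      by rewrite -setIUl setUv setTI.
    by rewrite setIACA setICr set0I.
  rewrite (@subset_measure0 _ _ _ P (~` (B 0 @^-1` C) `&` A) (~` (B 0 @^-1` C)))//.
  - by rewrite adde0.
  - by apply: measurableI => //; exact: measurableC.
  - exact: measurableC.
have P0 : P (B 0 @^-1` C) = 0.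
  apply: subset_measure0 N0 => // w /= Cw.
  by apply: contrapT => /B0 h; rewrite h in Cw.
rewrite P0 mul0e; apply: subset_measure0 P0 => //; first exact: measurableI.
Qed.

Lemma brownian_grid_indep (n : nat) (u : nat -> R) (s t : R) (C : set R) (A : set Omega) :
  u 0%N = 0%R -> (forall k, (k < n)%N -> u k <= u k.+1)%R -> (u n <= s)%R -> (s <= t)%R ->
  measurable C ->
  <<s \bigcup_(k in [set: 'I_n.+1]) preim (incr u k) >> A ->
  P (A `&` (B t - B s)%R @^-1` C) = P A * P ((B t - B s)%R @^-1` C).
Proof.
move=> u0 umon uns st mC.
have mE : measurable ((B t - B s)%R @^-1` C).
  by rewrite -[X in measurable X]setTI; exact: measurable_funP.
apply: indep_bigcup => //.
- by move=> k; exact: preimage_system_measurable.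
- by move=> k; exact: preimage_system_setI.
- by move=> k; exact: preimage_system_setT.
move=> {}A FA.
(* The grid is prolonged by [s] and [t]. Increment [n], from [u n] to [s], gets the event [setT] in
   [A']; increment [n.+1] is the one under study. *)
pose u' k := if (k <= n)%N then u k else if k == n.+1 then s else t.
have u'E k : (k <= n)%N -> u' k = u k by rewrite /u' => ->.
have u'n1 : u' n.+1 = s by rewrite /u' ltnn eqxx.
have u'n2 : u' n.+2 = t by rewrite /u' ltnNge leqnSn/= eqn_leq ltnn.
have u'mon k : (k < n.+2)%N -> (u' k <= u' k.+1)%R.
  rewrite ltnS leq_eqVlt => /predU1P[->|]; first by rewrite u'n1 u'n2.
  rewrite ltnS leq_eqVlt => /predU1P[->|kn]; first by rewrite u'n1 u'E.
  by rewrite !u'E ?(ltnW kn)//; exact: umon.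
have u'0 : (0 <= u' 0%N)%R by rewrite u'E// u0.
have ind := brownian_indep hB u'0 u'mon.
pose A' (E : set Omega) (k : 'I_n.+2) : set Omega :=
  if (k < n)%N then A (inord k.+1) else if k == n :> nat then setT else E.
have mA k : measurable (A k) by apply: preimage_system_measurable (FA k).
have key (E : set Omega) : preim (B t - B s)%R E ->
    P (\bigcap_i A i `&` E) = P (A ord0) * (\prod_(k < n) P (A (inord k.+1)) * P E).
  move=> FE; have mE' := preimage_system_measurable FE.
  have := FA ord0 => -[C0 mC0 C0E].
  have -> : \bigcap_i A i `&` E = A ord0 `&` \bigcap_(i in [set` [set: 'I_n.+2]%SET]) A' E i.
    apply/seteqP; split=> [w [Aw Ew]|w [A0w Aw]].
      split=> [|k _]; first exact: Aw.
      by rewrite /A'; case: ifP => _; [exact: Aw|case: ifP].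
    split=> [k _|].
      have [k0|k0] := posnP k; first by rewrite (_ : k = ord0)//; apply: val_inj.
      have kn : (k.-1 < n)%N by rewrite -ltnS prednK.
      have := Aw (inord k.-1) (finset.in_setT _); rewrite /A' inordK; last by rewrite ltnS ltnW// ltnS ltnW.
      rewrite kn; congr (A _ w); apply: val_inj => /=.
      by rewrite prednK// inordK.
    have := Aw ord_max (finset.in_setT _); rewrite /A' /=.
    by rewrite ltnNge leqnSn/= eqn_leq ltnn.
  rewrite -C0E setTI brownian0_indep//; last first.
    apply: fin_bigcap_measurable => [|i _]; first exact: finite_finset.
    by rewrite /A'; case: ifP => _ //; case: ifP.
  congr (_ * _).
  rewrite ind; last first.
    move=> i _; rewrite /A'; case: ifPn => [iN|].
      have := FA (inord i.+1); rewrite /incr inordK ?ltnS//.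
      by rewrite !u'E ?(ltnW iN).
    rewrite -leqNgt leq_eqVlt => /predU1P[ni|ni].
      by rewrite -ni eqxx; exact: preimage_system_setT.
    rewrite gtn_eqF//; have -> : i = n.+1 :> nat.
      by apply/eqP; rewrite eqn_leq ni -ltnS ltn_ord.
    by rewrite u'n1 u'n2.
  under eq_bigl do rewrite finset.in_setT.
  rewrite big_ord_recr big_ord_recr/=.
  rewrite {2}/A' /= ltnn eqxx probability_setT mule1.
  rewrite {2}/A' /= ltnNge leqnSn/= eqn_leq ltnn/=.
  by congr (_ * _); apply: eq_bigr => i _; rewrite /A' /= ltn_ord.
rewrite key; last by exists C => //; rewrite setTI.
have := key setT (preimage_system_setT _); rewrite setIT probability_setT mule1 => ->.
by rewrite muleA.
Qed.

Lemma brownian_past_indep (s t : R) (C : set R) (A : set Omega) :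
  (0 <= s)%R -> (s <= t)%R -> measurable C ->
  sigma_process measurable `[0%R, s] (fun u => B u : Omega -> R) A ->
  P (A `&` (B t - B s)%R @^-1` C) = P A * P ((B t - B s)%R @^-1` C).
Proof.
move=> s0 st mC sA.
pose G (l : seq R) := <<s \bigcup_(u in [set` l]) preim (B u) >>.
(* Events depending on finitely many times of [[0, s]] form a pi-system, by concatenation of the
   lists of times. Such a list is then sorted and started at [0] to become a grid. *)
pose PI : set (set Omega) := [set A | exists2 l, {in l, forall u, (0 <= u <= s)%R} & G l A].
have Gmono l l' : {subset l <= l'} -> G l `<=` G l'.
  move=> ll'; apply: sub_smallest2r; first exact: smallest_sigma_algebra.
  by move=> X [x /= xl Xx]; exists x => //=; exact: ll'.
have mG l : G l `<=` measurable.
  apply: smallest_sub; first exact: sigma_algebra_measurable.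
  by move=> X [u _]; exact: preimage_system_measurable.
have : <<s PI >> A.
  apply: (smallest_sub _ _ sA); first exact: smallest_sigma_algebra.
  apply: subset_trans (@sub_sigma_algebra _ _ _) => X [u us FX].
  exists [:: u]; first by move=> v; rewrite inE => /eqP ->; have := us; rewrite /= in_itv/=.
  by apply: sub_sigma_algebra; exists u => //=; rewrite inE.
have mE : measurable ((B t - B s)%R @^-1` C).
  by rewrite -[X in measurable X]setTI; exact: measurable_funP.
apply: indep_pi_system => //.
- by move=> X [l _]; exact: mG.
- move=> X X' [l ls GX] [l' l's GX']; exists (l ++ l').
    by move=> v; rewrite mem_cat => /orP[/ls|/l's].
  have : G (l ++ l') X by apply: Gmono GX => v vl; rewrite mem_cat vl.
  have : G (l ++ l') X' by apply: Gmono GX' => v vl; rewrite mem_cat vl orbT.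
  move=> h1 h2.
  exact: (@measurableI _ (g_sigma_algebraType (\bigcup_(u in [set` l ++ l']) preim (B u))) _ _ h2 h1).
- exists [::] => //.
  exact: (@measurableT _ (g_sigma_algebraType (\bigcup_(u in [set` [::]]) preim (B u)))).
move=> X [l ls GX].
pose u k := nth 0%R (0%R :: sort <=%R l) k.
pose n := size l.
have usize k : (k <= n)%N -> u k \in 0%R :: sort <=%R l.
  by move=> kn; apply: mem_nth; rewrite /= size_sort.
have us k : (k <= n)%N -> (0 <= u k <= s)%R.
  by move=> /usize; rewrite inE mem_sort => /predU1P[->|/ls//]; rewrite lexx.
have so : sorted <=%R (0%R :: sort <=%R l).
  rewrite /= path_min_sorted ?sort_le_sorted//.
  by apply/allP => v; rewrite mem_sort => /ls/andP[].
apply: (@brownian_grid_indep n u) => //.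
- by move=> k kn; move/(sortedP 0%R) : so => /(_ k); apply; rewrite /= size_sort ltnS.
- by have /andP[] := us n (leqnn _).
apply: (smallest_sub _ _ GX); first exact: smallest_sigma_algebra.
pose F := \bigcup_(k in [set: 'I_n.+1]) preim (incr u k); rewrite -/F.
pose TF := g_sigma_algebraType F.
(* By summation of increments, the values on the grid generate no more than [B 0] and the increments
   do. *)
have mu k : (k <= n)%N -> measurable_fun [set: TF] (B (u k) : TF -> R).
  have mincr i : (i <= n)%N -> measurable_fun [set: TF] (incr u i : TF -> R).
    move=> iN _ D mD; apply: sub_sigma_algebra; exists (inord i : 'I_n.+1) => //.
    by exists D => //; rewrite inordK.
  elim: k => [_|k ih kn]; first by rewrite [u 0%N]/=; exact: (mincr 0%N).
  rewrite (_ : (B (u k.+1) : TF -> R) = (fun w => B (u k) w + incr u k.+1 w)%R); last first.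
    by apply/funext => w; rewrite /incr /= subrKC.
  by apply: measurable_funD; [apply: ih; exact: ltnW|exact: mincr].
move=> Z [v /= vl [D mD <-]].
have [k kn ->] : exists2 k, (k <= n)%N & v = u k.
  exists (index v (sort <=%R l)).+1; first by rewrite /n -(size_sort <=%R) index_mem mem_sort.
  by rewrite /u /= nth_index// mem_sort.
exact: mu.
Qed.

End OneBrownianMotion.

(** * Joint past of the chain and of the noises *)

Section PastIndependence.
Context {disp : measure_display} {Omega : measurableType disp} {R : realType}.
Variables (P : probability Omega R) (d J : nat) (Q : 'M[R]_d).
Variables (X : R -> Omega -> 'I_d) (B : 'I_J -> R -> {RV P >-> R}).
Hypothesis hX : markov_chain P Q X.
Hypothesis hB : forall j, brownian_motion (B j).
Hypothesis hXB : mutual_independence P (chain_and_noises X B `[0, +oo[).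
Local Open Scope ereal_scope.

(** Only component [Some j] is stopped at [s]; the chain and the other noises are revealed at all
    times. *)
Definition past (j : 'I_J) (s : R) (c : option 'I_J) : set (set Omega) :=
  chain_and_noises X B (if c == Some j then `[0%R, s]%classic else `[0%R, +oo[%classic) c.

Definition past_system (j : 'I_J) (s : R) : set (set Omega) := \bigcup_c past j s c.

Lemma chain_and_noises_measurable (D : set R) (c : option 'I_J) :
  D `<=` `[0%R, +oo[ -> chain_and_noises X B D c `<=` measurable.
Proof.
move=> D0; case: c => [j|] /=; apply: smallest_sub;
  try exact: sigma_algebra_measurable.
- by move=> A [u _]; exact: preimage_system_measurable.
- move=> A [u Du [C _ <-]]; rewrite setTI.
  rewrite (_ : X u @^-1` C = \bigcup_(i in C) (X u @^-1` [set i])); last first.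
    by apply/seteqP; split=> [w Cw|w [i Ci /= wi]]; [exists (X u w)|rewrite /= wi].
  apply: fin_bigcup_measurable => [|i _]; first exact: finite_finset.
  by apply: (chain_measurable hX); have := D0 _ Du; rewrite /= in_itv/= andbT.
Qed.

Lemma chain_and_noises_mono (D D' : set R) (c : option 'I_J) :
  D `<=` D' -> chain_and_noises X B D c `<=` chain_and_noises X B D' c.
Proof.
move=> DD'; case: c => [j|]; apply: sub_smallest2r;
  by [exact: smallest_sigma_algebra|move=> A [u Du FA]; exists u => //; exact: DD'].
Qed.

Lemma chain_and_noises_setI (D : set R) (c : option 'I_J) :
  setI_closed (chain_and_noises X B D c).
Proof. by case: c => [j|] A A'; exact: (@measurableI _ (g_sigma_algebraType _)). Qed.

Lemma chain_and_noises_setT (D : set R) (c : option 'I_J) :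
  chain_and_noises X B D c setT.
Proof. by case: c => [j|]; exact: (@measurableT _ (g_sigma_algebraType _)). Qed.

Lemma past_measurable (j : 'I_J) (s : R) (c : option 'I_J) :
  past j s c `<=` measurable.
Proof.
apply: chain_and_noises_measurable; case: ifP => _ //.
by move=> u /=; rewrite !in_itv/= andbT => /andP[].
Qed.

Lemma past_system_measurable (j : 'I_J) (s : R) : past_system j s `<=` measurable.
Proof. by move=> A [c _]; exact: past_measurable. Qed.

Lemma natural_filtration_past (j : 'I_J) (s : R) :
  natural_filtration X B s `<=` <<s past_system j s >>.
Proof.
apply: sub_smallest2r; first exact: smallest_sigma_algebra.
move=> A [c _ cA]; exists c => //; move: cA; rewrite /past; case: ifP => _ //.
by apply: chain_and_noises_mono => u /=; rewrite !in_itv/= andbT => /andP[].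
Qed.

Lemma past_mono (j : 'I_J) (s t : R) : (s <= t)%R ->
  <<s past_system j s >> `<=` <<s past_system j t >>.
Proof.
move=> st; apply: sub_smallest2r; first exact: smallest_sigma_algebra.
move=> A [c _ cA]; exists c => //; move: cA; rewrite /past; case: ifP => _ //.
apply: chain_and_noises_mono => u /=; rewrite !in_itv/= => /andP[-> us].
exact: le_trans us st.
Qed.

Lemma past_indep (j : 'I_J) (s t : R) (C : set R) (A : set Omega) :
  (0 <= s)%R -> (s <= t)%R -> <<s past_system j s >> A -> measurable C ->
  P (A `&` (B j t - B j s)%R @^-1` C) = P A * P ((B j t - B j s)%R @^-1` C).
Proof.
move=> s0 st sA mC; have t0 := le_trans s0 st.
have sub0 : `[0%R, s] `<=` `[0%R, +oo[.
  by move=> u /=; rewrite !in_itv/= andbT => /andP[].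
set E := _ @^-1` C.
have mE : measurable E by rewrite -[X in measurable X]setTI; exact: measurable_funP.
apply: (@indep_bigcup _ _ _ P (option 'I_J) (past j s)) => //.
- by move=> c; exact: past_measurable.
- by move=> c; exact: chain_and_noises_setI.
- by move=> c; exact: chain_and_noises_setT.
move=> {sA}A FA.
have pastS c : chain_and_noises X B `[0%R, +oo[ c (A c).
  by apply: (chain_and_noises_mono _ (FA c)); case: ifP => _ //.
have jE : chain_and_noises X B `[0%R, +oo[ (Some j) E.
  have mBT u : (0 <= u)%R -> measurable_fun
      [set: g_sigma_algebraType (\bigcup_(v in `[0%R, +oo[) preimage_set_system setT (B j v) measurable)] (B j u).
    move=> u0 _ D mD; rewrite setTI; apply: sub_sigma_algebra; exists u.
      by rewrite /= in_itv/= andbT.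
    by exists D => //; rewrite setTI.
  have := measurable_funB (mBT t t0) (mBT s s0).
  by move=> /(_ measurableT C mC); rewrite setTI.
have mA c : measurable (A c) by apply: past_measurable (FA c).
(* The increment is an event of component [Some j]. Mutual independence, applied to [A] and to [A'],
   leaves a single factor to compare, the one settled by [brownian_past_indep]. *)
pose A' c := if c == Some j then A c `&` E else A c.
have -> : \bigcap_i A i `&` E = \bigcap_(i in [set` [set: option 'I_J]%SET]) A' i.
  apply/seteqP; split=> [w [Aw Ew] c _|w Aw].
    by rewrite /A'; case: ifP => _; [split => //|]; exact: Aw.
  split=> [c _|].
    by have := Aw c (finset.in_setT _); rewrite /A'; case: ifP => // _ [].
  by have := Aw (Some j) (finset.in_setT _); rewrite /A' eqxx => -[].
have -> : \bigcap_i A i = \bigcap_(i in [set` [set: option 'I_J]%SET]) A i.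
  by apply/seteqP; split=> w Aw c _; apply: Aw => //; exact: finset.in_setT.
rewrite !hXB => [|c _|c _]; last 2 first.
- exact: pastS.
- rewrite /A'; case: eqP => [->|_]; last exact: pastS.
  by apply: chain_and_noises_setI => //; exact: pastS.
rewrite (bigD1 (Some j)) ?finset.in_setT//= [in RHS](bigD1 (Some j)) ?finset.in_setT//=.
rewrite /A' eqxx (brownian_past_indep (hB j) s0 st mC); last first.
  by have := FA (Some j); rewrite /past eqxx.
rewrite muleAC; congr (_ * _ * _).
by apply: eq_bigr => c /andP[_ /negbTE ->].
Qed.

End PastIndependence.

(** * The Ito isometry *)

Section IntegralNonMeasurable.
Context {d} {T : measurableType d} {R : realType}.
Variable mu : {measure set T -> \bar R}.
Local Open Scope ereal_scope.
Import HBNNSimple.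

(** The integral of a nonnegative function is a supremum over the simple functions below it, so
    monotonicity holds for arbitrary functions. *)
Lemma ge0_le_integral_nonmeasurable (f g : T -> \bar R) :
  (forall x, 0 <= f x) -> (forall x, f x <= g x) ->
  \int[mu]_x f x <= \int[mu]_x g x.
Proof.
move=> f0 fg; rewrite !ge0_integralTE// => [|x]; last exact: le_trans (f0 x) (fg x).
apply: le_ereal_sup => _ [h hf <-]; exists h => // x.
exact: le_trans (hf x) (fg x).
Qed.

(* [g] need not be measurable: inner Lebesgue integrals of the data are only
   known to be measurable up to null sets *)
Lemma ae_ge0_le_integral_nonmeasurable (f g : T -> \bar R) :
  measurable_fun setT f -> (forall x, 0 <= f x) -> (forall x, 0 <= g x) ->
  {ae mu, forall x, f x <= g x} -> \int[mu]_x f x <= \int[mu]_x g x.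
Proof.
move=> mf f0 g0 [N [mN N0 sN]].
have -> : \int[mu]_x f x = \int[mu]_x (f \_ (~` N)) x.
  transitivity (\int[mu]_(x in ~` N) f x); last exact: integral_mkcond.
  by rewrite -setTD; apply: ge0_negligible_integral.
apply: ge0_le_integral_nonmeasurable => x; first by rewrite patchE; case: ifP.
rewrite patchE; case: ifP => // /set_mem Nx.
by apply: contrapT => /sN.
Qed.

End IntegralNonMeasurable.

Lemma lebesgue_segment_lty (R : realType) (a b : R) :
  (lebesgue_measure `[a, b]%classic < +oo)%E.
Proof. by rewrite lebesgue_measure_itv/=; case: ifP; rewrite ?ltry// -EFinD ltry. Qed.

Section BrownianFiltration.
Context {disp : measure_display} {Omega : measurableType disp} {R : realType}.
Variable P : probability Omega R.
Local Open Scope ereal_scope.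

(** [G s] is a generating family rather than a sigma-algebra, since it is later instantiated by
    [past_system j s]. *)
Record brownian_wrt (W : R -> {RV P >-> R}) (G : R -> set (set Omega)) : Prop := {
  wrt_measurable : forall s, G s `<=` measurable;
  wrt_mono : forall s t, (s <= t)%R -> <<s G s >> `<=` <<s G t >>;
  wrt_adapted : forall u s, (0 <= u)%R -> (u <= s)%R ->
    measurable_fun [set: g_sigma_algebraType (G s)] (W u : g_sigma_algebraType (G s) -> R);
  wrt_gaussian : forall s t, (0 <= s)%R -> (s <= t)%R ->
    centered_gaussian P (W t - W s)%R (t - s);
  wrt_indep : forall s t A C, (0 <= s)%R -> (s <= t)%R -> <<s G s >> A -> measurable C ->
    P (A `&` (W t - W s)%R @^-1` C) = P A * P ((W t - W s)%R @^-1` C) }.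

Definition adapted_at (G : set (set Omega)) (V : Omega -> R) : Prop :=
  measurable_fun [set: g_sigma_algebraType G] (V : g_sigma_algebraType G -> R).

Variables (W : R -> {RV P >-> R}) (G : R -> set (set Omega)).
Hypothesis hW : brownian_wrt W G.
Let kappa : R := @std_second_moment R.

Lemma adapted_mono (s t : R) (V : Omega -> R) : (s <= t)%R ->
  adapted_at (G s) V -> adapted_at (G t) V.
Proof.
move=> st mV _ C mC; apply: (wrt_mono hW st); exact: (mV measurableT C mC).
Qed.

Lemma adapted_measurable (s : R) (V : Omega -> R) : adapted_at (G s) V ->
  measurable_fun setT V.
Proof. exact: (sub_measurable_fun (wrt_measurable hW (s := s))). Qed.

Lemma adapted_incr (s t : R) : (0 <= s)%R -> (s <= t)%R -> adapted_at (G t) (W t - W s)%R.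
Proof.
move=> s0 st; apply: measurable_funB; apply: (wrt_adapted hW) => //.
exact: le_trans st.
Qed.

Section OneIncrement.
Variables (s t : R).
Hypotheses (s0 : (0 <= s)%R) (st : (s <= t)%R).
Notation Y := (W t - W s)%R.

Let indY A C (sA : <<s G s >> A) (mC : measurable C) := wrt_indep hW s0 st sA mC.
Let GY := wrt_gaussian hW s0 st.

(** The coefficient [Xi] may be random: it is frozen with [V], and the inner integral is the
    Gaussian moment generating function at [Xi w]. *)
Lemma increment_exp (V Xi : Omega -> R) : adapted_at (G s) V -> adapted_at (G s) Xi ->
  (forall w, (0 <= V w)%R) ->
  \int[P]_w (V w * expR (Xi w * Y w))%:E =
  \int[P]_w (V w * expR (Xi w ^+ 2 * (t - s) / 2))%:E.
Proof.
move=> mV mX V0.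
pose TG := g_sigma_algebraType (G s).
pose f (z : TG * R) : \bar R := (V z.1 * expR (Xi z.1 * z.2))%:E.
have mf : measurable_fun setT f.
  apply/measurable_EFinP; apply: measurable_funM.
    exact: (measurableT_comp mV (@measurable_fst _ _ TG R)).
  apply: measurableT_comp => //; apply: measurable_funM.
    exact: (measurableT_comp mX (@measurable_fst _ _ TG R)).
  exact: measurable_snd.
transitivity (\int[P]_w f (w, Y w)) => //.
rewrite (freezing (wrt_measurable hW (s := s)) indY mf); last first.
  by move=> z; rewrite lee_fin mulr_ge0 ?expR_ge0.
apply: eq_integral => w _; rewrite /f/= EFinM -(gaussian_mgf GY).
rewrite -ge0_integralZl//; last by rewrite lee_fin.
by apply/measurable_EFinP; apply: measurableT_comp => //; exact: mulrl_measurable.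
Qed.

Lemma increment_mean (V : Omega -> R) : adapted_at (G s) V ->
  P.-integrable setT (EFin \o V) ->
  P.-integrable setT (fun w => (V w * Y w)%:E) /\ \int[P]_w (V w * Y w)%:E = 0.
Proof.
move=> mV iV.
have [iVY ->] := indep_integralM (wrt_measurable hW (s := s)) indY mV
  (@measurable_id _ _ setT) iV (gaussian_integrable GY).
by rewrite [X in _ * X](gaussian_mean0 GY) mule0.
Qed.

Lemma increment_sqr (V : Omega -> R) : adapted_at (G s) V ->
  P.-integrable setT (EFin \o V) ->
  P.-integrable setT (fun w => (V w * Y w ^+ 2)%:E) /\
  \int[P]_w (V w * Y w ^+ 2)%:E = (kappa * (t - s))%:E * \int[P]_w (V w)%:E.
Proof.
move=> mV iV.
have [iVY ->] := indep_integralM (wrt_measurable hW (s := s)) indY mV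
  (@exprn_measurable _ setT 2) iV (gaussian_sqr_integrable GY).
by rewrite [X in _ * X](gaussian_sqr GY) muleC.
Qed.

End OneIncrement.

Definition bounded_rv (V : Omega -> R) : Prop := exists c, forall w, (`|V w| <= c)%R.

Lemma bounded_integrable (V : Omega -> R) : measurable_fun setT V -> bounded_rv V ->
  P.-integrable setT (EFin \o V).
Proof.
move=> mV [c Vc]; apply: measurable_bounded_integrable => //.
  by rewrite (le_lt_trans (probability_le1 _ _))// ltry.
by exists c; split; [exact: num_real|move=> x cx w _; exact: le_trans (Vc w) (ltW cx)].
Qed.

Lemma bounded_rvM (V V' : Omega -> R) : bounded_rv V -> bounded_rv V' ->
  bounded_rv (fun w => V w * V' w)%R.
Proof.
move=> [c Vc] [c' Vc']; exists (c * c')%R => w; rewrite normrM.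
by apply: ler_pM.
Qed.

Definition overlap (s t s' t' : R) : R :=
  (Num.max 0 (Num.min t t' - Num.max s s'))%R.

Lemma overlapC s t s' t' : overlap s t s' t' = overlap s' t' s t.
Proof. by rewrite /overlap [Num.min t t']minC [Num.max s s']maxC. Qed.

Let cov_le (s t s' t' : R) (xi eta : Omega -> R) :
  (0 <= s)%R -> (s <= t)%R -> (s <= s')%R -> (s' <= t')%R ->
  adapted_at (G s) xi -> adapted_at (G s') eta -> bounded_rv xi -> bounded_rv eta ->
  P.-integrable setT (fun w => (xi w * (W t - W s) w * (eta w * (W t' - W s') w))%:E) /\
  \int[P]_w (xi w * (W t - W s) w * (eta w * (W t' - W s') w))%:E =
  (kappa * overlap s t s' t')%:E * \int[P]_w (xi w * eta w)%:E.
Proof.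
move=> s0 st ss' st' mxi meta bxi beta.
have s'0 : (0 <= s')%R by exact: le_trans ss'.
have mV : adapted_at (G s') (fun w => xi w * eta w)%R.
  by apply: measurable_funM => //; exact: adapted_mono mxi.
have iV : P.-integrable setT (EFin \o (fun w => xi w * eta w)%R).
  by apply: bounded_integrable (bounded_rvM bxi beta); exact: adapted_measurable mV.
have incr_int (a b : R) (xi' : Omega -> R) : (0 <= a)%R -> (a <= b)%R -> adapted_at (G a) xi' ->
    P.-integrable setT (EFin \o xi') -> P.-integrable setT (EFin \o (fun w => xi' w * (W b - W a) w)%R).
  by move=> a0 ab mx' ix'; have [] := increment_mean a0 ab mx' ix'.
have mxe (a : R) : (s' <= a)%R -> adapted_at (G a) (fun w => xi w * eta w)%R.
  by move=> s'a; exact: adapted_mono mV.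
have bmulr (a : R) (xi' V : Omega -> R) : bounded_rv xi' -> adapted_at (G a) xi' ->
    P.-integrable setT (EFin \o V) -> P.-integrable setT (EFin \o (fun w => V w * xi' w)%R).
  move=> [c xc] mx' iV'; apply: (integrableMl measurableT iV').
    exact: adapted_measurable mx'.
  by exists c; split; [exact: num_real|move=> x cx w _; exact: le_trans (xc w) (ltW cx)].
have mxi1 := adapted_measurable mxi.
have ixi := bounded_integrable mxi1 bxi.
(* If the first interval ends before the second begins, the second increment is centred given all
   the other factors. *)
have [ts'|s't] := leP t s'.
  have -> : overlap s t s' t' = 0%R.
    by rewrite /overlap; apply/max_idPl; rewrite subr_le0 ge_min le_max ts' orbT.
  pose V w := (xi w * (W t - W s)%R w * eta w)%R.
  have mV1 : adapted_at (G s') V.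
    apply: measurable_funM => //; apply: measurable_funM.
      exact: adapted_mono mxi.
    by apply: adapted_mono ts' _; exact: adapted_incr.
  have iV1 : P.-integrable setT (EFin \o V).
    by apply: bmulr beta meta _; exact: incr_int.
  have [h1 h2] := increment_mean s'0 st' mV1 iV1.
  have E w : (xi w * (W t - W s)%R w * (eta w * (W t' - W s')%R w) = V w * (W t' - W s')%R w)%R.
    by rewrite /V mulrA.
  split; first by apply: eq_integrable h1 => // w _; rewrite E.
  under eq_integral do rewrite E.
  by rewrite h2 mulr0 mul0e.
(* The overlap is [[s', m]]. Splitting both increments at [s'] and [m] leaves a square over the
   overlap, terms with a centred last factor, and [(W t - W m) (W t' - W m)], which vanishes because
   [m] is [t] or [t']. *)
pose m := Num.min t t'.
have s'm : (s' <= m)%R by rewrite le_min (ltW s't).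
have mt : (m <= t)%R by rewrite ge_min lexx.
have mt' : (m <= t')%R by rewrite ge_min lexx orbT.
have m0 : (0 <= m)%R by exact: le_trans s'm.
have -> : overlap s t s' t' = (m - s')%R.
  by rewrite /overlap -/m (max_idPr ss') (max_idPr _)// subr_ge0.
have mWE a b : (W b - W a)%R = (fun w => W b w - W a w)%R :> (Omega -> R) by [].
pose V1 w := (xi w * eta w * (W s' - W s)%R w)%R.
pose V2 w := (xi w * eta w * (W m - W s')%R w)%R.
have mV1 : adapted_at (G s') V1 by apply: measurable_funM => //; exact: adapted_incr.
have mV2 : adapted_at (G m) V2.
  by apply: measurable_funM; [exact: adapted_mono s'm _|exact: adapted_incr].
have iV1 : P.-integrable setT (EFin \o V1).
  have h := bmulr _ _ _ beta meta (incr_int s s' xi s0 ss' mxi ixi).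
  by apply: eq_integrable h => // w _; rewrite /= /V1 mulrAC.
have iV2 : P.-integrable setT (EFin \o V2) by exact: incr_int.
have [i1 e1] := increment_mean s'0 st' mV1 iV1.
have [i2 e2] := increment_sqr s'0 s'm mV iV.
have [i3 e3] := increment_mean m0 mt' mV2 iV2.
have [i4 e4] := increment_mean m0 mt mV2 iV2.
have b34 w : ((W t - W m)%R w * (W t' - W m)%R w = 0)%R.
  rewrite /m; case: (leP t t') => _; rewrite !mWE subrr ?mul0r ?mulr0//.
have E w : (xi w * (W t - W s)%R w * (eta w * (W t' - W s')%R w))%:E =
    (V1 w * (W t' - W s')%R w)%:E + ((xi w * eta w * (W m - W s')%R w ^+ 2)%:E +
    ((V2 w * (W t' - W m)%R w)%:E + (V2 w * (W t - W m)%R w)%:E)).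
  rewrite -!EFinD; congr EFin.
  have := b34 w; rewrite /V1 /V2 !mWE => h.
  transitivity (xi w * (W t w - W s w) * (eta w * (W t' w - W s' w))
     - xi w * eta w * ((W t w - W m w) * (W t' w - W m w)))%R; first by rewrite h mulr0 subr0.
  ring.
have i34 := integrableD measurableT i3 i4.
have i234 := integrableD measurableT i2 i34.
split.
  by apply: eq_integrable (integrableD measurableT i1 i234).
under eq_integral do rewrite E.
rewrite integralD// integralD// integralD// e1 e2 e3 e4 !adde0 add0e.
by rewrite EFinM.
Qed.

Lemma increment_cov (s t s' t' : R) (xi eta : Omega -> R) :
  (0 <= s)%R -> (s <= t)%R -> (0 <= s')%R -> (s' <= t')%R ->
  adapted_at (G s) xi -> adapted_at (G s') eta -> bounded_rv xi -> bounded_rv eta ->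
  P.-integrable setT (fun w => (xi w * (W t - W s)%R w * (eta w * (W t' - W s')%R w))%:E) /\
  \int[P]_w (xi w * (W t - W s)%R w * (eta w * (W t' - W s')%R w))%:E =
  (kappa * overlap s t s' t')%:E * \int[P]_w (xi w * eta w)%:E.
Proof.
move=> s0 st s'0 st' mx me bx be; have [ss'|/ltW s's] := leP s s'; first exact: cov_le.
have [h1 h2] := @cov_le s' t' s t eta xi s'0 st' s's st me mx be bx.
split; first by apply: eq_integrable h1 => // w _; rewrite mulrC.
under eq_integral do rewrite mulrC.
by rewrite h2 overlapC; under eq_integral do rewrite mulrC.
Qed.

Lemma integral_overlap (s t s' t' T : R) : (0 <= s)%R -> (s <= t)%R -> (t <= T)%R ->
  (0 <= s')%R -> (s' <= t')%R -> (t' <= T)%R ->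
  \int[lebesgue_measure]_(u in `[0%R, T]) (\1_(`]s, t]) u * \1_(`]s', t']) u)%:E =
  (overlap s t s' t')%:E.
Proof.
move=> s0 st tT s'0 st' tT'.
have mt : measurable `]Num.max s s', Num.min t t'] by [].
rewrite (eq_integral (fun u : measurableTypeR R => (\1_(`]Num.max s s', Num.min t t']) u : R)%:E)); last first.
  move=> u _; congr EFin.
  have <- : `]s, t] `&` `]s', t'] = `]Num.max s s', Num.min t t']%classic.
    apply/seteqP; split => [v [/=]|v /=]; rewrite !in_itv/= gt_max le_min.
      by move=> /andP[-> ->] /andP[-> ->].
    by move=> /andP[/andP[-> ->] /andP[-> ->]].
  by rewrite indicI.
rewrite integral_indic// setIidl; last first.
  move=> v /=; rewrite !in_itv/= gt_max le_min => /andP[/andP[sv _] /andP[vt _]].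
  by rewrite (le_trans vt tT) andbT ltW// (le_lt_trans s0).
rewrite /= lebesgue_measure_itv/= lte_fin /overlap.
case: (ltP (Num.max s s') (Num.min t t')) => h.
  rewrite -EFinD; congr EFin; apply/esym.
  by apply/max_idPr; rewrite subr_ge0 ltW.
by congr EFin; apply/esym/max_idPl; rewrite subr_le0.
Qed.

(* No common refinement of the two partitions is needed: the covariance of two
   stochastic increments only involves the overlap of the time intervals. *)
Lemma ito_isometry (N : nat) (T : R) (a b : nat -> R) (xi : nat -> Omega -> R) :
  (forall k, (k < N)%N -> [/\ 0 <= a k, a k <= b k & b k <= T]%R) ->
  (forall k, (k < N)%N -> adapted_at (G (a k)) (xi k)) ->
  (forall k, (k < N)%N -> bounded_rv (xi k)) ->
  exists Z : Omega -> R, [/\ measurable_fun setT Z,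
    forall w, (Z w)%:E = \int[lebesgue_measure]_(u in `[0%R, T])
      ((\sum_(k < N) xi k w * \1_(`]a k, b k]) u) ^+ 2)%:E &
    \int[P]_w ((\sum_(k < N) xi k w * (W (b k) - W (a k))%R w) ^+ 2)%:E =
    kappa%:E * \int[P]_w (Z w)%:E].
Proof.
move=> ab mxi bxi.
pose ov (p : 'I_N * 'I_N) := overlap (a p.1) (b p.1) (a p.2) (b p.2).
have mx (k : 'I_N) : measurable_fun setT (xi k).
  by apply: adapted_measurable; exact: mxi.
have sqE (x : 'I_N -> R) : ((\sum_k x k) ^+ 2 = \sum_(p : 'I_N * 'I_N) x p.1 * x p.2)%R.
  rewrite expr2 mulr_suml; under eq_bigr do rewrite mulr_sumr.
  by rewrite pair_big.
have ixx (p : 'I_N * 'I_N) : P.-integrable setT (fun w => (xi p.1 w * xi p.2 w)%:E).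
  apply: (bounded_integrable (V := fun w => xi p.1 w * xi p.2 w)%R).
    exact: measurable_funM.
  by apply: bounded_rvM; exact: bxi.
(* The pathwise squared norm in closed form, a quadratic form in the coefficients; this makes it
   visibly measurable in [w]. *)
exists (fun w => \sum_(p : 'I_N * 'I_N) ov p * (xi p.1 w * xi p.2 w))%R; split.
- apply: measurable_sum => p; apply: measurable_funM => //.
  exact: measurable_funM.
- move=> w; under eq_integral do rewrite sqE -sumEFin.
  have iov (p : 'I_N * 'I_N) : lebesgue_measure.-integrable `[0%R, T]
      (fun u => (\1_(`]a p.1, b p.1]) u * \1_(`]a p.2, b p.2]) u : R)%:E).
    apply: measurable_bounded_integrable => //.
    - exact: lebesgue_segment_lty.
    - by apply: measurable_funM; exact: measurable_indic.
    - exists 1%R; split; first exact: num_real.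
      move=> x x1 u _; apply: le_trans (ltW x1); rewrite !indicE.
      by case: (_ \in _); case: (_ \in _); rewrite ?mulr0 ?mul0r ?mulr1 ?normr1 ?normr0.
  rewrite -sumEFin.
  have tE (p : 'I_N * 'I_N) u : (xi p.1 w * \1_(`]a p.1, b p.1]) u * (xi p.2 w * \1_(`]a p.2, b p.2]) u))%:E =
     (xi p.1 w * xi p.2 w)%:E * (\1_(`]a p.1, b p.1]) u * \1_(`]a p.2, b p.2]) u : R)%:E.
    by rewrite -EFinM mulrACA.
  under eq_integral do under eq_bigr do rewrite tE.
  rewrite integral_sum//; last by move=> p; exact: integrableZl.
  apply: eq_bigr => p _; rewrite integralZl// integral_overlap//; last 6 first.
  + by have [] := ab p.1 (ltn_ord _).
  + by have [] := ab p.1 (ltn_ord _).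
  + by have [] := ab p.1 (ltn_ord _).
  + by have [] := ab p.2 (ltn_ord _).
  + by have [] := ab p.2 (ltn_ord _).
  + by have [] := ab p.2 (ltn_ord _).
  by rewrite -EFinM mulrC.
have cov (p : 'I_N * 'I_N) : P.-integrable setT (fun w => (xi p.1 w * (W (b p.1) - W (a p.1))%R w *
      (xi p.2 w * (W (b p.2) - W (a p.2))%R w))%:E) /\
    \int[P]_w (xi p.1 w * (W (b p.1) - W (a p.1))%R w *
      (xi p.2 w * (W (b p.2) - W (a p.2))%R w))%:E =
    (kappa * ov p)%:E * \int[P]_w (xi p.1 w * xi p.2 w)%:E.
  have [a1 ab1 _] := ab p.1 (ltn_ord _); have [a2 ab2 _] := ab p.2 (ltn_ord _).
  by apply: increment_cov => //; [exact: mxi|exact: mxi|exact: bxi|exact: bxi].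
under eq_integral do rewrite sqE -sumEFin.
rewrite integral_sum//; last by move=> p; have [] := cov p.
under eq_bigr => p _ do rewrite (cov p).2 EFinM -muleA.
have fin (p : 'I_N * 'I_N) := integrable_fin_num measurableT (ixx p).
under [in RHS]eq_integral do rewrite -sumEFin.
rewrite integral_sum//; last by move=> p; exact: (integrableZl measurableT (ov p) (ixx p)).
rewrite (eq_bigr (fun p => (kappa * (ov p * fine (\int[P]_w (xi p.1 w * xi p.2 w)%:E)))%:E)); last first.
  by move=> p _; rewrite [RHS]EFinM; congr *%E; rewrite [RHS]EFinM fineK.
rewrite sumEFin -mulr_sumr EFinM -sumEFin; congr *%E; apply: eq_bigr => p _.
by rewrite [LHS]EFinM fineK// -integralZl.
Qed.

End BrownianFiltration.

Lemma cvg0_lt (R : realType) (a : nat -> \bar R) (e : R) :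
  a n @[n --> \oo] --> 0%E -> 0 < e -> \forall n \near \oo, (a n < e%:E)%E.
Proof.
move=> a0 e0; apply: (a0 [set x | (x < e%:E)%E]); apply: open_nbhs_nbhs; split; last by rewrite /= lte_fin.
exact: open_ereal_lt_ereal.
Qed.

(** * Distance from an Ito integral to a simple integral *)

Section ItoIntegralNear.
Context {disp : measure_display} {Omega : measurableType disp} {R : realType}.
Variables (P : probability Omega R) (W : R -> {RV P >-> R}) (G : R -> set (set Omega)).
Hypothesis hW : brownian_wrt W G.
Let kappa : R := @std_second_moment R.

Lemma admissible_times (F : R -> set (set Omega)) (T : R) (H : simple_process) :
  admissible F T H -> forall k, (k < sp_size H)%N ->
    [/\ 0 <= sp_time H k, sp_time H k <= sp_time H k.+1 & sp_time H k.+1 <= T].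
Proof.
move=> [t0 tT tm _ _] k kn.
have lo i : (i <= sp_size H)%N -> 0 <= sp_time H i.
  elim: i => // i ih iN; apply: le_trans (tm _ iN); exact/ih/ltnW.
have hi i : (i <= sp_size H)%N -> sp_time H (sp_size H - i)%N <= T.
  elim: i => [|i ih iN]; first by rewrite subn0.
  apply: le_trans (ih (ltnW iN)); rewrite -(subnSK iN); apply: tm.
  by rewrite subnSK// leq_subr.
split; [exact/lo/ltnW|exact: tm|].
by have := hi (sp_size H - k.+1)%N (leq_subr _ _); rewrite subKn.
Qed.

Variables (F : R -> set (set Omega)) (T : R).
Hypothesis FG : forall s, F s `<=` <<s G s >>.

Lemma simple_sub_isometry (H K : simple_process) :
  admissible F T H -> admissible F T K ->
  exists Z : Omega -> R, [/\ measurable_fun setT Z,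
    forall w, ((Z w)%:E = \int[lebesgue_measure]_(u in `[0%R, T])
      ((sp_eval H u w - sp_eval K u w) ^+ 2)%:E)%E &
    (\int[P]_w ((sp_integral (fun u => W u : Omega -> R) H w
      - sp_integral (fun u => W u : Omega -> R) K w) ^+ 2)%:E =
    kappa%:E * \int[P]_w (Z w)%:E)%E].
Proof.
move=> aH aK; have tH := admissible_times aH; have tK := admissible_times aK.
case: aH => _ _ _ cH bH; case: aK => _ _ _ cK bK.
set n := sp_size H in tH cH bH; set m := sp_size K in tK cK bK.
(* The difference is one sum over [n + m] intervals, those of [H] followed by those of [K] with the
   sign of the coefficients reversed. *)
pose a k := if (k < n)%N then sp_time H k else sp_time K (k - n).
pose b k := if (k < n)%N then sp_time H k.+1 else sp_time K (k - n).+1.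
pose xi k := if (k < n)%N then sp_coef H k else fun w => - sp_coef K (k - n) w.
have kmn k : (k < n + m)%N -> (k < n)%N = false -> (k - n < m)%N.
  by move=> kN /negbT; rewrite -leqNgt => nk; rewrite ltn_subLR.
have mcoef (s : R) (V : Omega -> R) : preimage_set_system setT V measurable `<=` F s ->
    adapted_at (G s) V.
  by move=> VF _ C mC; apply: FG; apply: VF; exists C.
have [k kN|k kN|k kN|Z [mZ ZE IZ]] := @ito_isometry _ _ _ P W G hW (n + m) T a b xi.
- rewrite /a /b; case: ifPn => [/tH//|/negbTE kn]; exact: tK (kmn _ kN kn).
- rewrite /a /xi; case: ifPn => [kn|/negbTE kn]; first by apply: mcoef; exact: cH.
  by apply: measurable_funN; apply: mcoef; apply: cK; exact: kmn.
- rewrite /xi; case: ifPn => [kn|/negbTE kn].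
    by have [c cE] := bH _ kn; exists c => w; exact: cE.
  by have [c cE] := bK _ (kmn _ kN kn); exists c => w; rewrite normrN; exact: cE.
have sumE (f g : nat -> R) : \sum_(k < n + m) (if (k < n)%N then f k else - g (k - n)%N) =
    \sum_(k < n) f k - \sum_(k < m) g k.
  rewrite big_split_ord/= -sumrN; congr (_ + _); apply: eq_bigr => k _.
    by rewrite /= ltn_ord.
  by rewrite /= ltnNge leq_addr/= addKn.
exists Z; split=> //.
- move=> w; rewrite ZE; apply: eq_integral => u _; congr (_ ^+ 2)%:E.
  rewrite /sp_eval -(sumE (fun k => sp_coef H k w * \1_(`]sp_time H k, sp_time H k.+1]) u)
    (fun k => sp_coef K k w * \1_(`]sp_time K k, sp_time K k.+1]) u)); apply: eq_bigr => k _; rewrite /xi /a /b.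
  by case: ifP => // _; rewrite mulNr.
- rewrite -IZ; apply: eq_integral => w _; congr (_ ^+ 2)%:E.
  rewrite /sp_integral -(sumE (fun k => sp_coef H k w * (W (sp_time H k.+1) w - W (sp_time H k) w))
    (fun k => sp_coef K k w * (W (sp_time K k.+1) w - W (sp_time K k) w))); apply: eq_bigr => k _; rewrite /xi /a /b.
  by case: ifP => // _; rewrite mulNr.
Qed.

Lemma measurable_sp_eval (H : @simple_process _ Omega R) (w : Omega) (D : set R) :
  measurable_fun D (fun u : measurableTypeR R => sp_eval H u w).
Proof.
by apply: measurable_sum => k; apply: measurable_funM.
Qed.

Lemma measurable_sp_integral (K : simple_process) : admissible F T K ->
  measurable_fun setT (sp_integral (fun u => W u : Omega -> R) K).
Proof.
move=> [_ _ _ cK _].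
have mk (k : 'I_(sp_size K)) : measurable_fun setT
    (fun w => sp_coef K k w * (W (sp_time K k.+1) w - W (sp_time K k) w)).
  apply: measurable_funM; last by apply: measurable_funB.
  move=> _ C mC; apply: (smallest_sub (@sigma_algebra_measurable _ Omega) (@wrt_measurable _ _ _ _ _ _ hW (sp_time K k))).
  by apply: FG; apply: (cK k (ltn_ord k)); exists C.
exact: measurable_sum.
Qed.

Let sqrD_le (x y : R) : (x + y) ^+ 2 <= 2 * x ^+ 2 + 2 * y ^+ 2.
Proof. by have := sqr_ge0 (x - y); rewrite !expr2; nra. Qed.

Let sqrB_le (x y z : R) : (y - z) ^+ 2 <= 2 * (x - y) ^+ 2 + 2 * (x - z) ^+ 2.
Proof. by have := sqr_ge0 (2 * x - y - z); rewrite !expr2; nra. Qed.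

Local Open Scope ereal_scope.

(** Compares [K] with the approximations [Hn] of the definition through the isometry, then lets [n]
    grow. The factor [4] comes from splitting a square in two twice: once for the integrals and once
    for the integrands. [D] is a measurable majorant supplied by the caller. *)
Lemma ito_integral_near (H : R -> Omega -> R) (I : {RV P >-> R}) (K : simple_process)
    (D : Omega -> R) :
  is_ito_integral F (fun u => W u : Omega -> R) H T I ->
  admissible F T K -> measurable_fun setT D -> (forall w, (0 <= D w)%R) ->
  {ae P, forall w, measurable_fun `[0%R, T] (fun u : measurableTypeR R => H u w) /\
    \int[lebesgue_measure]_(u in `[0%R, T]) ((H u w - sp_eval K u w) ^+ 2)%:E <= (D w)%:E} ->
  \int[P]_w ((I w - sp_integral (fun u => W u : Omega -> R) K w) ^+ 2)%:E <=
  (4 * kappa)%:E * \int[P]_w (D w)%:E.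
Proof.
move=> [Hn [aHn A0 I0]] aK mD D0 HD.
have k0 : (0 <= kappa)%R by rewrite fine_ge0// integral_ge0// => y _; rewrite lee_fin sqr_ge0.
have mspK := measurable_sp_integral aK.
pose A n w := \int[lebesgue_measure]_(u in `[0%R, T]) ((H u w - sp_eval (Hn n) u w) ^+ 2)%:E.
have A_ge0 n w : 0 <= A n w by apply: integral_ge0 => u _; rewrite lee_fin sqr_ge0.
pose EI n := 'E_P[fun w => ((I w - sp_integral (fun u => W u : Omega -> R) (Hn n) w) ^+ 2)%R].
have key n : \int[P]_w ((I w - sp_integral (fun u => W u : Omega -> R) K w) ^+ 2)%:E <=
    2%:E * EI n + (4 * kappa)%:E * \int[P]_w A n w + (4 * kappa)%:E * \int[P]_w (D w)%:E.
  have mspH := measurable_sp_integral (aHn n).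
  have [Z [mZ ZE IZ]] := simple_sub_isometry (aHn n) aK.
  have Z0 w : (0 <= Z w)%R.
    by rewrite -lee_fin ZE integral_ge0// => u _; rewrite lee_fin sqr_ge0.
  have ZAD : {ae P, forall w, (Z w)%:E <= 2%:E * A n w + 2%:E * (D w)%:E}.
    apply: filterS HD => w [mH HDw]; rewrite ZE.
    have mA : measurable_fun `[0%R, T] (fun u : measurableTypeR R => ((H u w - sp_eval (Hn n) u w) ^+ 2)%:E).
      apply/measurable_EFinP; apply: measurable_funX; apply: measurable_funB => //.
      exact: measurable_sp_eval.
    have mB : measurable_fun `[0%R, T] (fun u : measurableTypeR R => ((H u w - sp_eval K u w) ^+ 2)%:E).
      apply/measurable_EFinP; apply: measurable_funX; apply: measurable_funB => //.
      exact: measurable_sp_eval.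
    apply: le_trans (leeD (lexx _) (lee_wpmul2l _ HDw)) => //.
    rewrite -!ge0_integralZl//; try by move=> u _; rewrite lee_fin sqr_ge0.
    rewrite -ge0_integralD//; last first.
    - exact: measurable_funeM.
    - by move=> u _; rewrite -EFinM lee_fin mulr_ge0// sqr_ge0.
    - exact: measurable_funeM.
    - by move=> u _; rewrite -EFinM lee_fin mulr_ge0// sqr_ge0.
    apply: ge0_le_integral => //.
    - by move=> u _; rewrite lee_fin sqr_ge0.
    - by apply/measurable_EFinP; apply: measurable_funX; apply: measurable_funB; exact: measurable_sp_eval.
    - by apply: emeasurable_funD; exact: measurable_funeM.
    - move=> u _; rewrite -!EFinM -EFinD lee_fin.
      exact: sqrB_le.
  have intZ : \int[P]_w (Z w)%:E <= 2%:E * \int[P]_w A n w + 2%:E * \int[P]_w (D w)%:E.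
    (* The inner integral [A n] is not known to be measurable in [w], so the integral of the sum
       [A n + D] cannot be split. The measurable excess [Zp] is almost everywhere at most [2 A n]
       and is compared with it alone. *)
    pose Zp w := (Num.max 0 (Z w - 2 * D w))%R.
    have mZp : measurable_fun setT Zp.
      apply: measurable_maxr => //; apply: measurable_funB => //.
      exact: measurable_funM.
    have Zp0 w : (0 <= Zp w)%R by rewrite /Zp le_max lexx.
    apply: (@le_trans _ _ (\int[P]_w ((Zp w)%:E + 2%:E * (D w)%:E))).
      apply: ge0_le_integral => //.
      - by move=> w _; rewrite lee_fin.
      - by apply/measurable_EFinP.
      - apply: emeasurable_funD; first exact/measurable_EFinP.
        by apply: measurable_funeM; exact/measurable_EFinP.
      - by move=> w _; rewrite -EFinM -EFinD lee_fin -lerBlDr /Zp le_max lexx orbT.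
    rewrite ge0_integralD//; last first.
    - by apply: measurable_funeM; exact/measurable_EFinP.
    - by move=> w _; rewrite -EFinM lee_fin mulr_ge0.
    - exact/measurable_EFinP.
    - by move=> w _; rewrite lee_fin.
    rewrite ge0_integralZl//; last first.
    - by move=> w _; rewrite lee_fin.
    - exact/measurable_EFinP.
    apply: leeD => //.
    (* For the same reason the factor [2] is moved to the measurable side before comparing. *)
    have -> : \int[P]_w (Zp w)%:E = 2%:E * \int[P]_w (2^-1 * Zp w)%:E.
      rewrite -ge0_integralZl//.
      - by apply: eq_integral => w _; rewrite -EFinM mulrA divff ?mul1r.
      - by apply/measurable_EFinP; exact: measurable_funM.
      - by move=> w _; rewrite lee_fin mulr_ge0.
    apply: lee_wpmul2l => //.
    apply: ae_ge0_le_integral_nonmeasurable => //.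
    - by apply/measurable_EFinP; exact: measurable_funM.
    - by move=> w; rewrite lee_fin mulr_ge0.
    apply: filterS ZAD => w; have := A_ge0 n w; case: (A n w) => [x|_ _|//]; last by rewrite leey.
    rewrite -!EFinM -EFinD !lee_fin /Zp => x0 h.
    by case: (leP 0 (Z w - 2 * D w))%R => _; lra.
  have mI : measurable_fun setT (I : Omega -> R) by [].
  apply: (@le_trans _ _ (\int[P]_w
     (2%:E * ((I w - sp_integral (fun u => W u : Omega -> R) (Hn n) w) ^+ 2)%:E +
      2%:E * ((sp_integral (fun u => W u : Omega -> R) (Hn n) w - sp_integral (fun u => W u : Omega -> R) K w) ^+ 2)%:E))).
    apply: ge0_le_integral => //.
    - by move=> w _; rewrite lee_fin sqr_ge0.
    - by apply/measurable_EFinP; apply: measurable_funX; exact: measurable_funB.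
    - by apply: emeasurable_funD; apply: measurable_funeM; apply/measurable_EFinP;
        apply: measurable_funX; exact: measurable_funB.
    - move=> w _; rewrite -!EFinM -EFinD lee_fin.
      apply: le_trans (sqrD_le _ _); rewrite addrA subrK//.
  rewrite ge0_integralD//; last first.
  - by apply: measurable_funeM; apply/measurable_EFinP; apply: measurable_funX; exact: measurable_funB.
  - by move=> w _; rewrite -EFinM lee_fin mulr_ge0// sqr_ge0.
  - by apply: measurable_funeM; apply/measurable_EFinP; apply: measurable_funX; exact: measurable_funB.
  - by move=> w _; rewrite -EFinM lee_fin mulr_ge0// sqr_ge0.
  rewrite !ge0_integralZl//; try by [move=> w _; rewrite lee_fin sqr_ge0|
    apply/measurable_EFinP; apply: measurable_funX; exact: measurable_funB].
  rewrite IZ -addeA; apply: leeD; first by rewrite /EI unlock.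
  apply: (@le_trans _ _ (2%:E * (kappa%:E * (2%:E * \int[P]_w A n w + 2%:E * \int[P]_w (D w)%:E)))).
    by do 2 (apply: lee_wpmul2l => //).
  rewrite ge0_muleDr ?mule_ge0 ?integral_ge0// => [|w _]; last by rewrite lee_fin.
  rewrite ge0_muleDr ?mule_ge0 ?integral_ge0// => [|w _]; last by rewrite lee_fin.
  rewrite !muleA -!EFinM (_ : (2 * kappa * 2 = 4 * kappa)%R)//; ring.
apply/lee_addgt0Pr => e e0.
pose c := (2 + 4 * kappa)%R.
have c0 : (0 < c)%R by rewrite /c; lra.
have ec0 : (0 < e / c)%R by rewrite divr_gt0.
have [n _ hn] := filterI (cvg0_lt A0 ec0) (cvg0_lt I0 ec0).
have [h1 h2] := hn n (leqnn n).
apply: le_trans (key n) _; rewrite addeC; apply: leeD => //.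
apply: (@le_trans _ _ (2%:E * (e / c)%:E + (4 * kappa)%:E * (e / c)%:E)).
  by apply: leeD; apply: lee_wpmul2l; rewrite ?lee_fin ?mulr_ge0//; exact: ltW.
by rewrite -!EFinM -EFinD lee_fin -mulrDl -/c mulrC divfK// gt_eqF.
Qed.

End ItoIntegralNear.

(** * The Markov chain *)

Section Chain.
Context {disp : measure_display} {Omega : measurableType disp} {R : realType}.
Variables (P : probability Omega R) (d : nat) (Q : 'M[R]_d).

Lemma semigroup_generator_le (p : R -> 'M[R]_d) : transition_semigroup Q p ->
  forall e, 0 < e -> exists2 dl, 0 < dl & forall h, 0 <= h -> h <= dl ->
    forall i k, `|p h i k - 1%:M i k - h * Q i k| <= e * h.
Proof.
move=> hp e e0; have := semigroup_generator hp.
move/cvgrPdist_le => /(_ e e0); rewrite near_withinE => -[dl /= dl0 hdl].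
exists (dl / 2); first by rewrite divr_gt0.
move=> h; rewrite le_eqVlt => /predU1P[<- _ i k|h0 hdl2 i k].
  by rewrite (semigroup0 hp) subrr mul0r subr0 mulr0 normr0.
have /hdl /(_ h0) : ball_ Num.norm 0 dl h.
  rewrite /= sub0r normrN gtr0_norm// (le_lt_trans hdl2)// ltr_pdivrMr//; lra.
move=> hn.
have : `|(Q - h^-1 *: (p h - 1%:M)) i k| <= e.
  apply: le_trans hn; rewrite [leRHS]/Num.Def.normr/= mx_normrE.
  exact: (le_bigmax _ (fun ij : 'I_d * 'I_d => `|(Q - h^-1 *: (p h - 1%:M)) ij.1 ij.2|) (i, k)).
rewrite !mxE => hik.
have -> : p h i k - (i == k)%:R - h * Q i k = - (h * (Q i k - h^-1 * (p h i k - (i == k)%:R))).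
  by field; rewrite gt_eqF.
by rewrite normrN normrM gtr0_norm// mulrC ler_wpM2r// ltW.
Qed.

Lemma semigroup_rate (p : R -> 'M[R]_d) : transition_semigroup Q p ->
  exists C, exists2 dl, 0 < dl & 0 < C /\ forall h, 0 <= h -> h <= dl ->
    forall i, 1 - p h i i <= C * h.
Proof.
move=> hp; have [dl dl0 H] := semigroup_generator_le hp ltr01.
exists (1 + \sum_i `|Q i i|), dl => //; split.
  by rewrite ltr_wpDr// sumr_ge0.
move=> h h0 hdl i; have := H h h0 hdl i i; rewrite mxE eqxx mulr1n mul1r ler_norml => /andP[h1 _].
have h2 : `|Q i i| <= \sum_i `|Q i i| by rewrite (bigD1 i)//= lerDl sumr_ge0.
have h3 : - (h * Q i i) <= h * \sum_i `|Q i i|.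
  rewrite -mulrN; apply: ler_wpM2l => //; apply: le_trans h2.
  by rewrite -normrN ler_norm.
rewrite mulrDl mul1r mulrC; lra.
Qed.

Variable X : R -> Omega -> 'I_d.
Hypothesis hX : markov_chain P Q X.
Local Open Scope ereal_scope.

Lemma chain_event_measurable (t : R) (A : set 'I_d) : (0 <= t)%R -> measurable (X t @^-1` A).
Proof.
move=> t0; rewrite (_ : X t @^-1` A = \bigcup_(i in A) (X t @^-1` [set i])); last first.
  by apply/seteqP; split=> [w Aw|w [i Ai /= wi]]; [exists (X t w)|rewrite /= wi].
apply: fin_bigcup_measurable => [|i _]; first exact: finite_finset.
exact: (chain_measurable hX).
Qed.

Lemma measurable_chain_fun (t : R) (f : 'I_d -> R) : (0 <= t)%R ->
  measurable_fun setT (fun w => f (X t w)).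
Proof.
by move=> t0 _ C mC; rewrite setTI; exact: (chain_event_measurable (f @^-1` C) t0).
Qed.

Definition jump_event (s t : R) : set Omega := [set w | X t w != X s w].

Lemma jump_eventE (s t : R) : jump_event s t =
  \bigcup_(i in setT) (X s @^-1` [set i] `&` X t @^-1` [set k | k != i]).
Proof.
by apply/seteqP; split=> [w /= ne|w [i _ [/= wi ne]]]; [exists (X s w)|rewrite /jump_event/= wi].
Qed.

Lemma measurable_jump_event (s t : R) : (0 <= s)%R -> (0 <= t)%R ->
  measurable (jump_event s t).
Proof.
move=> s0 t0; rewrite jump_eventE.
apply: fin_bigcup_measurable => [|i _]; first exact: finite_finset.
by apply: measurableI; exact: chain_event_measurable.
Qed.

Lemma jump_event_rate : exists C, exists2 dl, (0 < dl)%R & (0 < C)%R /\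
  forall s t, (0 <= s)%R -> (s <= t)%R -> (t - s <= dl)%R ->
    P (jump_event s t) <= (C * (t - s))%:E.
Proof.
have [p [hp mk]] := chain_markov hX.
have [C [dl dl0 [C0 HC]]] := semigroup_rate hp.
pose N := size (finmap.enum_fset (fset_set [set: 'I_d])).
(* [N] counts the states, over which the rates are summed; the successor keeps the constant
   positive. *)
exists (N.+1%:R * C)%R, dl => //; split; first by rewrite mulr_gt0.
move=> s t s0 st tsdl; have t0 := le_trans s0 st.
have mi (i : 'I_d) : measurable (X s @^-1` [set i]) by exact: chain_event_measurable.
have mk' (i : 'I_d) : measurable (X s @^-1` [set i] `&` X t @^-1` [set k | k != i]).
  by apply: measurableI => //; exact: chain_event_measurable.
rewrite jump_eventE measure_fin_bigcup//; last 2 first.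
- exact: finite_finset.
- apply/trivIsetP => i j _ _ ij; apply/seteqP; split=> // w [[/= wi _] [wj _]].
  by move: ij; rewrite -wi -wj eqxx.
rewrite fsbig_finite/=; last exact: finite_finset.
(* By the Markov property with a trivial past, this probability is
   [P (X s = i) * (1 - p (t - s) i i)]. *)
have bnd (i : 'I_d) : P (X s @^-1` [set i] `&` X t @^-1` [set k | k != i]) <= (C * (t - s))%:E.
  have := mk s t setT i i s0 st (@measurableT _ (g_sigma_algebraType _)).
  rewrite setTI => mkii.
  have -> : X s @^-1` [set i] `&` X t @^-1` [set k | k != i] =
      X s @^-1` [set i] `\` (X s @^-1` [set i] `&` X t @^-1` [set i]).
    apply/seteqP; split=> [w [/= wi /eqP wt]|w [/= wi wt]]; first by split => // -[].
    by split=> //=; apply/eqP => h; apply: wt.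
  have mii : measurable (X s @^-1` [set i] `&` X t @^-1` [set i]).
    by apply: measurableI => //; exact: chain_event_measurable.
  have -> : P (X s @^-1` [set i] `\` (X s @^-1` [set i] `&` X t @^-1` [set i])) =
      P (X s @^-1` [set i]) - P (X s @^-1` [set i]) * (p (t - s)%R i i)%:E.
    transitivity (P (X s @^-1` [set i]) - P (X s @^-1` [set i] `&` (X s @^-1` [set i] `&` X t @^-1` [set i]))).
      apply: measureD => //.
      by rewrite (le_lt_trans (probability_le1 _ _))// ltry.
    by rewrite setIA setIid mkii.
  have Pf : P (X s @^-1` [set i]) \is a fin_num by rewrite fin_num_measure.
  have P0 : (0 <= fine (P (X s @^-1` [set i])))%R by rewrite fine_ge0.
  have P1 : (fine (P (X s @^-1` [set i])) <= 1)%R.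
    by rewrite -lee_fin fineK// probability_le1.
  rewrite -(fineK Pf) -EFinM -EFinB lee_fin.
  have := HC (t - s)%R _ tsdl i; rewrite subr_ge0 => /(_ st) h.
  have h0 : (0 <= C * (t - s))%R by rewrite mulr_ge0 ?subr_ge0// ltW.
  nra.
apply: (@le_trans _ _ (\sum_(i <- finmap.enum_fset (fset_set [set: 'I_d])) (C * (t - s))%:E)).
  by apply: lee_sum => i _.
rewrite sumEFin lee_fin big_const_seq count_predT iter_addr addr0 -[leLHS]mulr_natl -/N -mulrA.
by rewrite ler_wpM2r ?ler_nat// mulr_ge0 ?subr_ge0// ltW.
Qed.

(** Passes from past events to nonnegative functionals [V] of the past; it is applied to the
    exponential of [log_laplace]. *)
Lemma chain_markov_fun : exists p, transition_semigroup Q p /\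
  forall (s t : R) (V : Omega -> R) (i k : 'I_d), (0 <= s)%R -> (s <= t)%R ->
    measurable_fun [set: g_sigma_algebraType (\bigcup_(u in `[0%R, s])
       preimage_set_system setT (X u) setT)] V ->
    (forall w, (0 <= V w)%R) ->
    \int[P]_w (V w * \1_(X s @^-1` [set i] `&` X t @^-1` [set k]) w)%:E =
    (p (t - s) i k)%:E * \int[P]_w (V w * \1_(X s @^-1` [set i]) w)%:E.
Proof.
have [p [hp mk]] := chain_markov hX; exists p; split=> //.
move=> s t V i k s0 st mV V0; have t0 := le_trans s0 st.
set G := \bigcup_(u in _) _ in mV.
have mG : G `<=` measurable.
  move=> A [u u0 [D _ <-]]; rewrite setTI; apply: chain_event_measurable.
  by move: u0; rewrite /= in_itv/= => /andP[].
have mVT : measurable_fun setT V by exact: (sub_measurable_fun mG mV).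
have p0 : (0 <= p (t - s)%R i k)%R by rewrite (semigroup_ge0 hp)// subr_ge0.
set A := X s @^-1` [set i]; set B := X t @^-1` [set k].
have mA : measurable A by exact: chain_event_measurable.
have mAB : measurable (A `&` B) by apply: measurableI => //; exact: chain_event_measurable.
have restr (E : set Omega) (mE : measurable E) :
    \int[P]_w (V w * \1_E w)%:E = \int[mrestr P mE]_w (V w)%:E.
  rewrite (@ge0_integral_density _ _ _ P (mrestr P mE) \1_E)//.
  - by move=> F mF; rewrite integral_indic// setIC.
  - exact/measurable_EFinP.
pose TG := g_sigma_algebraType G.
have mid : measurable_fun [set: Omega] (id : Omega -> TG).
  exact: (@sub_measurable_fun _ _ G mG _ TG (id : TG -> TG)).
pose idm : {mfun Omega >-> TG} := HB.pack (id : Omega -> TG) (isMeasurableFun.Build _ _ _ _ _ mid).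
have mVE : measurable_fun [set: TG] (fun w : TG => (V w)%:E) by exact/measurable_EFinP.
(* [V] is measurable for the past sigma-algebra, so measures need only be compared after restriction
   to it; there their equality is the Markov property for events. *)
have toG (m : {measure set Omega -> \bar R}) :
    \int[m]_w (V w)%:E = \int[pushforward m idm]_w (V w)%:E.
  have := @ge0_integral_pushforward _ _ Omega TG R id mid m setT (fun w => (V w)%:E) measurableT mVE.
  rewrite preimage_setT => h; apply/esym/h => w _.
  by rewrite lee_fin.
rewrite !restr.
transitivity (\int[mscale (NngNum p0) (mrestr P mA)]_w (V w)%:E); last first.
  by apply: ge0_integral_mscale => //; [exact/measurable_EFinP|move=> w _; rewrite lee_fin].
rewrite (toG (mrestr P mAB)) (toG (mscale (NngNum p0) (mrestr P mA))).
apply: eq_measure_integral => E mE _.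
rewrite /= /pushforward /mscale/= /mrestr setIA muleC; exact: mk.
Qed.

End Chain.

(** * Path regularity and occupation times *)

Section ChainPaths.
Context {disp : measure_display} {Omega : measurableType disp} {R : realType}.
Variables (P : probability Omega R) (d : nat) (Q : 'M[R]_d) (X : R -> Omega -> 'I_d).
Hypothesis hX : markov_chain P Q X.

Definition right_regular (w : Omega) : Prop :=
  forall t, 0 <= t -> \forall u \near t^'+, X u w = X t w.

Lemma right_regular_ae : {ae P, forall w, right_regular w}.
Proof. by apply: filterS (chain_cadlag hX) => w []. Qed.

Definition grid_point (m z : nat) : R := z%:R / m.+1%:R.

(* For right-continuous paths, [X u w = i] can be read off the values of the
   path at the first points of the lattices of mesh 1/(m+1) to the right of
   [u]. *)
Definition chain_graph (i : 'I_d) : set (measurableTypeR R * Omega) :=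
  \bigcup_(M in setT) \bigcap_(m in [set m | (M <= m)%N]) \bigcup_(z in setT)
    (`[grid_point m z, grid_point m z.+1[ `*` (X (grid_point m z.+1) @^-1` [set i])).

Lemma measurable_chain_graph (i : 'I_d) : measurable (chain_graph i).
Proof.
apply: bigcupT_measurable => M; apply: bigcap_measurable => [|m _]; first by exists M => /=.
apply: bigcupT_measurable => z; apply: measurableX; first exact: measurable_itv.
by apply: (chain_measurable hX); rewrite divr_ge0.
Qed.

Lemma chain_graphE (i : 'I_d) (u : R) (w : Omega) : 0 <= u -> right_regular w ->
  chain_graph i (u, w) <-> X u w = i.
Proof.
move=> u0 /(_ u u0); rewrite near_withinE => -[e /= e0 he].
pose M := Num.truncn e^-1.
have hM (m z : nat) : (M <= m)%N -> grid_point m z <= u -> u < grid_point m z.+1 ->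
    X (grid_point m z.+1) w = X u w.
  move=> Mm zu uz; apply: he => //=; rewrite distrC gtr0_norm ?subr_gt0//.
  rewrite ltrBlDr; apply: (@lt_le_trans _ _ (e + grid_point m z)); last by rewrite lerD2l.
  have -> : grid_point m z.+1 = m.+1%:R^-1 + grid_point m z.
    by rewrite /grid_point -natr1 mulrDl mul1r addrC.
  rewrite ltrD2r invf_plt ?posrE//.
  have /andP[_ h] : M%:R <= e^-1 < M.+1%:R by apply: truncn_itv; rewrite invr_ge0 ltW.
  by apply: lt_le_trans h _; rewrite ler_nat.
split.
  move=> [M' _] /(_ (maxn M M') (leq_maxr _ _)) [z _ [/=]].
  rewrite in_itv/= => /andP[zu uz] <-.
  by apply/esym/hM => //; exact: leq_maxl.
move=> Xui; exists M => // m Mm; pose z := Num.truncn (u * m.+1%:R); exists z => //.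
have /andP[h1 h2] : z%:R <= u * m.+1%:R < z.+1%:R by apply: truncn_itv; rewrite mulr_ge0.
have zu : grid_point m z <= u by rewrite ler_pdivrMr.
have uz : u < grid_point m z.+1 by rewrite ltr_pdivlMr.
by split=> /=; [rewrite in_itv/= zu uz|rewrite hM].
Qed.

Lemma measurable_chain_path (T : R) (f : 'I_d -> R) (w : Omega) : right_regular w ->
  measurable_fun `[0, T] (fun u : measurableTypeR R => f (X u w)).
Proof.
move=> rw _ C mC.
rewrite (_ : _ `&` _ = `[0, T] `&`
  \bigcup_(i in f @^-1` C) ysection (chain_graph i) w); last first.
  apply/seteqP; split=> [u [uT /= Cu]|u [uT [i /= Ci]]].
    have u0 : 0 <= u by move: uT; rewrite /= in_itv/= => /andP[].
    by split=> //; exists (X u w) => //; apply/ysectionP/chain_graphE.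
  have u0 : 0 <= u by move: uT; rewrite /= in_itv/= => /andP[].
  move=> /ysectionP/chain_graphE => /(_ u0 rw) Xui.
  by split=> //=; rewrite Xui.
apply: measurableI; first exact: measurable_itv.
apply: fin_bigcup_measurable => [|i _]; first exact: finite_finset.
by apply: measurable_ysection; exact: measurable_chain_graph.
Qed.

Local Open Scope ereal_scope.

(** By Fubini the mean is the integral over the cell of the probability that [X u] differs from
    [X a], of order [u - a]; hence the square. [beta] is measurable everywhere but agrees with the
    occupation time only on right-regular paths. *)
Lemma occupation_time : exists C, exists2 dl, (0 < dl)%R & (0 < C)%R /\
  forall a b, (0 <= a)%R -> (a <= b)%R -> (b - a <= dl)%R ->
  exists beta : Omega -> R, [/\ measurable_fun setT beta,
    forall w, (0 <= beta w)%R,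
    forall w, right_regular w -> \int[lebesgue_measure]_(u in `[a, b])
      ((X u w != X a w)%:R)%:E = (beta w)%:E &
    \int[P]_w (beta w)%:E <= (C * (b - a) ^+ 2)%:E].
Proof.
have [C [dl dl0 [C0 jr]]] := jump_event_rate hX.
exists C, dl => //; split=> // a b a0 ab abdl.
(* A jointly measurable substitute for the set of pairs with [X u w] different from [X a w], equal
   to it on right-regular paths. *)
pose S : set (measurableTypeR R * Omega) := (`[a, b] `*` setT) `&`
  \bigcup_(i in setT) ((setT `*` (X a @^-1` [set i])) `\` chain_graph i).
have mS : measurable S.
  apply: measurableI; first by apply: measurableX => //; exact: measurable_itv.
  apply: fin_bigcup_measurable => [|i _]; first exact: finite_finset.
  apply: measurableD; last exact: measurable_chain_graph.
  by apply: measurableX => //; exact: (chain_measurable hX).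
have SE u w : right_regular w -> S (u, w) <-> (u \in `[a, b]%R) && (X u w != X a w).
  move=> rw; split=> [[[/= uab _] [i _ [[_ /= wi] ng]]]|/andP[uab ne]].
    have u0 : (0 <= u)%R by apply: le_trans a0 _; move: uab; rewrite in_itv/= => /andP[].
    rewrite uab/= wi; apply/eqP => h; apply: ng; exact/chain_graphE.
  have u0 : (0 <= u)%R by apply: le_trans a0 _; move: uab; rewrite in_itv/= => /andP[].
  split=> //; exists (X a w) => //; split=> // /chain_graphE => /(_ u0 rw) h.
  by move: ne; rewrite h eqxx.
pose Gy w := \int[@lebesgue_measure R]_u (\1_S (u, w))%:E.
have mG : measurable_fun setT Gy.
  exact: (indic_measurable_fun_fubini_tonelli_G (@lebesgue_measure R) mS).
have GE : \int[@lebesgue_measure R]_u \int[P]_w (\1_S (u, w))%:E = \int[P]_w Gy w.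
  exact: (indic_fubini_tonelli (@lebesgue_measure R) P mS).
have S_le u w : (\1_S (u, w) : R)%:E <= (\1_(`[a, b]) u)%:E.
  rewrite lee_fin !indicE; case: (boolP (_ \in S)) => [/set_mem [[/= uab _] _]|_]; last exact: ler0n.
  by rewrite mem_set.
have mSy w : measurable_fun setT (fun u : measurableTypeR R => (\1_S (u, w) : R)%:E).
  rewrite (_ : (fun _ => _) = (fun u => (\1_(ysection S w) u)%:E)).
    by apply/measurable_EFinP/measurable_indic/measurable_ysection.
  by apply/funext => u; rewrite !indicE mem_ysection.
have mSx u : measurable_fun setT (fun w : Omega => (\1_S (u, w) : R)%:E).
  rewrite (_ : (fun _ => _) = (fun w => (\1_(xsection S u) w)%:E)).
    by apply/measurable_EFinP/measurable_indic/measurable_xsection.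
  by apply/funext => w; rewrite !indicE mem_xsection.
have indab : \int[@lebesgue_measure R]_u (\1_(`[a, b]) u)%:E = (b - a)%:E.
  rewrite integral_indic ?setIT//.
  rewrite [LHS](lebesgue_measure_itv `[a, b]%R)/= lte_fin -EFinB.
  by case: ltgtP ab => // -> _; rewrite subrr.
have G_fin w : Gy w \is a fin_num.
  rewrite ge0_fin_numE; last by apply: integral_ge0 => u _; rewrite lee_fin.
  apply: (@le_lt_trans _ _ (\int[@lebesgue_measure R]_u (\1_(`[a, b]) u)%:E)); last by rewrite indab ltry.
  apply: ge0_le_integral => //.
  by apply/measurable_EFinP/measurable_indic; exact: measurable_itv.
exists (fun w => fine (Gy w)); split.
- exact: measurableT_comp.
- by move=> w; rewrite fine_ge0// integral_ge0// => u _; rewrite lee_fin.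
- move=> w rw; rewrite fineK// /Gy integral_mkcond; apply: eq_integral => u _.
  rewrite patchE indicE; case: ifPn => uab.
    move/set_mem: uab => /= uab; suff -> : (X u w != X a w) = ((u, w) \in S) by [].
    by apply/idP/idP => [ne|/set_mem /(SE _ _ rw)/andP[]//]; apply/mem_set/(SE _ _ rw); rewrite uab.
  rewrite memNset// => /(SE _ _ rw)/andP[h _].
  by move: uab; rewrite notin_setE; apply.
- under eq_integral do rewrite fineK//.
  rewrite -GE.
  apply: (@le_trans _ _ (\int[@lebesgue_measure R]_u ((C * (b - a))%:E * (\1_(`[a, b]) u)%:E))).
    apply: ge0_le_integral_nonmeasurable => u; first by apply: integral_ge0 => w _; rewrite lee_fin.
    rewrite indicE; case: (boolP (u \in _)) => uab; last first.
      rewrite mule0 le_eqVlt; apply/orP; left; apply/eqP.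
      apply: integral0_eq => w _; rewrite indicE memNset// => -[[/= h _] _].
      by move: uab; rewrite notin_setE; apply.
    move/set_mem: uab => /= uab; have := uab; rewrite in_itv/= => /andP[au ub].
    rewrite mule1; apply: le_trans (_ : P (jump_event X a u) <= _).
      have mj : measurable (jump_event X a u).
        by apply: (measurable_jump_event hX) => //; exact: le_trans au.
      have -> : P (jump_event X a u) = \int[P]_w (\1_(jump_event X a u) w)%:E.
        by rewrite integral_indic// setIT.
      apply: ae_ge0_le_integral_nonmeasurable => //.
      apply: filterS right_regular_ae => w rw; rewrite lee_fin !indicE.
      case: (boolP (_ \in S)) => [/set_mem/(SE _ _ rw)/andP[_ ne]|_]; last exact: ler0n.
      by rewrite mem_set.
    apply: le_trans (jr a u a0 au _) _; first by apply: le_trans abdl; rewrite lerD2r.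
    by rewrite lee_fin ler_wpM2l ?lerD2r// ltW.
  rewrite ge0_integralZl//; last first.
  - by rewrite lee_fin mulr_ge0 ?subr_ge0// ltW.
  - by apply/measurable_EFinP/measurable_indic; exact: measurable_itv.
  by rewrite indab -EFinM lee_fin expr2 mulrA.
Qed.

End ChainPaths.

(** * The Euler scheme *)

Section Noises.
Context {disp : measure_display} {Omega : measurableType disp} {R : realType}.
Variables (P : probability Omega R) (d J : nat) (Q : 'M[R]_d).
Variables (X : R -> Omega -> 'I_d) (B : 'I_J -> R -> {RV P >-> R}).
Hypothesis hX : markov_chain P Q X.
Hypothesis hB : forall j, brownian_motion (B j).
Hypothesis hXB : mutual_independence P (chain_and_noises X B `[0, +oo[).

Lemma chain_adapted (j : 'I_J) (s u : R) (f : 'I_d -> R) : 0 <= u ->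
  adapted_at (past_system X B j s) (fun w => f (X u w)).
Proof.
move=> u0 _ C mC; rewrite setTI; apply: sub_sigma_algebra; exists None => //.
apply: sub_sigma_algebra; exists u; first by rewrite /= in_itv/= u0.
by exists (f @^-1` C) => //; rewrite setTI.
Qed.

(** The implication puts the time constraint on [B j] alone: the other noises are observable at
    every time. *)
Lemma noise_adapted (j i : 'I_J) (s u : R) : 0 <= u -> (i == j) ==> (u <= s) ->
  adapted_at (past_system X B j s) (B i u).
Proof.
move=> u0 us _ C mC; rewrite setTI; apply: sub_sigma_algebra; exists (Some i) => //.
apply: sub_sigma_algebra; exists u; last by exists C => //; rewrite setTI.
rewrite (_ : (Some i == Some j) = (i == j))//.
by move: us; case: eqP => _ /= us; rewrite in_itv/= u0.
Qed.

Lemma past_brownian_wrt (j : 'I_J) : brownian_wrt (B j) (past_system X B j).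
Proof.
split.
- by move=> s; exact: (past_system_measurable hX).
- by move=> s t; exact: past_mono.
- by move=> u s u0 us; apply: noise_adapted => //; rewrite us implybT.
- move=> s t s0; rewrite le_eqVlt => /predU1P[<-|st].
    by left; split=> [|w]; rewrite subrr.
  by right; split=> [|A mA]; [rewrite subr_gt0|exact: (brownian_normal (hB j) s0 st mA)].
- by move=> s t A C s0 st sA mC; exact: (past_indep hX hB hXB).
Qed.

End Noises.

Section EulerScheme.
Context {Omega : Type} {R : realType}.
Variables (d : nat) (X : R -> Omega -> 'I_d) (u : nat -> R).
Variables (alpha gamma sigma : 'rV[R]_d) (m0 : R).

Definition mesh_size (k : nat) : R := u k.+1 - u k.

Fixpoint euler (W : R -> Omega -> R) (k : nat) (w : Omega) : R :=
  if k is l.+1 then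
    (1 - gamma 0 (X (u l) w) * mesh_size l) * euler W l w
    + alpha 0 (X (u l) w) * mesh_size l
    + sigma 0 (X (u l) w) * (W (u l.+1) w - W (u l) w)
  else m0.

(* Conditionally on the chain, [euler k] is normal with mean [euler_mean k]
   and variance [euler_var k]. *)
Fixpoint euler_mean (k : nat) (w : Omega) : R :=
  if k is l.+1 then
    (1 - gamma 0 (X (u l) w) * mesh_size l) * euler_mean l w
    + alpha 0 (X (u l) w) * mesh_size l
  else m0.

Fixpoint euler_var (k : nat) (w : Omega) : R :=
  if k is l.+1 then
    (1 - gamma 0 (X (u l) w) * mesh_size l) ^+ 2 * euler_var l w
    + sigma 0 (X (u l) w) ^+ 2 * mesh_size l
  else 0.

End EulerScheme.

Section EulerMeasurable.
Context {disp : measure_display} {Omega : measurableType disp} {R : realType}.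
Variables (d : nat) (X : R -> Omega -> 'I_d) (u : nat -> R).
Variables (alpha gamma sigma : 'rV[R]_d) (m0 : R).
Variables (n : nat) (X_meas : forall (f : 'I_d -> R) l, (l < n)%N -> measurable_fun setT (fun w => f (X (u l) w))).

Lemma measurable_euler (W : R -> Omega -> R) :
  (forall l, (l <= n)%N -> measurable_fun setT (W (u l))) ->
  measurable_fun setT (euler X u alpha gamma sigma m0 W n).
Proof.
move=> mW.
suff h k : (k <= n)%N -> measurable_fun setT (euler X u alpha gamma sigma m0 W k) by exact: h.
elim: k => [_|k ih kn] /=; first exact: measurable_cst.
apply: measurable_funD; first apply: measurable_funD.
- apply: measurable_funM; last exact/ih/ltnW.
  exact: (X_meas (fun i => 1 - gamma 0 i * mesh_size u k)).
- exact: (X_meas (fun i => alpha 0 i * mesh_size u k)).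
- apply: measurable_funM; first exact: (X_meas (fun i => sigma 0 i)).
  by apply: measurable_funB; apply: mW => //; exact: ltnW.
Qed.

Lemma measurable_euler_mean : measurable_fun setT (euler_mean X u alpha gamma m0 n).
Proof.
suff h k : (k <= n)%N -> measurable_fun setT (euler_mean X u alpha gamma m0 k) by exact: h.
elim: k => [_|k ih kn] /=; first exact: measurable_cst.
apply: measurable_funD; first apply: measurable_funM.
- exact: (X_meas (fun i => 1 - gamma 0 i * mesh_size u k)).
- exact/ih/ltnW.
- exact: (X_meas (fun i => alpha 0 i * mesh_size u k)).
Qed.

Lemma measurable_euler_var : measurable_fun setT (euler_var X u gamma sigma n).
Proof.
suff h k : (k <= n)%N -> measurable_fun setT (euler_var X u gamma sigma k) by exact: h.
elim: k => [_|k ih kn] /=; first exact: measurable_cst.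
apply: measurable_funD; first apply: measurable_funM.
- exact: (X_meas (fun i => (1 - gamma 0 i * mesh_size u k) ^+ 2)).
- exact/ih/ltnW.
- exact: (X_meas (fun i => sigma 0 i ^+ 2 * mesh_size u k)).
Qed.

End EulerMeasurable.

(** * Laplace transform of the Euler scheme *)

Section EulerLaplace.
Context {disp : measure_display} {Omega : measurableType disp} {R : realType}.
Variables (P : probability Omega R) (d J : nat) (Q : 'M[R]_d).
Variables (X : R -> Omega -> 'I_d) (B : 'I_J -> R -> {RV P >-> R}).
Hypothesis hX : markov_chain P Q X.
Hypothesis hB : forall j, brownian_motion (B j).
Hypothesis hXB : mutual_independence P (chain_and_noises X B `[0, +oo[).
Variables (alpha gamma sigma : 'I_J -> 'rV[R]_d) (m0 : 'rV[R]_J).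
Variable u : nat -> R.
Hypotheses (u0 : u 0%N = 0) (u_mono : forall k, u k <= u k.+1).

Lemma grid_ge0 k : 0 <= u k.
Proof. by elim: k => [|k ih]; [rewrite u0|exact: le_trans (u_mono k)]. Qed.

Lemma grid_mono (k l : nat) : (k <= l)%N -> u k <= u l.
Proof. by move=> kl; apply: (homo_leq (@lexx _ _) le_trans u_mono) kl. Qed.

Definition euler_M j := euler X u (alpha j) (gamma j) (sigma j) (m0 0 j) (fun s => B j s : Omega -> R).
Definition euler_mu j := euler_mean X u (alpha j) (gamma j) (m0 0 j).
Definition euler_v j := euler_var X u (gamma j) (sigma j).

Lemma euler_M_adapted (j i : 'I_J) (s : R) k : (i == j) ==> (u k <= s) ->
  adapted_at (past_system X B j s) (euler_M i k).
Proof.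
move=> ks; apply: (@measurable_euler _ (g_sigma_algebraType _)).
  by move=> f l _; apply: chain_adapted; exact: grid_ge0.
move=> l lk; apply: noise_adapted; first exact: grid_ge0.
by apply/implyP => ij; move: ks; rewrite ij /=; apply: le_trans; exact: grid_mono.
Qed.

Lemma euler_mu_adapted (j i : 'I_J) (s : R) k : adapted_at (past_system X B j s) (euler_mu i k).
Proof.
apply: (@measurable_euler_mean _ (g_sigma_algebraType _)) => f l _.
by apply: chain_adapted; exact: grid_ge0.
Qed.

Lemma euler_v_adapted (j i : 'I_J) (s : R) k : adapted_at (past_system X B j s) (euler_v i k).
Proof.
apply: (@measurable_euler_var _ (g_sigma_algebraType _)) => f l _.
by apply: chain_adapted; exact: grid_ge0.
Qed.

Lemma measurable_euler_M j k : measurable_fun setT (euler_M j k).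
Proof.
by apply: (adapted_measurable (past_brownian_wrt hX hB hXB j) (s := u k)); apply: euler_M_adapted; rewrite lexx implybT.
Qed.

(** Random [V] and [Xi] are what makes the induction close. Integrating out the last increment
    multiplies [Xi] by the damping factor of the cell and adds the drift and variance terms to the
    exponent in [V]; these depend on the chain only, so both stay adapted at time [0]. *)
Lemma euler_laplace1 (j : 'I_J) k (V Xi : Omega -> R) :
  adapted_at (past_system X B j 0) V -> adapted_at (past_system X B j 0) Xi ->
  (forall w, 0 <= V w) ->
  (\int[P]_w (V w * expR (- (Xi w * euler_M j k w)))%:E =
   \int[P]_w (V w * expR (- (Xi w * euler_mu j k w) + Xi w ^+ 2 * euler_v j k w / 2))%:E)%E.
Proof.
elim: k V Xi => [|k ih] V Xi mV mXi V0.
  by apply: eq_integral => w _; rewrite /= mulr0 mul0r addr0.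
have hW := past_brownian_wrt hX hB hXB j.
have mX (s : R) (f : 'I_d -> R) : adapted_at (past_system X B j s) (fun w => f (X (u k) w)).
  by apply: chain_adapted; exact: grid_ge0.
pose c w := 1 - gamma j 0 (X (u k) w) * mesh_size u k.
pose a w := alpha j 0 (X (u k) w) * mesh_size u k.
pose sg w := sigma j 0 (X (u k) w).
have mc s : adapted_at (past_system X B j s) c by exact: (mX s (fun i => 1 - gamma j 0 i * mesh_size u k)).
have ma s : adapted_at (past_system X B j s) a by exact: (mX s (fun i => alpha j 0 i * mesh_size u k)).
have ms s : adapted_at (past_system X B j s) sg by exact: (mX s (fun i => sigma j 0 i)).
have mV' := adapted_mono hW (grid_ge0 k) mV; have mXi' := adapted_mono hW (grid_ge0 k) mXi.
have mM : adapted_at (past_system X B j (u k)) (euler_M j k).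
  by apply: euler_M_adapted; rewrite lexx implybT.
pose V1 w := V w * expR (- (Xi w * (c w * euler_M j k w + a w))).
pose Xi1 w := - (Xi w * sg w).
have mV1 : adapted_at (past_system X B j (u k)) V1.
  apply: measurable_funM => //; apply: measurableT_comp => //; apply: measurable_funN.
  apply: measurable_funM => //; apply: measurable_funD; last exact: ma.
  by apply: measurable_funM => //; exact: mc.
have mXi1 : adapted_at (past_system X B j (u k)) Xi1.
  by apply: measurable_funN; apply: measurable_funM => //; exact: ms.
have V10 w : 0 <= V1 w by rewrite mulr_ge0 ?expR_ge0.
have h1 := increment_exp hW (grid_ge0 k) (u_mono k) mV1 mXi1 V10.
transitivity (\int[P]_w (V1 w * expR (Xi1 w * (B j (u k.+1) - B j (u k))%R w))%:E)%E.
  apply: eq_integral => w _; congr EFin; rewrite /V1 -mulrA -expRD; congr (_ * expR _).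
  rewrite /euler_M/= -/(euler_M j k w) /Xi1 -/(c w) -/(a w) -/(sg w).
  have e z : z = B j (u k.+1) w - B j (u k) w ->
    - (Xi w * (c w * euler_M j k w + a w + sg w * (B j (u k.+1) w - B j (u k) w))) =
    - (Xi w * (c w * euler_M j k w + a w)) + - (Xi w * sg w) * z by move=> ->; ring.
  exact: e.
rewrite {}h1.
pose V2 w := V w * expR (- (Xi w * a w) + Xi1 w ^+ 2 * mesh_size u k / 2).
pose Xi2 w := Xi w * c w.
have mV2 : adapted_at (past_system X B j 0) V2.
  apply: measurable_funM => //; apply: measurableT_comp => //; apply: measurable_funD.
    by apply: measurable_funN; apply: measurable_funM => //; exact: ma.
  apply: measurable_funM => //; apply: measurable_funM => //; apply: measurable_funX.
  by apply: measurable_funN; apply: measurable_funM => //; exact: ms.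
have mXi2 : adapted_at (past_system X B j 0) Xi2.
  by apply: measurable_funM => //; exact: mc.
have V20 w : 0 <= V2 w by rewrite mulr_ge0 ?expR_ge0.
transitivity (\int[P]_w (V2 w * expR (- (Xi2 w * euler_M j k w)))%:E)%E.
  apply: eq_integral => w _; congr EFin; rewrite /V1 /V2 -!mulrA -!expRD; congr (_ * expR _).
  rewrite /mesh_size /Xi2; ring.
rewrite (ih V2 Xi2 mV2 mXi2 V20); apply: eq_integral => w _; congr EFin.
rewrite /V2 -!mulrA -!expRD; congr (_ * expR _).
rewrite /euler_mu /euler_v /= -/(euler_mu j k w) -/(euler_v j k w) -/(c w) -/(a w) -/(sg w).
rewrite /Xi1 /Xi2; ring.
Qed.

Definition log_laplace (theta : 'rV[R]_J) (k : nat) (w : Omega) : R :=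
  \sum_(j < J) (- (theta 0 j * euler_mu j k w) + theta 0 j ^+ 2 * euler_v j k w / 2).

Lemma euler_laplace (theta : 'rV[R]_J) k (f : 'I_d -> R) (s : R) : 0 <= s -> (forall i, 0 <= f i) ->
  (\int[P]_w (expR (- \sum_(j < J) theta 0 j * euler_M j k w) * f (X s w))%:E =
   \int[P]_w (expR (log_laplace theta k w) * f (X s w))%:E)%E.
Proof.
move=> s0 f0.
pose x j w := - (theta 0 j * euler_M j k w).
pose y j w := - (theta 0 j * euler_mu j k w) + theta 0 j ^+ 2 * euler_v j k w / 2.
(* Interpolates between the two exponents: the first [r] noises have been integrated out, the others
   not yet. *)
pose part r w := \sum_(j < J) if (j < r)%N then y j w else x j w.
suff h r : (r <= J)%N ->
    (\int[P]_w (expR (part 0%N w) * f (X s w))%:E = \int[P]_w (expR (part r w) * f (X s w))%:E)%E.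
  have := h J (leqnn J).
  have -> : part J = log_laplace theta k.
    by apply/funext => w; apply: eq_bigr => j _; rewrite ltn_ord.
  move=> <-; apply: eq_integral => w _; congr (expR _ * _)%:E.
  by rewrite -sumrN; apply: eq_bigr => j _.
elim: r => [//|r ih rJ]; rewrite (ih (ltnW rJ)).
pose jr := Ordinal rJ.
pose rest w := \sum_(j < J | j != jr) if (j < r)%N then y j w else x j w.
have part_r w : part r w = x jr w + rest w.
  by rewrite /part (bigD1 jr)//= ltnn.
have part_r1 w : part r.+1 w = y jr w + rest w.
  rewrite /part (bigD1 jr)//= ltnSn; congr (_ + _); apply: eq_bigr => j jne.
  by rewrite ltnS leq_eqVlt; move: jne; rewrite -(inj_eq val_inj)/= => /negbTE ->.
pose V w := expR (rest w) * f (X s w).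
(* The schemes driven by the other noises belong to the enlarged past of [B jr] already at time
   [0]. *)
have mrest : adapted_at (past_system X B jr 0) rest.
  rewrite /adapted_at /rest.
  have -> : (fun w => \sum_(j < J | j != jr) (if (j < r)%N then y j w else x j w)) =
     (fun w => \sum_(j < J) (if j != jr then if (j < r)%N then y j w else x j w else 0)).
    by apply/funext => w; rewrite big_mkcond.
  apply: measurable_sum => j; case: (boolP (j != jr)) => [jne|_]; last exact: measurable_cst.
  case: (j < r)%N.
    apply: measurable_funD.
      by apply: measurable_funN; apply: measurable_funM => //; exact: euler_mu_adapted.
    by apply: measurable_funM => //; apply: measurable_funM => //; exact: euler_v_adapted.
  by apply: measurable_funN; apply: measurable_funM => //; apply: euler_M_adapted; rewrite (negbTE jne).
have mV : adapted_at (past_system X B jr 0) V.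
  apply: measurable_funM; first exact: measurableT_comp.
  by apply: chain_adapted.
have V0 w : 0 <= V w by rewrite mulr_ge0 ?expR_ge0.
have := @euler_laplace1 jr k V (fun=> theta 0 jr) mV (measurable_cst _) V0.
move=> h; transitivity (\int[P]_w (V w * expR (- (theta 0 jr * euler_M jr k w)))%:E)%E.
  by apply: eq_integral => w _; congr EFin; rewrite part_r expRD /V; ring.
rewrite h; apply: eq_integral => w _; congr EFin.
by rewrite part_r1 -/(y jr w) (expRD (y jr w)) /V; ring.
Qed.

End EulerLaplace.

(* [f] is the Euler error without its martingale part [D], [r] the local
   truncation error of the drift. *)
Lemma damped_recursion_le (R : realType) (c dt f r D : nat -> R) (K : R) (n : nat) :
  f 0%N = 0 -> (forall k, (k < n)%N -> 0 <= c k * dt k <= 1 /\ 0 <= dt k /\ c k <= K) ->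
  (forall k, (k < n)%N -> f k.+1 = (1 - c k * dt k) * f k + r k - c k * dt k * D k) ->
  `|f n| <= \sum_(k < n) (`|r k| + K * (dt k * `|D k|)).
Proof.
move=> f0 hc fS.
suff h k : (k <= n)%N -> `|f k| <= \sum_(l < k) (`|r l| + K * (dt l * `|D l|)) by exact: h.
elim: k => [_|k ih kn]; first by rewrite f0 normr0 big_ord0.
have [/andP[c0 c1] [dt0 cK]] := hc _ kn.
rewrite big_ord_recr/= fS//.
apply: (le_trans (ler_normB _ _)); apply: (le_trans (lerD (ler_normD _ _) (lexx _))).
(* The factor [1 - c dt] lies in [[0, 1]], so earlier errors are not amplified and no exponential
   constant appears. *)
rewrite -addrA; apply: lerD.
  apply: le_trans (ih (ltnW kn)); rewrite normrM.
  by rewrite ler_piMl// ger0_norm ?subr_ge0// gerBl.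
rewrite lerD2l normrM ger0_norm// mulrA ler_wpM2r// ler_wpM2r//.
Qed.

Lemma measurable_fun_segment_sub (R : realType) {dd} {U : measurableType dd} (T a b : R)
    (f : R -> U) :
  0 <= a -> b <= T -> measurable_fun `[0, T] f -> measurable_fun `[a, b] f.
Proof.
move=> a0 bT; apply: measurable_funS; first exact: measurable_itv.
move=> v /=; rewrite !in_itv/= => /andP[av vb].
by rewrite (le_trans a0 av) (le_trans vb bT).
Qed.

(** * Pathwise drift and noise errors *)

Section EulerError.
Context {disp : measure_display} {Omega : measurableType disp} {R : realType}.
Variables (P : probability Omega R) (d J : nat) (Q : 'M[R]_d).
Variables (X : R -> Omega -> 'I_d) (B : 'I_J -> R -> {RV P >-> R}).
Hypothesis hX : markov_chain P Q X.
Variables (u : nat -> R) (u0 : u 0%N = 0) (u_mono : forall k, u k <= u k.+1).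
Variables (alpha gamma sigma : 'rV[R]_d) (K : R).
Hypotheses (aK : forall i, `|alpha 0 i| <= K) (gK : forall i, 0 <= gamma 0 i <= K)
  (sK : forall i, `|sigma 0 i| <= K).
Variable beta : nat -> Omega -> R.
Hypothesis beta_occ : forall k w, right_regular X w ->
  (\int[lebesgue_measure]_(v in `[u k, u k.+1])
      ((X v w != X (u k) w)%:R)%:E = (beta k w)%:E)%E.

Definition euler_noise (n : nat) : @simple_process _ Omega R :=
  SimpleProcess n u (fun l w => sigma 0 (X (u l) w)).

Lemma admissible_euler_noise n : admissible (natural_filtration X B) (u n) (euler_noise n).
Proof.
split=> //=.
- by rewrite u0.
- move=> k kn A [C mC <-]; apply: sub_sigma_algebra; exists None => //=.
  apply: sub_sigma_algebra; exists (u k); first by rewrite /= in_itv/= lexx (grid_ge0 u0 u_mono).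
  by exists ((fun i => sigma 0 i) @^-1` C) => //; rewrite setTI.
- by move=> k _; exists K => w; exact: sK.
Qed.

Lemma euler_noise_eval n l v w : (l < n)%N -> v \in `]u l, u l.+1] ->
  sp_eval (euler_noise n) v w = sigma 0 (X (u l) w).
Proof.
move=> ln /[!in_itv]/= /andP[lv vl].
rewrite /sp_eval/= (bigD1 (Ordinal ln))//= big1 ?addr0 => [|k kl].
  by rewrite indicE mem_set ?mulr1//= in_itv/= lv vl.
rewrite indicE memNset ?mulr0//= in_itv/= => /andP[kv vk].
move: kl; rewrite -(inj_eq val_inj)/= neq_ltn => /orP[kl|lk].
  by have := lt_le_trans (lt_le_trans lv vk) (grid_mono u_mono kl); rewrite ltxx.
by have := lt_le_trans (lt_le_trans kv vl) (grid_mono u_mono lk); rewrite ltxx.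
Qed.

Lemma grid_segment_setU k : `[0, u k.+1]%classic = `[0, u k]%classic `|` `]u k, u k.+1]%classic.
Proof.
have uk0 := grid_ge0 u0 u_mono k; have ukk := u_mono k.
by rewrite -itv_bndbnd_setU// bnd_simp.
Qed.

Lemma grid_segment_disj k : [disjoint `[0, u k]%classic & `]u k, u k.+1]%classic].
Proof.
apply/disj_setPS => v [] /=; rewrite !in_itv/= => /andP[_ vk] /andP[kv _].
by have := le_lt_trans vk kv; rewrite ltxx.
Qed.

Lemma euler_noise_error n w : right_regular X w ->
  (\int[lebesgue_measure]_(v in `[0%R, u n])
     ((sigma 0 (X v w) - sp_eval (euler_noise n) v w) ^+ 2)%:E <=
   (4 * K ^+ 2 * \sum_(k < n) beta k w)%:E)%E.
Proof.
move=> rw.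
pose f (v : measurableTypeR R) := ((sigma 0 (X v w) - sp_eval (euler_noise n) v w) ^+ 2)%:E.
have f0 v : (0 <= f v)%E by rewrite lee_fin sqr_ge0.
have mf : measurable_fun `[0, u n] f.
  apply/measurable_EFinP; apply: measurable_funX; apply: measurable_funB.
    exact: (measurable_chain_path hX (fun i => sigma 0 i) rw).
  exact: measurable_sp_eval.
suff h k : (k <= n)%N -> (\int[lebesgue_measure]_(v in `[0%R, u k]) f v <=
   (4 * K ^+ 2 * \sum_(l < k) beta l w)%:E)%E by exact: h.
elim: k => [_|k ih kn].
  by rewrite u0 set_itv1 integral_set1 big_ord0 mulr0.
have uk0 := grid_ge0 u0 u_mono k; have ukn := grid_mono u_mono kn.
rewrite grid_segment_setU ge0_integral_setU//; last 2 first.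
- by rewrite -grid_segment_setU; exact: measurable_fun_segment_sub mf.
- exact: grid_segment_disj.
rewrite big_ord_recr/= mulrDr EFinD; apply: leeD; first exact/ih/ltnW.
have b0 : measurable_fun `[u k, u k.+1] (fun v : measurableTypeR R => ((X v w != X (u k) w)%:R : R)%:E).
  apply/measurable_EFinP; apply: (measurable_fun_segment_sub uk0 (lexx _)).
  exact: (measurable_chain_path hX (fun i => (i != X (u k) w)%:R) rw).
rewrite EFinM -beta_occ// -ge0_integralZl//; last first.
- by rewrite lee_fin mulr_ge0// sqr_ge0.
rewrite -integral_itv_obnd_cbnd; last first.
  apply: measurable_funeM; apply: measurable_funS b0; first exact: measurable_itv.
  exact: subset_itv_oc_cc.
apply: ge0_le_integral => //.
- apply: measurable_funS mf; first exact: measurable_itv.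
  move=> v /=; rewrite !in_itv/= => /andP[kv vk].
  by rewrite (le_trans uk0 (ltW kv)) (le_trans vk ukn).
- apply: measurable_funeM; apply: measurable_funS b0; first exact: measurable_itv.
  exact: subset_itv_oc_cc.
(* The integrand vanishes while the chain keeps its value at [u k], and is at most [(2 K)^2]
   otherwise. *)
move=> v vk; rewrite /f (euler_noise_eval _ kn vk) -EFinM lee_fin.
case: eqP => [->|_]; first by rewrite subrr expr0n mulr0.
have := sK (X v w); have := sK (X (u k) w); rewrite !ler_norml !expr2 mulr1.
move=> /andP[a1 a2] /andP[a3 a4]; nra.
Qed.

Let drift (m : R -> R) (w : Omega) (v : R) : R :=
  alpha 0 (X v w) - gamma 0 (X v w) * m v.

Let K0 (i : 'I_d) : 0 <= K.
Proof. exact: le_trans (normr_ge0 _) (aK i). Qed.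

Lemma drift_integrable (m : R -> R) (T A : R) (w : Omega) : right_regular X w ->
  measurable_fun `[0, T] m -> (forall v, v \in `[0, T] -> `|m v| <= A) ->
  lebesgue_measure.-integrable `[0, T] (EFin \o drift m w).
Proof.
move=> rw mm mA; apply: measurable_bounded_integrable => //.
- exact: lebesgue_segment_lty.
- apply: measurable_funB; first exact: (measurable_chain_path hX (fun i => alpha 0 i) rw).
  apply: measurable_funM => //; exact: (measurable_chain_path hX (fun i => gamma 0 i) rw).
exists (K * (1 + A)); split; first exact: num_real.
move=> x Kx v vT; apply: le_trans (ltW Kx); rewrite mulrDr mulr1.
apply: le_trans (ler_normB _ _) _; apply: lerD => //; rewrite normrM.
have /andP[g0 gK'] := gK (X v w).
by apply: ler_pM => //; [rewrite ger0_norm|exact: mA].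
Qed.

Lemma drift_truncation_error (m : R -> R) (n k : nat) (eta A om : R) (w : Omega) :
  right_regular X w -> measurable_fun `[0, u n] m -> 0 <= A -> 0 <= om ->
  (forall v, v \in `[0, u n] -> `|m v| <= A) ->
  (forall v v', v \in `[0, u n] -> v' \in `[0, u n] -> `|v - v'| <= eta -> `|m v - m v'| <= om) ->
  (k < n)%N -> mesh_size u k <= eta ->
  `|\int[lebesgue_measure]_(v in `[0, u k.+1]) drift m w v
    - \int[lebesgue_measure]_(v in `[0, u k]) drift m w v - drift m w (u k) * mesh_size u k|
  <= 2 * K * (1 + A) * beta k w + K * om * mesh_size u k.
Proof.
move=> rw mm A0 om0 mA mom kn keta.
have uk0 := grid_ge0 u0 u_mono k; have ukn := grid_mono u_mono kn; have ukk := u_mono k.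
have K_ge0 : 0 <= K := K0 (X 0 w).
have sub1 : `[u k, u k.+1]%classic `<=` `[0, u n]%classic.
  by move=> v /=; rewrite !in_itv/= => /andP[a b]; rewrite (le_trans uk0 a) (le_trans b ukn).
have int_n : lebesgue_measure.-integrable `[0, u n] (EFin \o drift m w).
  exact: drift_integrable rw mm mA.
have int_k1 : lebesgue_measure.-integrable `[0, u k.+1] (EFin \o drift m w).
  apply: integrableS int_n => // v /=; rewrite !in_itv/= => /andP[-> b].
  exact: le_trans b ukn.
have int_c : lebesgue_measure.-integrable `[u k, u k.+1] (EFin \o drift m w).
  exact: integrableS int_n.
have int_oc : lebesgue_measure.-integrable `]u k, u k.+1] (EFin \o drift m w).
  by apply: integrableS int_c => //; exact: subset_itv_oc_cc.
have int_cst : lebesgue_measure.-integrable `[u k, u k.+1] (EFin \o (fun=> drift m w (u k))).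
  apply: measurable_bounded_integrable => //; first exact: lebesgue_segment_lty.
  by exists `|drift m w (u k)|; split; [exact: num_real|move=> x hx v _; exact: ltW].
rewrite Rintegral_itvB// ?bnd_simp//.
rewrite Rintegral_itv_obnd_cbnd//.
have -> : drift m w (u k) * mesh_size u k = \int[lebesgue_measure]_(v in `[u k, u k.+1]) drift m w (u k).
  rewrite Rintegral_cst//; congr (_ * _).
  rewrite [X in fine X](_ : _ = (u k.+1 - u k)%:E)//.
  rewrite [LHS](lebesgue_measure_itv `[u k, u k.+1])/= lte_fin -EFinB.
  by move: ukk; case: ltgtP => // -> _; rewrite subrr.
rewrite -RintegralB//.
have int_d : lebesgue_measure.-integrable `[u k, u k.+1]
    (EFin \o (fun v => drift m w v - drift m w (u k))).
  by apply: (fun mD => integrableB mD int_c int_cst).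
apply: le_trans (le_normr_Rintegral _ _) _ => //.
have b0 : measurable_fun `[u k, u k.+1] (fun v : measurableTypeR R => ((X v w != X (u k) w)%:R : R)%:E).
  apply/measurable_EFinP; apply: (measurable_fun_segment_sub uk0 (lexx _)).
  exact: (measurable_chain_path hX (fun i => (i != X (u k) w)%:R) rw).
have c1 : 0 <= 2 * K * (1 + A) by rewrite !mulr_ge0// addr_ge0.
rewrite -lee_fin /Rintegral fineK; last first.
  by apply: integrable_fin_num => //; exact: integrable_norm int_d.
apply: (@le_trans _ _ (\int[lebesgue_measure]_(v in `[u k, u k.+1])
   ((2 * K * (1 + A))%:E * ((X v w != X (u k) w)%:R)%:E + (K * om)%:E))%E).
  apply: ge0_le_integral => //.
  - apply/measurable_EFinP; apply: measurableT_comp => //.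
    by apply/measurable_EFinP; exact: (measurable_int lebesgue_measure int_d).
  - by apply: emeasurable_funD => //; exact: measurable_funeM.
  move=> v vk; rewrite -EFinM -EFinD lee_fin /drift.
  have vn : v \in `[0, u n] by exact: sub1.
  have kkn : u k \in `[0, u n] by apply: sub1; rewrite /= in_itv/= lexx.
  have hom : `|m v - m (u k)| <= om.
    apply: mom => //; move: vk; rewrite /= in_itv/= => /andP[a b].
    by rewrite ger0_norm ?subr_ge0//; apply: le_trans keta; rewrite lerB.
  (* While the chain sits in its state at [u k] only [m] varies, at cost [K om]; otherwise the two
     drifts are bounded separately, each by [K (1 + A)]. *)
  case: eqP => [->|_].
    rewrite mulr0 add0r (_ : _ - _ = - (gamma 0 (X (u k) w) * (m v - m (u k)))); last by ring.
    have /andP[g0 gK'] := gK (X (u k) w).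
    by rewrite normrN normrM ger0_norm// ler_pM.
  rewrite mulr1; apply: (@le_trans _ _ (2 * K * (1 + A))); last by rewrite lerDl mulr_ge0.
  have bnd x : x \in `[0, u n] -> `|alpha 0 (X x w) - gamma 0 (X x w) * m x| <= K * (1 + A).
    move=> xn; rewrite mulrDr mulr1; apply: le_trans (ler_normB _ _) _; apply: lerD => //; rewrite normrM.
    have /andP[g0 gK'] := gK (X x w).
    by apply: ler_pM => //; [rewrite ger0_norm|exact: mA].
  apply: le_trans (ler_normB _ _) _.
  by rewrite -mulrA (mulr_natl _ 2) mulr2n; apply: lerD; exact: bnd.
rewrite ge0_integralD//; last 3 first.
- by move=> v _; rewrite -EFinM lee_fin mulr_ge0.
- exact: measurable_funeM.
- by move=> v _; rewrite lee_fin mulr_ge0.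
rewrite ge0_integralZl// beta_occ// integral_cst// EFinD; apply: leeD => //.
rewrite [X in (_ * X)%E](_ : _ = (mesh_size u k)%:E)//.
rewrite [LHS](lebesgue_measure_itv `[u k, u k.+1])/= lte_fin -EFinB.
by move: ukk; rewrite /mesh_size; case: ltgtP => // -> _; rewrite subrr.
Qed.

End EulerError.

(** Weighted inequality [|x| <= la + x^2 / la] in place of Cauchy-Schwarz; the weight [la] is tuned
    to the mesh later. *)
Lemma integral_norm_le_sqr {disp} {Omega : measurableType disp} {R : realType}
    (P : probability Omega R) (D : Omega -> R) (la c : R) :
  measurable_fun setT D -> 0 < la -> (\int[P]_w ((D w) ^+ 2)%:E <= c%:E)%E ->
  (\int[P]_w (`|D w|)%:E <= (la + c / la)%:E)%E.
Proof.
move=> mD la0 h.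
have mD2 : measurable_fun setT (fun w => ((D w) ^+ 2)%:E).
  by apply/measurable_EFinP; exact: measurable_funX.
apply: (@le_trans _ _ (\int[P]_w (la%:E + la^-1%:E * ((D w) ^+ 2)%:E))%E).
  apply: ge0_le_integral => //.
  - by apply/measurable_EFinP; exact: measurableT_comp.
  - by apply: emeasurable_funD => //; exact: measurable_funeM.
  move=> w _; rewrite -EFinM -EFinD lee_fin.
  rewrite -(real_normK (num_real (D w))); set x := `|D w|.
  rewrite -(ler_pM2l la0) mulrDr mulrA divff ?gt_eqF// mul1r.
  have := sqr_ge0 (x - la); rewrite !expr2; nra.
rewrite ge0_integralD//; last 3 first.
- by move=> w _; rewrite lee_fin ltW.
- by move=> w _; rewrite -EFinM lee_fin mulr_ge0 ?sqr_ge0// invr_ge0 ltW.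
- exact: measurable_funeM.
rewrite integral_cst//.
rewrite [X in (la%:E * X)%E](_ : _ = 1%E); last exact: probability_setT.
rewrite mule1 ge0_integralZl//; last 2 first.
- by move=> w _; rewrite lee_fin sqr_ge0.
- by rewrite lee_fin invr_ge0 ltW.
rewrite EFinD; apply: leeD => //; rewrite mulrC EFinM.
by apply: lee_wpmul2l => //; rewrite lee_fin invr_ge0 ltW.
Qed.

Lemma ge0_integral_EFinD {disp} {Omega : measurableType disp} {R : realType}
    (P : {measure set Omega -> \bar R}) (f g : Omega -> R) :
  measurable_fun setT f -> measurable_fun setT g -> (forall w, 0 <= f w) -> (forall w, 0 <= g w) ->
  (\int[P]_w (f w + g w)%:E = \int[P]_w (f w)%:E + \int[P]_w (g w)%:E)%E.
Proof.
move=> mf mg f0 g0; rewrite -ge0_integralD//.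
- by move=> w _; rewrite lee_fin.
- exact/measurable_EFinP.
- by move=> w _; rewrite lee_fin.
- exact/measurable_EFinP.
Qed.

Section EulerConvergence.
Context {disp : measure_display} {Omega : measurableType disp} {R : realType}.
Variables (P : probability Omega R) (d J : nat) (Q : 'M[R]_d).
Variables (X : R -> Omega -> 'I_d) (B : 'I_J -> R -> {RV P >-> R}).
Hypothesis hX : markov_chain P Q X.
Hypothesis hB : forall j, brownian_motion (B j).
Hypothesis hXB : mutual_independence P (chain_and_noises X B `[0, +oo[).
Variables (alpha gamma sigma : 'I_J -> 'rV[R]_d) (m0 : 'rV[R]_J) (M : 'I_J -> R -> {RV P >-> R}).
Hypothesis hM : forall j, modulated_OU (natural_filtration X B) X (B j)
                      (alpha j) (gamma j) (sigma j) (m0 0 j) (M j).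
Variable K : R.
Hypotheses (K0 : 0 <= K) (aK : forall j i, `|alpha j 0 i| <= K)
  (gK : forall j i, 0 <= gamma j 0 i <= K) (sK : forall j i, `|sigma j 0 i| <= K).

(** The bound [A] and the modulus [om] of the path of [M] are random and come with no moment
    estimate. They are therefore quantified after the path, and only [Z], which involves neither, is
    estimated in mean. *)
Lemma euler_error (T : R) : 0 <= T -> exists2 C, 0 <= C & exists2 dl, 0 < dl &
  forall (u : nat -> R) (n : nat) (eta la : R) (j : 'I_J),
    u 0%N = 0 -> (forall k, u k <= u k.+1) -> u n <= T -> 0 <= eta -> eta <= dl -> 0 < la ->
    (forall k, mesh_size u k <= eta) ->
  exists Z : Omega -> R, [/\ measurable_fun setT Z, forall w, 0 <= Z w,
    (\int[P]_w (Z w)%:E <= (C * (eta + la + eta / la))%:E)%E &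
    {ae P, forall w, {within `[0, +oo[, continuous (fun t => M j t w)} /\ forall A om, 0 <= A -> 0 <= om ->
      (forall v, v \in `[0, u n] -> `|M j v w| <= A) ->
      (forall v v', v \in `[0, u n] -> v' \in `[0, u n] -> `|v - v'| <= eta ->
        `|M j v w - M j v' w| <= om) ->
      `|M j (u n) w - euler_M X B alpha gamma sigma m0 u j n w| <= C * ((1 + A) * Z w + om)}].
Proof.
move=> T0; have [C0 [dl0 dl00 [C00 occ]]] := occupation_time hX.
pose kappa := @std_second_moment R.
have k0 : 0 <= kappa by rewrite fine_ge0// integral_ge0// => y _; rewrite lee_fin sqr_ge0.
(* Product of the constants of [ito_integral_near], of [euler_noise_error], and of the occupation
   times summed over the grid. *)
pose E := 4 * kappa * (4 * K ^+ 2) * (C0 * T).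
have E0 : 0 <= E by rewrite !mulr_ge0// ?sqr_ge0// ltW.
pose C := 1 + 3 * K + K * T + C0 * T + (1 + T) * (1 + E).
have [C1 C2] : 1 + 3 * K + K * T <= C /\ C0 * T + (1 + T) * (1 + E) <= C.
  have h1 : 0 <= C0 * T by rewrite mulr_ge0// ltW.
  have h2 : 0 <= (1 + T) * (1 + E) by rewrite mulr_ge0// addr_ge0.
  have h3 : 0 <= K * T by rewrite mulr_ge0.
  have aux (a b k c : R) : 0 <= a -> 0 <= b -> 0 <= k -> 0 <= c ->
      1 + 3 * k + c <= 1 + 3 * k + c + a + b /\ a + b <= 1 + 3 * k + c + a + b by lra.
  exact: aux.
have C_ge0 : 0 <= C.
  by apply: le_trans C1; rewrite !addr_ge0// !mulr_ge0.
(* The second bound gives [K * eta <= 1], which keeps the damping factors in [[0, 1]]. *)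
exists C => //; exists (Num.min dl0 (1 + K)^-1).
  by rewrite lt_min dl00/= invr_gt0 ltr_pwDl.
move=> u n eta la j u0 u_mono unT eta0; rewrite le_min => /andP[etadl etaK] la0 mesh.
have Keta : K * eta <= 1.
  have K1 : 0 < 1 + K by rewrite ltr_pwDl.
  have : (1 + K) * eta <= 1 by rewrite -ler_pdivlMl// mulr1.
  lra.
have uk0 k := grid_ge0 u0 u_mono k.
have mesh0 k : 0 <= mesh_size u k by rewrite subr_ge0.
have /choice[beta hbeta] : forall k, exists b : Omega -> R, [/\ measurable_fun setT b,
    forall w, 0 <= b w,
    forall w, right_regular X w -> (\int[lebesgue_measure]_(v in `[u k, u k.+1])
      ((X v w != X (u k) w)%:R)%:E)%E = (b w)%:E &
    (\int[P]_w (b w)%:E <= (C0 * (u k.+1 - u k) ^+ 2)%:E)%E].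
  by move=> k; apply: occ => //; exact: le_trans (mesh k) etadl.
have mb k : measurable_fun setT (beta k) by have [] := hbeta k.
have b0 k w : 0 <= beta k w by have [] := hbeta k.
have b_occ k w := let: And4 _ _ h _ := hbeta k in h w.
have b_int k := let: And4 _ _ _ h := hbeta k in h.
have /choice[I hI] : forall k, exists I : {RV P >-> R},
    is_ito_integral (natural_filtration X B) (fun t => B j t : Omega -> R)
      (fun t w => sigma j 0 (X t w)) (u k) I /\
    {ae P, forall w, M j (u k) w = m0 0 j + \int[lebesgue_measure]_(v in `[0, u k])
          (alpha j 0 (X v w) - gamma j 0 (X v w) * M j v w) + I w}.
  by move=> k; exact: (OU_sde (hM j)).
pose W t : Omega -> R := B j t.
pose S k := sp_integral W (euler_noise X u (sigma j) k).
pose D k w := I k w - S k w.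
have mS k : measurable_fun setT (S k).
  apply: (measurable_sp_integral (past_brownian_wrt hX hB hXB j) (F := natural_filtration X B)) => //.
    by move=> s; exact: natural_filtration_past.
  by apply: (@admissible_euler_noise _ _ _ P d J X B u u0 u_mono (sigma j) K); exact: sK.
have mD k : measurable_fun setT (D k) by exact: measurable_funB.
have sum_beta k : (k <= n)%N -> (\int[P]_w (\sum_(l < k) beta l w)%:E <= (C0 * T * eta)%:E)%E.
  move=> kn; under eq_integral do rewrite -sumEFin.
  rewrite ge0_integral_sum//; last 2 first.
  - by move=> l; apply/measurable_EFinP.
  - by move=> l w _; rewrite lee_fin.
  apply: (@le_trans _ _ (\sum_(l < k) (C0 * eta * mesh_size u l)%:E)%E).
    apply: lee_sum => l _; apply: le_trans (b_int l) _; rewrite lee_fin -mulrA.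
    by apply: ler_wpM2l; [exact: ltW|rewrite expr2 -/(mesh_size u l) ler_wpM2r].
  rewrite sumEFin lee_fin -mulr_sumr mulrAC.
  have -> : \sum_(l < k) mesh_size u l = u k - u 0%N.
    by rewrite -(big_mkord xpredT (fun l => mesh_size u l)) telescope_sumr.
  rewrite u0 subr0 ler_wpM2r// ler_wpM2l ?(ltW C00)//.
  by apply: le_trans unT; exact: grid_mono.
have D_sqr k : (k <= n)%N -> (\int[P]_w ((D k w) ^+ 2)%:E <= (E * eta)%:E)%E.
  move=> kn; have [hI1 _] := hI k.
  pose De w := 4 * K ^+ 2 * \sum_(l < k) beta l w.
  have c4 : 0 <= 4 * K ^+ 2 by rewrite mulr_ge0 ?sqr_ge0.
  have mDe : measurable_fun setT De.
    by apply: measurable_funM => //; exact: measurable_sum.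
  have De0 w : 0 <= De w by rewrite mulr_ge0// sumr_ge0.
  have nfp s : natural_filtration X B s `<=` <<s past_system X B j s >>.
    exact: natural_filtration_past.
  have adm : admissible (natural_filtration X B) (u k) (euler_noise X u (sigma j) k).
    by apply: (@admissible_euler_noise _ _ _ P d J X B u u0 u_mono (sigma j) K); exact: sK.
  have near : {ae P, forall w, measurable_fun `[0, u k] (fun v : measurableTypeR R => sigma j 0 (X v w)) /\
     (\int[lebesgue_measure]_(v in `[0%R, u k]) ((sigma j 0 (X v w) -
        sp_eval (euler_noise X u (sigma j) k) v w) ^+ 2)%:E <= (De w)%:E)%E}.
    apply: filterS (right_regular_ae hX) => w rw; split.
      exact: (measurable_chain_path hX (fun i => sigma j 0 i) rw).
    by apply: (euler_noise_error hX u0 u_mono (sK j)).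
  have h := ito_integral_near (past_brownian_wrt hX hB hXB j) nfp hI1 adm mDe De0 near.
  apply: le_trans h _.
  have -> : (\int[P]_w (De w)%:E = (4 * K ^+ 2)%:E * \int[P]_w (\sum_(l < k) beta l w)%:E)%E.
    rewrite -ge0_integralZl//.
    - by apply/measurable_EFinP; exact: measurable_sum.
    - by move=> w _; rewrite lee_fin sumr_ge0.
  rewrite muleA -EFinM.
  apply: (@le_trans _ _ ((4 * kappa * (4 * K ^+ 2))%:E * (C0 * T * eta)%:E)%E).
    by apply: lee_wpmul2l; [rewrite lee_fin !mulr_ge0|exact: sum_beta].
  by rewrite -EFinM lee_fin /E !mulrA.
have D_norm k (kn : (k <= n)%N) := integral_norm_le_sqr (mD k) la0 (D_sqr k kn).
(* Noise error at the final time, time spent away from the left-end states, and noise error fed back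
   through the mean-reverting drift. *)
pose Z w := `|D n w| + \sum_(l < n) beta l w + \sum_(l < n) mesh_size u l * `|D l w|.
have mnD k : measurable_fun setT (fun w => `|D k w|) by exact: measurableT_comp.
have mZ1 : measurable_fun setT (fun w => \sum_(l < n) beta l w) by exact: measurable_sum.
have mZ2 : measurable_fun setT (fun w => \sum_(l < n) mesh_size u l * `|D l w|).
  by apply: measurable_sum => l; exact: measurable_funM.
have Z10 w : 0 <= \sum_(l < n) beta l w by exact: sumr_ge0.
have Z20 w : 0 <= \sum_(l < n) mesh_size u l * `|D l w| by apply: sumr_ge0 => l _; rewrite mulr_ge0.
exists Z; split.
- by apply: measurable_funD => //; exact: measurable_funD.
- by move=> w; rewrite !addr_ge0.
- have -> : (\int[P]_w (Z w)%:E = \int[P]_w (`|D n w|)%:E + \int[P]_w (\sum_(l < n) beta l w)%:E +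
      \int[P]_w (\sum_(l < n) mesh_size u l * `|D l w|)%:E)%E.
    rewrite ge0_integral_EFinD//; last 2 first.
    - exact: measurable_funD.
    - by move=> w; rewrite addr_ge0.
    by rewrite ge0_integral_EFinD.
  have h3 : (\int[P]_w (\sum_(l < n) mesh_size u l * `|D l w|)%:E <= (T * (la + E * eta / la))%:E)%E.
    under eq_integral do rewrite -sumEFin.
    rewrite ge0_integral_sum//; last 2 first.
    - by move=> l; apply/measurable_EFinP; exact: measurable_funM.
    - by move=> l w _; rewrite lee_fin mulr_ge0.
    apply: (@le_trans _ _ (\sum_(l < n) (mesh_size u l * (la + E * eta / la))%:E)%E).
      apply: lee_sum => l _; rewrite [leRHS]EFinM.
      under eq_integral do rewrite EFinM.
      have mDl : measurable_fun setT (fun w => (`|D l w|)%:E) by exact/measurable_EFinP.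
      rewrite ge0_integralZl//; last by rewrite lee_fin.
      by apply: lee_wpmul2l; [rewrite lee_fin|apply: D_norm; exact: ltnW].
    rewrite sumEFin lee_fin -mulr_suml ler_wpM2r//.
      by apply: addr_ge0; [exact: ltW|apply: divr_ge0; [exact: mulr_ge0|exact: ltW]].
    have -> : \sum_(l < n) mesh_size u l = u n - u 0%N.
      by rewrite -(big_mkord xpredT (fun l => mesh_size u l)) telescope_sumr.
    by rewrite u0 subr0.
  apply: le_trans (leeD (leeD (D_norm n (leqnn n)) (sum_beta n (leqnn n))) h3) _.
  rewrite -!EFinD lee_fin.
  have q0 : 0 <= eta / la by rewrite divr_ge0// ltW.
  have -> : la + E * eta / la + C0 * T * eta + T * (la + E * eta / la) =
     C0 * T * eta + (1 + T) * (la + E * (eta / la)) by ring.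
  have lam0 := ltW la0.
  have c0T : 0 <= C0 * T by rewrite mulr_ge0// ltW.
  apply: (@le_trans _ _ ((C0 * T + (1 + T) * (1 + E)) * (eta + la + eta / la))); last first.
    by rewrite ler_wpM2r// !addr_ge0.
  have aux (a e q : R) : 0 <= a -> 0 <= e -> 0 <= q ->
      a * eta + (1 + T) * (la + e * q) <= (a + (1 + T) * (1 + e)) * (eta + la + q).
    move=> a0 e0 q0'; rewrite -subr_ge0.
    have -> : (a + (1 + T) * (1 + e)) * (eta + la + q) - (a * eta + (1 + T) * (la + e * q)) =
       a * (la + q) + (1 + T) * (eta * (1 + e) + e * la + q) by ring.
    by rewrite addr_ge0// mulr_ge0 ?addr_ge0// mulr_ge0// addr_ge0.
  exact: aux.
have hsde : {ae P, forall w, forall k, M j (u k) w = m0 0 j + \int[lebesgue_measure]_(v in `[0, u k])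
          (alpha j 0 (X v w) - gamma j 0 (X v w) * M j v w) + I k w}.
  by apply/ae_foralln => k; have [] := hI k.
have hcont := OU_continuous (hM j); have hreg := right_regular_ae hX.
near=> w.
have cw : {within `[0, +oo[, continuous (fun t => M j t w)} by near: w.
have rw : right_regular X w by near: w.
have sde : forall k, M j (u k) w = m0 0 j + \int[lebesgue_measure]_(v in `[0, u k])
          (alpha j 0 (X v w) - gamma j 0 (X v w) * M j v w) + I k w by near: w.
split=> // A om A0 om0 MA Mom.
pose m t := M j t w.
have mm : measurable_fun `[0, u n] m.
  apply: subspace_continuous_measurable_fun; first exact: measurable_itv.
  apply: continuous_subspaceW cw => v /=; rewrite !in_itv/= andbT => /andP[]//.
pose a k := \int[lebesgue_measure]_(v in `[0, u k]) (alpha j 0 (X v w) - gamma j 0 (X v w) * m v).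
pose dr k := alpha j 0 (X (u k) w) - gamma j 0 (X (u k) w) * m (u k).
pose r k := a k.+1 - a k - dr k * mesh_size u k.
pose f k := m (u k) - euler_M X B alpha gamma sigma m0 u j k w - D k w.
have hr k : (k < n)%N -> `|r k| <= 2 * K * (1 + A) * beta k w + K * om * mesh_size u k.
  move=> kn; exact: (drift_truncation_error hX u0 u_mono (aK j) (gK j) b_occ rw mm A0 om0 MA Mom kn (mesh k)).
have hf := @damped_recursion_le R (fun k => gamma j 0 (X (u k) w)) (mesh_size u) f r (D^~ w) K n.
have {}hf : `|f n| <= \sum_(k < n) (`|r k| + K * (mesh_size u k * `|D k w|)).
  apply: hf.
  - rewrite /f /D /S /sp_integral big_ord0 subr0 /m sde u0 set_itv1 Rintegral_set1 /euler_M/=.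
    by rewrite addr0; ring.
  - move=> k kn; have /andP[g0 gk] := gK j (X (u k) w); split=> //.
    rewrite mulr_ge0//=; apply: le_trans Keta; exact: ler_pM.
  - move=> k kn.
    have SS : S k.+1 w = S k w + sigma j 0 (X (u k) w) * (W (u k.+1) w - W (u k) w).
      by rewrite /S /sp_integral/= big_ord_recr.
    have Mk l : m (u l) = m0 0 j + a l + I l w by exact: sde.
    rewrite /f /r /D SS /dr Mk (Mk k) /euler_M /= -/(euler_M X B alpha gamma sigma m0 u j k w) /W.
    ring.
have -> : M j (u n) w - euler_M X B alpha gamma sigma m0 u j n w = f n + D n w.
  by rewrite /f /m; ring.
apply: le_trans (ler_normD _ _) _.
apply: le_trans (lerD hf (lexx _)) _.
rewrite big_split/= -mulr_sumr.
have hrs : \sum_(k < n) `|r k| <= 2 * K * (1 + A) * \sum_(k < n) beta k w + K * om * T.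
  apply: (@le_trans _ _ (\sum_(k < n) (2 * K * (1 + A) * beta k w + K * om * mesh_size u k))).
    by apply: ler_sum => k _; exact: hr.
  rewrite big_split/= -!mulr_sumr lerD2l ler_wpM2l ?mulr_ge0//.
  have -> : \sum_(l < n) mesh_size u l = u n - u 0%N.
    by rewrite -(big_mkord xpredT (fun l => mesh_size u l)) telescope_sumr.
  by rewrite u0 subr0.
apply: le_trans (lerD (lerD hrs (lexx _)) (lexx _)) _.
apply: (@le_trans _ _ ((1 + 3 * K + K * T) * ((1 + A) * Z w + om))); last first.
  rewrite ler_wpM2r// addr_ge0// mulr_ge0 ?addr_ge0// /Z !addr_ge0//.
rewrite /Z; have := Z10 w; have := Z20 w; have : 0 <= `|D n w| by [].
set z1 := \sum_(l < n) beta l w; set z2 := \sum_(l < n) _; set z3 := `|D n w| => z30 z20 z10.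
have KT : 0 <= K * T by rewrite mulr_ge0.
have p1 : 0 <= K * om by rewrite mulr_ge0.
have p2 : z3 <= (1 + A) * (z3 + z1 + z2).
  by rewrite mulrDl mul1r -[leLHS]addr0 lerD ?mulr_ge0 ?addr_ge0// -addrA lerDl addr_ge0.
have p3 : (1 + A) * z1 <= (1 + A) * (z3 + z1 + z2) by rewrite ler_wpM2l ?addr_ge0//; lra.
have p4 : z2 <= (1 + A) * (z3 + z1 + z2).
  by rewrite mulrDl mul1r -[leLHS]addr0 lerD ?mulr_ge0 ?addr_ge0//; lra.
have p5 : 2 * K * (1 + A) * z1 + K * z2 + z3 <= (1 + 2 * K + K) * ((1 + A) * (z3 + z1 + z2)).
  have : K * ((1 + A) * z1) <= K * ((1 + A) * (z3 + z1 + z2)) by rewrite ler_wpM2l.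
  have : K * z2 <= K * ((1 + A) * (z3 + z1 + z2)) by rewrite ler_wpM2l.
  lra.
have p6 : 0 <= (1 + A) * (z3 + z1 + z2) by rewrite mulr_ge0 ?addr_ge0.
have -> : (1 + 3 * K + K * T) * ((1 + A) * (z3 + z1 + z2) + om) =
    (1 + 2 * K + K) * ((1 + A) * (z3 + z1 + z2)) + K * T * ((1 + A) * (z3 + z1 + z2))
    + (1 + 3 * K) * om + K * om * T by ring.
have p7 : 0 <= K * T * ((1 + A) * (z3 + z1 + z2)) by rewrite mulr_ge0.
have p8 : 0 <= (1 + 3 * K) * om by rewrite mulr_ge0// addr_ge0// mulr_ge0.
lra.
Unshelve. all: by end_near.
Qed.

End EulerConvergence.

(** * Uniform integrability *)

Lemma within_continuous_segment_unif (R : realType) (f : R -> R) (T : R) :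
  {within `[0, +oo[, continuous f} ->
  (exists2 A, 0 <= A & forall v, v \in `[0, T] -> `|f v| <= A) /\
  forall e, 0 < e -> exists2 eta, 0 < eta & forall v v', v \in `[0, T] -> v' \in `[0, T] ->
    `|v - v'| <= eta -> `|f v - f v'| <= e.
Proof.
move=> cf0; have cf : {within `[0, T], continuous f}.
  by apply: continuous_subspaceW cf0 => v /=; rewrite !in_itv/= andbT => /andP[].
split.
  have /compact_bounded [A [Ar hA]] := continuous_compact cf (@segment_compact _ 0 T).
  exists (Num.max 0 (A + 1)); first by rewrite le_max lexx.
  move=> v vT; apply: (@le_trans _ _ (A + 1)); last by rewrite le_max lexx orbT.
  by apply: (hA (A + 1)); [rewrite ltrDl|exists v].
move=> e e0.
have /compact_near_coveringP cov := @segment_compact R 0 T.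
have := cov R (0^'+) (fun eta v => v \in `[0, T] -> forall v', v' \in `[0, T] ->
    `|v - v'| <= eta -> `|f v - f v'| <= e) _.
case=> [x xT|eta /= eta0 heta].
  move/subspace_continuousP : cf => /(_ x xT)/cvgrPdist_le /(_ (e / 2)).
  rewrite divr_gt0// => /(_ isT); rewrite near_withinE => -[r /= r0 hr].
  have r20 : 0 < r / 2 by rewrite divr_gt0.
  near=> v eta => /= vT v' v'T vv'.
  have vx : `|x - v| < r / 2.
    by near: v; exists (r / 2).
  have eta_r : eta < r / 2 by near: eta; exact: nbhs_right_lt.
  have h1 : `|f x - f v| <= e / 2 by apply: hr => //=; lra.
  have h2 : `|f x - f v'| <= e / 2.
    apply: hr => //=; have -> : x - v' = (x - v) + (v - v') by ring.
    by apply: le_lt_trans (ler_normD _ _) _; lra.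
  have -> : f v - f v' = (f x - f v') - (f x - f v) by ring.
  by apply: le_trans (ler_normB _ _) _; lra.
exists (eta / 2); first by rewrite divr_gt0.
move=> v v' vT; apply: heta => //=; last by rewrite divr_gt0.
by rewrite sub0r normrN gtr0_norm ?divr_gt0// ltr_pdivrMr//; lra.
Unshelve. all: by end_near.
Qed.

Lemma min_lipschitz (R : realType) (a b L : R) : `|Num.min a L - Num.min b L| <= `|a - b|.
Proof.
have h := ler_norm (a - b); have h' := ler_norm (b - a); rewrite distrC in h'.
by rewrite ler_norml; case: (leP a L) => aL; case: (leP b L) => bL; apply/andP; split; lra.
Qed.

Section Convergence.
Context {disp : measure_display} {Omega : measurableType disp} {R : realType}.
Variable P : probability Omega R.

(** The sum of the [Z n] has finite mean, hence is almost surely finite, and each term is bounded by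
    a tail. *)
Lemma ae_cvg0_summable (Z : nat -> Omega -> R) (C : R) : 0 <= C ->
  (forall n, measurable_fun setT (Z n)) -> (forall n w, 0 <= Z n w) ->
  (forall n, (\int[P]_w (Z n w)%:E <= (C / (2 ^ n.+1)%:R)%:E)%E) ->
  {ae P, forall w, Z n w @[n --> \oo] --> 0}.
Proof.
move=> C0 mZ Z0 intZ.
have mZE n : measurable_fun setT (fun w => (Z n w)%:E) by exact/measurable_EFinP.
pose S w := (\sum_(0 <= n <oo) (Z n w)%:E)%E.
have mS : measurable_fun setT S.
  by apply: (ge0_emeasurable_sum (P := xpredT)) => [n w _ _|n _]; rewrite ?lee_fin.
have S0 w : (0 <= S w)%E by apply: nneseries_ge0 => n _ _; rewrite lee_fin.
have iS : P.-integrable setT S.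
  apply/integrableP; split=> //.
  under eq_integral do rewrite gee0_abs//.
  rewrite integral_nneseries//; last by move=> n w _; rewrite lee_fin.
  apply: (@le_lt_trans _ _ C%:E); last exact: ltry.
  apply: le_trans (epsilon_trick0 xpredT C0).
  by apply: lee_nneseries => [n _ _|n _]; [apply: integral_ge0 => w _; rewrite lee_fin|exact: intZ].
apply: filterS (integrable_ae measurableT iS) => w /(_ I) Sfin.
have tail : (\sum_(N <= n <oo) (Z n w)%:E @[N --> \oo] --> 0)%E.
  apply: nneseries_tail_cvg => [|n _]; last by rewrite lee_fin.
  by rewrite ltey_eq Sfin.
apply/cvgrPdist_lt => e e0.
have := cvg0_lt tail e0; apply: filterS => N hN.
rewrite sub0r normrN ger0_norm// -lte_fin; apply: le_lt_trans hN.
have := @nneseries_lim_ge R (fun n => (Z n w)%:E) xpredT N N.+1.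
by rewrite big_nat1; apply => n _ _; rewrite lee_fin.
Qed.

Lemma fatou_sqr_le (f_ : nat -> Omega -> R) (f : Omega -> R) (C : R) :
  (forall n, measurable_fun setT (f_ n)) -> measurable_fun setT f ->
  {ae P, forall w, f_ n w @[n --> \oo] --> f w} ->
  (forall n, (\int[P]_w ((f_ n w) ^+ 2)%:E <= C%:E)%E) ->
  (\int[P]_w ((f w) ^+ 2)%:E <= C%:E)%E.
Proof.
move=> mf_ mf ff hC.
pose g n w := ((f_ n w) ^+ 2)%:E.
have mg n : measurable_fun setT (g n) by apply/measurable_EFinP; exact: measurable_funX.
have g0 n w : setT w -> (0 <= g n w)%E by rewrite lee_fin sqr_ge0.
apply: (@le_trans _ _ (\int[P]_w limn_einf (g ^~ w))%E).
  apply: ae_ge0_le_integral_nonmeasurable.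
  - by apply/measurable_EFinP; exact: measurable_funX.
  - by move=> w; rewrite lee_fin sqr_ge0.
  - move=> w; rewrite limn_einf_lim; apply: lime_ge; first exact: is_cvg_einfs.
    by apply: nearW => n; apply: le_ereal_inf_tmp => _ [m /= _ <-]; exact: g0.
  apply: filterS ff => w fw.
  have gw : (g n w @[n --> \oo] --> ((f w) ^+ 2)%:E)%E.
    by apply: cvg_EFin; [exact: nearW|exact: (cvgM fw fw)].
  by rewrite (cvg_limn_einf_sup gw).1.
apply: le_trans (fatou P measurableT mg g0) _.
rewrite limn_einf_lim; apply: lime_le; first exact: is_cvg_einfs.
apply: nearW => n; apply: ge_ereal_inf; exists (\int[P]_x g n x)%E; last exact: hC.
by exists n => /=.
Qed.

Lemma sqr_integrable (f : Omega -> R) (C : R) : measurable_fun setT f ->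
  (\int[P]_w ((f w) ^+ 2)%:E <= C%:E)%E -> P.-integrable setT (EFin \o f).
Proof.
move=> mf h; apply/integrableP; split; first exact/measurable_EFinP.
have := integral_norm_le_sqr mf ltr01 h => h1.
by apply: le_lt_trans h1 _; rewrite ltry.
Qed.

Lemma sqr_truncation (f : Omega -> R) (C L : R) : measurable_fun setT f ->
  (\int[P]_w ((f w) ^+ 2)%:E <= C%:E)%E -> 0 < L ->
  (\int[P]_w (`|f w - Num.min (f w) L|)%:E <= (C / L)%:E)%E.
Proof.
move=> mf h L0.
have mg : measurable_fun setT (fun w => f w - Num.min (f w) L).
  by apply: measurable_funB => //; exact: measurable_minr.
apply: (@le_trans _ _ (\int[P]_w (L^-1%:E * ((f w) ^+ 2)%:E))%E).
  apply: ge0_le_integral => //.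
  - by apply/measurable_EFinP; exact: measurableT_comp.
  - by apply: measurable_funeM; apply/measurable_EFinP; exact: measurable_funX.
  move=> w _; rewrite -EFinM lee_fin.
  case: (leP (f w) L) => [_|Lf]; first by rewrite subrr normr0 mulr_ge0 ?sqr_ge0// invr_ge0 ltW.
  rewrite ger0_norm ?subr_ge0 ?(ltW Lf)// ler_pdivlMl// expr2; nra.
rewrite ge0_integralZl//; last 3 first.
- by apply/measurable_EFinP; exact: measurable_funX.
- by move=> w _; rewrite lee_fin sqr_ge0.
- by rewrite lee_fin invr_ge0 ltW.
by rewrite mulrC EFinM lee_wpmul2l// lee_fin invr_ge0 ltW.
Qed.

(** Functions truncated at [L] converge in mean by domination, and truncation costs at most [C / L]
    uniformly in [n]; Fatou gives the second moment of the limit. *)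
Lemma uniformly_integrable_cvg (f_ : nat -> Omega -> R) (f : Omega -> R) (C : R) :
  (forall n, measurable_fun setT (f_ n)) -> measurable_fun setT f ->
  (forall n w, 0 <= f_ n w) ->
  {ae P, forall w, f_ n w @[n --> \oo] --> f w} ->
  (forall n, (\int[P]_w ((f_ n w) ^+ 2)%:E <= C%:E)%E) ->
  P.-integrable setT (EFin \o f) /\
  \int[P]_w (f_ n w) @[n --> \oo] --> \int[P]_w (f w).
Proof.
move=> mf_ mf f0 ff hC.
have hf := fatou_sqr_le mf_ mf ff hC.
have if_ n := sqr_integrable (mf_ n) (hC n); have iff := sqr_integrable mf hf.
split=> //; apply/cvgrPdist_le => e e0.
have C0 : 0 <= C.
  by rewrite -lee_fin; apply: le_trans hf; apply: integral_ge0 => w _; rewrite lee_fin sqr_ge0.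
(* Makes both truncation errors at most [e / 4]; the remaining [e / 2] goes to the truncated
   functions. *)
pose L := 1 + C * (4 / e).
have L0 : 0 < L by rewrite ltr_pwDl// mulr_ge0// divr_ge0// ltW.
have CL : C / L <= e / 4.
  rewrite ler_pdivrMr//; have -> : e / 4 * L = e / 4 + C by rewrite /L; field; rewrite gt_eqF.
  by rewrite lerDr divr_ge0// ltW.
clearbody L.
have mm (g : Omega -> R) : measurable_fun setT g -> measurable_fun setT (fun w => Num.min (g w) L).
  by move=> mg; exact: measurable_minr.
have im (g : Omega -> R) : P.-integrable setT (EFin \o g) -> P.-integrable setT (EFin \o (fun w => Num.min (g w) L)).
  move=> ig; have mg : measurable_fun setT g by apply/measurable_EFinP; exact: measurable_int ig.
  have igL : P.-integrable setT (fun w => (`|g w| + L)%:E).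
    have iL : P.-integrable setT (EFin \o (cst L : Omega -> R)) by exact: finite_measure_integrable_cst.
    exact: (integrableD measurableT (integrable_norm ig) iL).
  apply: le_integrable igL => //; first by apply/measurable_EFinP; exact: mm.
  move=> w _ /=; rewrite lee_fin [leRHS]ger0_norm ?addr_ge0 ?(ltW L0)//.
  by case: (leP (g w) L) => _; [rewrite lerDl ltW|rewrite (gtr0_norm L0) lerDr].
have tr (g : Omega -> R) : P.-integrable setT (EFin \o g) ->
    (\int[P]_w ((g w) ^+ 2)%:E <= C%:E)%E ->
    `|\int[P]_w (g w) - \int[P]_w (Num.min (g w) L)| <= e / 4.
  move=> ig hg; have mg : measurable_fun setT g by apply/measurable_EFinP; exact: measurable_int ig.
  have igm := im g ig.
  rewrite -RintegralB//; apply: le_trans (le_normr_Rintegral _ _) _ => //.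
    exact: (integrableB measurableT ig igm).
  rewrite -lee_fin; apply: le_trans _ (_ : (C / L)%:E <= _)%E; last by rewrite lee_fin.
  rewrite /Rintegral fineK; first exact: sqr_truncation.
  apply: integrable_fin_num => //; apply: integrable_norm.
  exact: (integrableB measurableT ig igm).
have cL : P.-integrable setT (EFin \o (cst L : Omega -> R)) by exact: finite_measure_integrable_cst.
have dct : (\int[P]_w (Num.min (f_ n w) L)%:E @[n --> \oo] --> \int[P]_w (Num.min (f w) L)%:E)%E.
  have [|||||_ _ //] := @dominated_convergence _ _ R P setT measurableT
    (fun n w => (Num.min (f_ n w) L)%:E) (fun w => (Num.min (f w) L)%:E) (EFin \o cst L).
  - by move=> n; apply/measurable_EFinP; exact: mm.
  - by apply/measurable_EFinP; exact: mm.
  - apply: filterS ff => w fw _; apply: cvg_EFin; first exact: nearW.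
    move/cvgrPdist_le : fw => fw; apply/cvgrPdist_le => e' e'0; move: (fw _ e'0).
    by apply: filterS => n; apply: le_trans; exact: min_lipschitz.
  - exact: cL.
  - by apply/aeW => w n _ /=; rewrite lee_fin ger0_norm ?ge_min ?lexx ?orbT// le_min f0 ltW.
have {}dct : \int[P]_w (Num.min (f_ n w) L) @[n --> \oo] --> \int[P]_w (Num.min (f w) L).
  apply: fine_cvg; move: dct; rewrite /Rintegral fineK//.
  by apply: integrable_fin_num => //; exact: im.
have e20 : 0 < e / 2 by rewrite divr_gt0.
move/cvgrPdist_le : dct => /(_ _ e20); apply: filterS => n hn.
have h1 := tr f iff hf; have h2 := tr (f_ n) (if_ n) (hC n).
move: h1 h2 hn; rewrite !ler_norml => /andP[a1 a2] /andP[a3 a4] /andP[a5 a6].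
by apply/andP; split; lra.
Qed.

End Convergence.

Section TwoPointGrid.
Context {R : realType}.
Variables (s t : R) (N : nat).
Hypotheses (s0 : 0 <= s) (st : s <= t) (N0 : (0 < N)%N).

(* [N] equal steps from 0 to [s], then equal steps reaching [t] at index [2 N]. *)
Definition two_point_grid (k : nat) : R :=
  (minn k N)%:R * (s / N%:R) + (k - N)%N%:R * ((t - s) / N%:R).

Let N0' : 0 < N%:R :> R. Proof. by rewrite ltr0n. Qed.

Lemma two_point_grid0 : two_point_grid 0 = 0.
Proof. by rewrite /two_point_grid min0n sub0n !mul0r addr0. Qed.

Lemma two_point_grid_mid : two_point_grid N = s.
Proof. by rewrite /two_point_grid minnn subnn mul0r addr0 mulrC divfK// gt_eqF. Qed.

Lemma two_point_grid_end : two_point_grid (N + N) = t.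
Proof.
rewrite /two_point_grid (minn_idPr _) ?leq_addr// addnK.
by rewrite ![N%:R * _]mulrC !divfK ?gt_eqF// addrC subrK.
Qed.

Lemma two_point_grid_mesh k :
  0 <= mesh_size two_point_grid k /\ mesh_size two_point_grid k <= t / N%:R.
Proof.
rewrite /mesh_size /two_point_grid.
have [kN|Nk] := ltnP k N.
  rewrite (minn_idPl kN).
  have -> : (k.+1 - N = 0)%N by apply/eqP; rewrite subn_eq0.
  have -> : (k - N = 0)%N by apply/eqP; rewrite subn_eq0 ltnW.
  rewrite -natr1.
  have -> : (k%:R + 1) * (s / N%:R) + 0%:R * ((t - s) / N%:R)
     - (k%:R * (s / N%:R) + 0%:R * ((t - s) / N%:R)) = s / N%:R by ring.
  by rewrite divr_ge0// ler_pM2r// invr_gt0.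
rewrite (minn_idPr (leqW Nk)) subSn// -natr1.
have -> : N%:R * (s / N%:R) + ((k - N)%:R + 1) * ((t - s) / N%:R) -
   (N%:R * (s / N%:R) + (k - N)%:R * ((t - s) / N%:R)) = (t - s) / N%:R by ring.
by rewrite divr_ge0 ?subr_ge0// ler_pM2r ?invr_gt0// gerBl.
Qed.

Lemma two_point_grid_mono k : two_point_grid k <= two_point_grid k.+1.
Proof. by rewrite -subr_ge0; have [] := two_point_grid_mesh k. Qed.

End TwoPointGrid.

Section EulerBounds.
Context {Omega : Type} {R : realType}.
Variables (d : nat) (X : R -> Omega -> 'I_d) (u : nat -> R).
Variables (alpha gamma sigma : 'rV[R]_d) (m0 K : R).
Hypotheses (aK : forall i, `|alpha 0 i| <= K)
  (gK : forall i, 0 <= gamma 0 i <= K) (sK : forall i, `|sigma 0 i| <= K).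
Hypotheses (u0 : u 0%N = 0) (u_mono : forall k, u k <= u k.+1)
  (mesh : forall k, K * mesh_size u k <= 1).

Lemma euler_damping k w : 0 <= 1 - gamma 0 (X (u k) w) * mesh_size u k <= 1.
Proof.
have m_ge0 : 0 <= mesh_size u k by rewrite subr_ge0.
have /andP[g0 gk] := gK (X (u k) w).
rewrite gerBl mulr_ge0// andbT subr_ge0; apply: le_trans (mesh k).
exact: ler_wpM2r.
Qed.

Lemma euler_mean_bound k w : `|euler_mean X u alpha gamma m0 k w| <= `|m0| + K * u k.
Proof.
elim: k => [|k ih] /=; first by rewrite u0 mulr0 addr0.
have m_ge0 : 0 <= mesh_size u k by rewrite subr_ge0.
have /andP[c0 c1] := euler_damping k w.
have -> : `|m0| + K * u k.+1 = `|m0| + K * u k + K * mesh_size u k by rewrite /mesh_size; ring.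
apply: le_trans (ler_normD _ _) _; apply: lerD.
  by apply: le_trans ih; rewrite normrM (ger0_norm c0) ler_piMl.
by rewrite normrM (ger0_norm m_ge0) ler_wpM2r.
Qed.

Lemma euler_var_bound k w : 0 <= euler_var X u gamma sigma k w <= K ^+ 2 * u k.
Proof.
elim: k => [|k /andP[v0 vk]] /=; first by rewrite u0 mulr0 lexx.
have m_ge0 : 0 <= mesh_size u k by rewrite subr_ge0.
have /andP[c0 c1] := euler_damping k w.
apply/andP; split; first by apply: addr_ge0; apply: mulr_ge0 => //; exact: sqr_ge0.
have -> : K ^+ 2 * u k.+1 = K ^+ 2 * u k + K ^+ 2 * mesh_size u k by rewrite /mesh_size; ring.
apply: lerD.
  by apply: le_trans vk; rewrite ler_piMl// exprn_ile1.
have := sK (X (u k) w); rewrite ler_norml => /andP[sl sr].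
by rewrite ler_wpM2r// !expr2; nra.
Qed.

End EulerBounds.

Lemma natr_expn4_gt (R : realType) (x : R) : \forall n \near \oo, x < (4 ^ n)%:R.
Proof.
exists (Num.truncn x).+1 => // n /= xn.
have : (n <= 4 ^ n)%N by apply: ltnW; exact: ltn_expl.
move=> n4; apply: (@lt_le_trans _ _ n%:R); last by rewrite ler_nat.
have [x0|x0] := leP 0 x; last exact: lt_le_trans x0 _.
by have /andP[_ h] := truncn_itv x0; apply: lt_le_trans h _; rewrite ler_nat.
Qed.

(** * Convergence of the Euler transforms to the transform of M *)

Section TransformApprox.
Context {disp : measure_display} {Omega : measurableType disp} {R : realType}.
Variables (P : probability Omega R) (d J : nat) (Q : 'M[R]_d).
Variables (X : R -> Omega -> 'I_d) (B : 'I_J -> R -> {RV P >-> R}).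
Hypothesis hX : markov_chain P Q X.
Hypothesis hB : forall j, brownian_motion (B j).
Hypothesis hXB : mutual_independence P (chain_and_noises X B `[0, +oo[).
Variables (alpha gamma sigma : 'I_J -> 'rV[R]_d) (m0 : 'rV[R]_J) (M : 'I_J -> R -> {RV P >-> R}).
Hypothesis hM : forall j, modulated_OU (natural_filtration X B) X (B j)
                      (alpha j) (gamma j) (sigma j) (m0 0 j) (M j).
Variable K : R.
Hypotheses (K0 : 0 <= K) (aK : forall j i, `|alpha j 0 i| <= K)
  (gK : forall j i, 0 <= gamma j 0 i <= K) (sK : forall j i, `|sigma j 0 i| <= K).

Definition log_laplace_bound (T : R) (theta : 'rV[R]_J) : R :=
  \sum_(j < J) (`|theta 0 j| * (`|m0 0 j| + K * T) + theta 0 j ^+ 2 * (K ^+ 2 * T)).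

Lemma log_laplace_le (u : nat -> R) (T : R) theta k w : u 0%N = 0 -> (forall l, u l <= u l.+1) ->
  (forall l, K * mesh_size u l <= 1) -> u k <= T ->
  `|log_laplace X alpha gamma sigma m0 u theta k w| <= log_laplace_bound T theta.
Proof.
move=> u0 u_mono mesh ukT; rewrite /log_laplace; apply: le_trans (ler_norm_sum _ _ _) _.
apply: ler_sum => j _.
have hm := euler_mean_bound X (alpha := alpha j) (gamma := gamma j) (m0 0 j) (aK j) (gK j) u0 u_mono mesh k w.
have /andP[v0 vk] := euler_var_bound X (gK j) (sK j) u0 u_mono mesh k w.
have uk0 := grid_ge0 u0 u_mono k.
apply: le_trans (ler_normD _ _) _; apply: lerD.
  rewrite normrN normrM; apply: ler_wpM2l => //; apply: le_trans hm _.
  by rewrite lerD2l ler_wpM2l.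
rewrite -mulrA normrM (ger0_norm (sqr_ge0 _)) ler_wpM2l ?sqr_ge0//.
have h : K ^+ 2 * u k <= K ^+ 2 * T by rewrite ler_wpM2l ?sqr_ge0.
rewrite ger0_norm ?divr_ge0//; apply: le_trans (le_trans vk h).
by rewrite ler_piMr//; lra.
Qed.

Lemma transform_approx (T : R) : 0 <= T -> exists2 dl, 0 < dl &
  forall (u : nat -> nat -> R) (c : nat -> nat) (r : R),
    (forall n, u n 0%N = 0) -> (forall n k, u n k <= u n k.+1) ->
    (forall n k, mesh_size (u n) k <= T / (4 ^ n)%:R) ->
    (forall n k, mesh_size (u n) k <= dl) ->
    (forall n, u n (c n) = r) -> r <= T -> forall theta i,
    P.-integrable setT (EFin \o transform_integrand X M theta r i) /\
    \int[P]_w (expR (log_laplace X alpha gamma sigma m0 (u n) theta (c n) w) * (X r w == i)%:R)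
      @[n --> \oo] --> transform X M theta r i 0.
Proof.
move=> T0.
have [C C0 [dl0 dl00 err]] := euler_error hX hB hXB hM K0 aK gK sK T0.
have K1 : 0 < 1 + K by rewrite ltr_pwDl.
exists (Num.min dl0 (1 + K)^-1); first by rewrite lt_min dl00 invr_gt0.
move=> u c r u0 u_mono meshT meshdl ur rT theta i.
have r0 : 0 <= r by rewrite -(ur 0%N) grid_ge0.
have meshK n k : K * mesh_size (u n) k <= 1.
  have m0' : 0 <= mesh_size (u n) k by rewrite subr_ge0.
  have h : mesh_size (u n) k <= (1 + K)^-1 by apply: le_trans (meshdl n k) _; rewrite ge_min lexx orbT.
  have : (1 + K) * mesh_size (u n) k <= 1 by rewrite -ler_pdivlMl// mulr1.
  rewrite mulrDl mul1r; lra.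
pose eta n := Num.min (T / (4 ^ n)%:R) dl0.
have eta0 n : 0 <= eta n by rewrite le_min divr_ge0// ltW.
have eta_dl n : eta n <= dl0 by rewrite ge_min lexx orbT.
have mesh_eta n k : mesh_size (u n) k <= eta n.
  by rewrite le_min meshT/=; apply: le_trans (meshdl n k) _; rewrite ge_min lexx.
(* With [eta] of order [4 ^ - n], this weight makes each of [eta], [la] and [eta / la] of order
   [2 ^ - n], hence summable. *)
pose la n : R := (2 ^ n)%:R^-1.
have la0 n : 0 < la n by rewrite invr_gt0 ltr0n expn_gt0.
pose C' := C * (2 * T + 1) * 2.
have C'0 : 0 <= C' by rewrite !mulr_ge0// addr_ge0// mulr_ge0.
pose m n := euler_M X B alpha gamma sigma m0 (u n).
have urT n : u n (c n) <= T by rewrite ur.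
have cvg_m (j : 'I_J) : {ae P, forall w, m n j (c n) w @[n --> \oo] --> M j r w}.
  have /choice[Z hZ] : forall n, exists Z : Omega -> R, [/\ measurable_fun setT Z, forall w, 0 <= Z w,
      (\int[P]_w (Z w)%:E <= (C * (eta n + la n + eta n / la n))%:E)%E &
      {ae P, forall w, {within `[0, +oo[, continuous (fun t => M j t w)} /\ forall A om, 0 <= A -> 0 <= om ->
        (forall v, v \in `[0, u n (c n)] -> `|M j v w| <= A) ->
        (forall v v', v \in `[0, u n (c n)] -> v' \in `[0, u n (c n)] -> `|v - v'| <= eta n ->
          `|M j v w - M j v' w| <= om) ->
        `|M j (u n (c n)) w - m n j (c n) w| <= C * ((1 + A) * Z w + om)}].
    by move=> n; exact: (err (u n) (c n) (eta n) (la n) j).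
  have Z0 : {ae P, forall w, Z n w @[n --> \oo] --> 0}.
    apply: (@ae_cvg0_summable _ _ _ P Z C' C'0) => n; have [mZn Zn0 h _] := hZ n => //.
    apply: le_trans h _; rewrite lee_fin /C'.
    have n2 : 0 < (2 ^ n)%:R :> R by rewrite ltr0n expn_gt0.
    have -> : C * (2 * T + 1) * 2 / (2 ^ n.+1)%:R = C * ((2 * T + 1) * (2 ^ n)%:R^-1).
      by rewrite expnS natrM; field; rewrite gt_eqF.
    apply: ler_wpM2l => //.
    have e4 : (4 ^ n)%:R = (2 ^ n)%:R * (2 ^ n)%:R :> R by rewrite -natrM -expnMn.
    have h1 : eta n <= T / (2 ^ n)%:R.
      apply: (@le_trans _ _ (T / (4 ^ n)%:R)); first by rewrite ge_min lexx.
      rewrite ler_wpM2l// lef_pV2 ?posrE ?ltr0n ?expn_gt0//.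
      by rewrite ler_nat -[4%N]/(2 ^ 2)%N -expnM leq_exp2l// leq_pmull.
    have h2 : eta n / la n <= T / (2 ^ n)%:R.
      rewrite /la invrK; apply: (@le_trans _ _ (T / (4 ^ n)%:R * (2 ^ n)%:R)).
        by rewrite ler_wpM2r// ge_min lexx.
      by rewrite e4 invfM mulrA divfK// gt_eqF.
    rewrite mulrDl mul1r -/(la n) -mulrA mulr_natl mulr2n -/(la n); move: h1 h2; rewrite -/(la n); lra.
  have good : {ae P, forall w, forall n, {within `[0, +oo[, continuous (fun t => M j t w)} /\ forall A om, 0 <= A -> 0 <= om ->
        (forall v, v \in `[0, u n (c n)] -> `|M j v w| <= A) ->
        (forall v v', v \in `[0, u n (c n)] -> v' \in `[0, u n (c n)] -> `|v - v'| <= eta n ->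
          `|M j v w - M j v' w| <= om) ->
        `|M j (u n (c n)) w - m n j (c n) w| <= C * ((1 + A) * Z n w + om)}.
    by apply/ae_foralln => n; have [] := hZ n.
  apply: filterS2 Z0 good => w Zw gw.
  have [cw _] := gw 0%N.
  have [[A A0 hA] uc] := within_continuous_segment_unif r cw.
  apply/cvgrPdist_le => e e0.
  have C1 : 0 < C + 1 by rewrite ltr_wpDl.
  have A1 : 0 < 1 + A by rewrite ltr_pwDl.
  pose om := e / 2 / (C + 1).
  have om0 : 0 < om by rewrite !divr_gt0.
  have [et et0 het] := uc om om0.
  have e1 : 0 < om / (1 + A) by rewrite divr_gt0.
  move/cvgrPdist_le : Zw => /(_ _ e1) Zw.
  apply: filterS2 Zw (natr_expn4_gt (T / et)) => n Zn n4.
  have [_ h] := gw n; rewrite ur in h.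
  have etan : eta n <= et.
    apply: (@le_trans _ _ (T / (4 ^ n)%:R)); first by rewrite ge_min lexx.
    rewrite ler_pdivrMr ?ltr0n ?expn_gt0// mulrC -ler_pdivrMr//; exact: ltW.
  have {}h := h A om A0 (ltW om0) hA (fun v v' vr v'r vv => het v v' vr v'r (le_trans vv etan)).
  apply: le_trans h _.
  have Zn' : (1 + A) * Z n w <= om.
    move: Zn; rewrite sub0r normrN => /(le_trans (ler_norm _)) Zn.
    by rewrite mulrC -ler_pdivlMr.
  apply: (@le_trans _ _ (C * (om + om))); first by rewrite ler_wpM2l// lerD2r.
  have -> : C * (om + om) = e * (C / (C + 1)).
    by rewrite /om; field; rewrite gt_eqF.
  rewrite ler_piMr ?(ltW e0)// ler_pdivrMr// mul1r lerDl//.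
pose f_ n w := expR (- \sum_(j < J) theta 0 j * m n j (c n) w) * (X r w == i)%:R.
have indE w : \1_(X r @^-1` [set i]) w = (X r w == i)%:R :> R.
  rewrite indicE; suff -> : (w \in X r @^-1` [set i]) = (X r w == i) by [].
  by apply/idP/eqP => [/set_mem//|h]; exact/mem_set.
have mchi : measurable_fun setT (fun w => (X r w == i)%:R : R).
  exact: (measurable_chain_fun hX (fun k => (k == i)%:R) r0).
have mf_ n : measurable_fun setT (f_ n).
  apply: measurable_funM => //; apply: measurableT_comp => //; apply: measurable_funN.
  apply: measurable_sum => j; apply: measurable_funM => //.
  exact: (measurable_euler_M hX hB hXB _ _ _ _ (u0 n) (u_mono n) j (c n)).
have mf : measurable_fun setT (transform_integrand X M theta r i).
  apply: measurable_funM; last first.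
    by rewrite (_ : \1__ = (fun w => (X r w == i)%:R : R)) //; exact/funext.
  apply: measurableT_comp => //; apply: measurable_funN.
  by apply: measurable_sum => j; exact: measurable_funM.
have f0 n w : 0 <= f_ n w by rewrite mulr_ge0 ?expR_ge0.
have chi_ge0 k : 0 <= (k == i)%:R :> R by [].
have lapl n (th : 'rV[R]_J) : (\int[P]_w (expR (- \sum_(j < J) th 0 j * m n j (c n) w) * (X r w == i)%:R)%:E =
    \int[P]_w (expR (log_laplace X alpha gamma sigma m0 (u n) th (c n) w) * (X r w == i)%:R)%:E)%E.
  exact: (@euler_laplace _ _ _ P d J Q X B hX hB hXB alpha gamma sigma m0 (u n) (u0 n)
    (u_mono n) th (c n) (fun k => (k == i)%:R) r r0 chi_ge0).
have cvg_f : {ae P, forall w, f_ n w @[n --> \oo] --> transform_integrand X M theta r i w}.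
  have /(filter_forall _) : forall j : 'I_J, {ae P, forall w, m n j (c n) w @[n --> \oo] --> M j r w} := cvg_m.
  apply: filterS => w hw; rewrite /f_ /transform_integrand indE.
  have cvg_arg : - \sum_(j < J) theta 0 j * m n j (c n) w @[n --> \oo] --> - \sum_(j < J) theta 0 j * M j r w.
    by apply: cvgN; apply: cvg_big => [|j _]; [exact: add_continuous|exact: cvgMr].
  apply: cvgM; last exact: cvg_cst.
  exact: (cvg_comp _ _ cvg_arg (@continuous_expR R _)).
have [|if_ cvg_int] := uniformly_integrable_cvg (C := expR (log_laplace_bound T (2 *: theta))) mf_ mf f0 cvg_f.
  move=> n; have -> : (\int[P]_w ((f_ n w) ^+ 2)%:E =
      \int[P]_w (expR (- \sum_(j < J) (2 *: theta) 0 j * m n j (c n) w) * (X r w == i)%:R)%:E)%E.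
    apply: eq_integral => w _; congr EFin; rewrite /f_ exprMn; congr (_ * _); last first.
      by case: (_ == _); rewrite ?expr1n ?expr0n.
    rewrite expr2 -expRD; congr expR; rewrite -opprD -big_split/=; congr (- _).
    by apply: eq_bigr => j _; rewrite mxE; ring.
  rewrite lapl.
  apply: (@le_trans _ _ (\int[P]_w (expR (log_laplace_bound T (2 *: theta)))%:E)%E).
    apply: ge0_le_integral_nonmeasurable => w; first by rewrite lee_fin mulr_ge0 ?expR_ge0.
    rewrite lee_fin; apply: le_trans (_ : expR (log_laplace X alpha gamma sigma m0 (u n) (2 *: theta) (c n) w) <= _).
      by rewrite ler_piMr ?expR_ge0//; case: (_ == _).
    rewrite ler_expR; apply: le_trans (ler_norm _) _; exact: log_laplace_le.
  by rewrite integral_cst// [X in (_ * X)%E](_ : _ = 1%E) ?mule1//; exact: probability_setT.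
split=> //.
have -> : transform X M theta r i 0 = \int[P]_w (transform_integrand X M theta r i w).
  by rewrite mxE unlock.
apply: cvg_trans cvg_int; apply: near_eq_cvg; apply: nearW => n.
by rewrite /Rintegral (lapl n theta).
Qed.

End TransformApprox.

(** * Consistency of the Euler transform *)

Section ExpIncrement.
Context {R : realType}.

(** With [x = dt psi + dt^2 rho] one has [|x| <= 2 Psi |dt|], so the Taylor remainder is at most
    [4 Psi^2 exp (2 Psi) dt^2]. One [Psi] pays for [rho], the other for the linear term in the
    Lipschitz bound. *)
Definition exp_increment_const (E Psi : R) : R :=
  E * (4 * Psi ^+ 2 * expR (2 * Psi) + 2 * Psi).

Lemma exp_increment_const_ge0 E Psi : 0 <= E -> 0 <= Psi -> 0 <= exp_increment_const E Psi.
Proof.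
move=> E0 P0; apply: mulr_ge0 => //; apply: addr_ge0; last exact: mulr_ge0.
by apply: mulr_ge0; [apply: mulr_ge0 => //; exact: sqr_ge0|exact: expR_ge0].
Qed.

(** Serves both for a step in time, with [dt] the mesh size, and for a displacement in [theta],
    where [dt] may be negative. *)
Lemma exp_increment (E Psi dt phi phi' psi rho : R) :
  phi' = phi + dt * psi + dt ^+ 2 * rho -> `|dt| <= 1 -> `|psi| <= Psi -> `|rho| <= Psi ->
  expR phi <= E ->
  `|expR phi' - expR phi - dt * (psi * expR phi)| <= exp_increment_const E Psi * dt ^+ 2 /\
  `|expR phi' - expR phi| <= exp_increment_const E Psi * `|dt|.
Proof.
move=> -> dt1 psiP rhoP phiE.
have Psi0 : 0 <= Psi by exact: le_trans psiP.
set x := dt * psi + dt ^+ 2 * rho.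
have dt2 : dt ^+ 2 = `|dt| ^+ 2 by rewrite real_normK ?num_real.
have dt0 : 0 <= `|dt| by [].
have hx : `|x| <= 2 * Psi * `|dt|.
  apply: le_trans (ler_normD _ _) _; rewrite !normrM.
  have h1 : `|dt| * `|psi| <= `|dt| * Psi by rewrite ler_wpM2l.
  have h2 : `|dt| * `|dt| * `|rho| <= 1 * `|dt| * Psi.
    by apply: ler_pM; [exact: mulr_ge0|exact: normr_ge0|exact: ler_wpM2r|].
  lra.
have hx2 : `|x| <= 2 * Psi by apply: le_trans hx _; rewrite ler_piMr// mulr_ge0.
have q : x ^+ 2 * expR `|x| <= 4 * Psi ^+ 2 * expR (2 * Psi) * dt ^+ 2.
  have -> : 4 * Psi ^+ 2 * expR (2 * Psi) * dt ^+ 2 = (2 * Psi * `|dt|) ^+ 2 * expR (2 * Psi).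
    by rewrite exprMn -dt2; ring.
  apply: ler_pM; [exact: sqr_ge0|exact: expR_ge0| |by rewrite ler_expR].
  by rewrite -(real_normK (num_real x)); apply: lerXn2r => //; rewrite nnegrE// !mulr_ge0.
have hE : 0 <= expR x - 1 - x <= 4 * Psi ^+ 2 * expR (2 * Psi) * dt ^+ 2.
  by rewrite expR_subDx_ge0/=; exact: le_trans (expR_subDx_le x) q.
have phi0 := expR_ge0 phi.
have E0 : 0 <= E by exact: le_trans phi0 phiE.
have c0 : 0 <= 4 * Psi ^+ 2 * expR (2 * Psi).
  by rewrite mulr_ge0 ?expR_ge0// mulr_ge0// sqr_ge0.
have rho2 : `|dt ^+ 2 * rho| <= Psi * dt ^+ 2.
  by rewrite normrM ger0_norm ?sqr_ge0// mulrC ler_wpM2r// sqr_ge0.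
have key : `|expR x - 1 - dt * psi| <= (4 * Psi ^+ 2 * expR (2 * Psi) + Psi) * dt ^+ 2.
  have -> : expR x - 1 - dt * psi = (expR x - 1 - x) + dt ^+ 2 * rho by rewrite /x; ring.
  apply: le_trans (ler_normD _ _) _; rewrite mulrDl; apply: lerD => //.
  by case/andP: hE => h1 h2; rewrite ger0_norm.
have sq0 : 0 <= dt ^+ 2 by exact: sqr_ge0.
have -> : expR (phi + dt * psi + dt ^+ 2 * rho) = expR phi * expR x by rewrite -expRD /x addrA.
split.
  have -> : expR phi * expR x - expR phi - dt * (psi * expR phi) =
      expR phi * (expR x - 1 - dt * psi) by ring.
  rewrite normrM (ger0_norm phi0) /exp_increment_const -mulrA.
  apply: ler_pM => //; apply: le_trans key _; rewrite ler_wpM2r//.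
  by rewrite lerD2l ler_peMl// ler1n.
have -> : expR phi * expR x - expR phi = expR phi * (expR x - 1) by ring.
rewrite normrM (ger0_norm phi0) /exp_increment_const -mulrA.
apply: ler_pM => //.
have -> : expR x - 1 = (expR x - 1 - dt * psi) + dt * psi by ring.
apply: le_trans (ler_normD _ _) _.
have k1 : (4 * Psi ^+ 2 * expR (2 * Psi) + Psi) * dt ^+ 2 <= (4 * Psi ^+ 2 * expR (2 * Psi) + Psi) * `|dt|.
  by rewrite ler_wpM2l ?addr_ge0// dt2 expr2 ler_piMl.
have k2 : `|dt * psi| <= Psi * `|dt| by rewrite normrM mulrC ler_wpM2r.
apply: le_trans (lerD (le_trans key k1) k2) _; rewrite -mulrDl ler_wpM2r//.
lra.
Qed.

End ExpIncrement.

Section BoundedExpectation.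
Context {disp : measure_display} {Omega : measurableType disp} {R : realType}.
Variable P : probability Omega R.

Lemma norm_Rintegral_le (V : Omega -> R) (c : R) (A : set Omega) : measurable A ->
  measurable_fun setT V -> 0 <= c -> (forall w, `|V w| <= c * \1_A w) ->
  `|\int[P]_w V w| <= c * fine (P A).
Proof.
move=> mA mV c0 Vc.
have iV : P.-integrable setT (EFin \o V).
  apply: bounded_integrable => //; exists c => w; apply: le_trans (Vc w) _.
  by rewrite ler_piMr// indicE; case: (_ \in _).
apply: le_trans (le_normr_Rintegral _ _) _ => //.
have PA : P A \is a fin_num by exact: fin_num_measure.
rewrite -lee_fin EFinM (fineK PA) /Rintegral fineK; last first.
  by apply: integrable_fin_num => //; exact: integrable_norm.
apply: (@le_trans _ _ (\int[P]_w (c%:E * (\1_A w)%:E))%E).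
  apply: ge0_le_integral => //.
  - by apply/measurable_EFinP; exact: measurableT_comp.
  - by apply: measurable_funeM; apply/measurable_EFinP; exact: measurable_indic.
  - by move=> w _; rewrite -EFinM lee_fin.
rewrite ge0_integralZl//; last first.
- by apply/measurable_EFinP; exact: measurable_indic.
by rewrite integral_indic// setIT.
Qed.

Lemma norm_Rintegral_le_cst (V : Omega -> R) (c : R) :
  measurable_fun setT V -> 0 <= c -> (forall w, `|V w| <= c) -> `|\int[P]_w V w| <= c.
Proof.
move=> mV c0 Vc; have := @norm_Rintegral_le V c setT measurableT mV c0.
have -> : fine (P setT) = 1 by rewrite probability_setT.
by rewrite mulr1; apply => w; rewrite indicE in_setT mulr1.
Qed.

Lemma RintegralB_bounded (V W : Omega -> R) : measurable_fun setT V -> measurable_fun setT W ->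
  bounded_rv V -> bounded_rv W ->
  \int[P]_w V w - \int[P]_w W w = \int[P]_w (V w - W w).
Proof. by move=> mV mW bV bW; rewrite RintegralB//; exact: bounded_integrable. Qed.

Lemma RintegralZ_bounded (V : Omega -> R) (c : R) : measurable_fun setT V -> bounded_rv V ->
  c * \int[P]_w V w = \int[P]_w (c * V w).
Proof. by move=> mV bV; rewrite RintegralZl//; exact: bounded_integrable. Qed.

Lemma Rintegral_sum_bounded (I : finType) (V : I -> Omega -> R) :
  (forall i, measurable_fun setT (V i)) -> (forall i, bounded_rv (V i)) ->
  \sum_i \int[P]_w V i w = \int[P]_w \sum_i V i w.
Proof.
move=> mV bV; have iV i := bounded_integrable P (mV i) (bV i).
rewrite /Rintegral; under eq_integral do rewrite -sumEFin.
rewrite integral_sum// sum_fine// => i _.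
by apply: (integrable_fin_num _ (iV i)).
Qed.

End BoundedExpectation.

(** * One step of the Euler transform, uniformly in the grid *)

Section EulerStep.
Context {disp : measure_display} {Omega : measurableType disp} {R : realType}.
Variables (P : probability Omega R) (d J : nat) (Q : 'M[R]_d) (X : R -> Omega -> 'I_d).
Hypothesis hX : markov_chain P Q X.
Variables (alpha gamma sigma : 'I_J -> 'rV[R]_d) (m0 : 'rV[R]_J).
Variable K : R.
Hypotheses (K0 : 0 <= K) (aK : forall j i, `|alpha j 0 i| <= K)
  (gK : forall j i, 0 <= gamma j 0 i <= K) (sK : forall j i, `|sigma j 0 i| <= K).
Variables (T : R) (theta : 'rV[R]_J).
Hypothesis T0 : 0 <= T.

Definition fine_grid (u : nat -> R) (eta : R) (n : nat) : Prop :=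
  [/\ u 0%N = 0, forall k, u k <= u k.+1, forall k, mesh_size u k <= eta,
      forall k, K * mesh_size u k <= 1 & u n <= T].

Section OneGrid.
Variables (u : nat -> R) (eta : R) (n : nat).
Hypothesis hu : fine_grid u eta n.

Let u0 : u 0%N = 0. Proof. by case: hu. Qed.
Let u_mono k : u k <= u k.+1. Proof. by case: hu. Qed.
Let meshK k : K * mesh_size u k <= 1. Proof. by case: hu. Qed.
Let ukT k : (k <= n)%N -> u k <= T.
Proof. by move=> kn; case: hu => _ _ _ _; apply: le_trans; exact: grid_mono. Qed.
Let uk0 k : 0 <= u k. Proof. exact: grid_ge0. Qed.

Notation mu j k := (euler_mu X alpha gamma m0 u j k).
Notation v j k := (euler_v X gamma sigma u j k).
Notation phi k := (log_laplace X alpha gamma sigma m0 u theta k).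

Definition moment_bound : R := \sum_(j < J) `|m0 0 j| + K * T + K ^+ 2 * T.

Lemma moment_bound_ge0 : 0 <= moment_bound.
Proof.
apply: addr_ge0; last by rewrite mulr_ge0 ?sqr_ge0.
by apply: addr_ge0; [exact: sumr_ge0|exact: mulr_ge0].
Qed.

Lemma euler_mu_le j k w : (k <= n)%N -> `|mu j k w| <= moment_bound.
Proof.
move=> kn; apply: le_trans (euler_mean_bound X (m0 0 j) (aK j) (gK j) u0 u_mono meshK k w) _.
have h1 : `|m0 0 j| <= \sum_(j < J) `|m0 0 j| by rewrite (bigD1 j)//= lerDl sumr_ge0.
have h2 : K * u k <= K * T by rewrite ler_wpM2l// ukT.
have h3 : 0 <= K ^+ 2 * T by rewrite mulr_ge0// sqr_ge0.
rewrite /moment_bound; lra.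
Qed.

Lemma euler_v_le j k w : (k <= n)%N -> 0 <= v j k w <= moment_bound.
Proof.
move=> kn; have /andP[-> h] := euler_var_bound X (gK j) (sK j) u0 u_mono meshK k w.
apply: le_trans h _.
have h1 : 0 <= \sum_(j < J) `|m0 0 j| by exact: sumr_ge0.
have h2 : K ^+ 2 * u k <= K ^+ 2 * T by rewrite ler_wpM2l ?sqr_ge0// ukT.
have h3 : 0 <= K * T by rewrite mulr_ge0.
rewrite /moment_bound; lra.
Qed.

Lemma measurable_chi k (i : 'I_d) : measurable_fun setT (fun w => (X (u k) w == i)%:R : R).
Proof. exact: (measurable_chain_fun hX (fun l => (l == i)%:R) (uk0 k)). Qed.

Lemma measurable_mu j k : measurable_fun setT (mu j k).
Proof. by apply: measurable_euler_mean => f l _; exact: (measurable_chain_fun hX). Qed.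

Lemma measurable_v j k : measurable_fun setT (v j k).
Proof. by apply: measurable_euler_var => f l _; exact: (measurable_chain_fun hX). Qed.

Lemma measurable_phi k : measurable_fun setT (phi k).
Proof.
apply: measurable_sum => j; apply: measurable_funD.
  by apply: measurable_funN; apply: measurable_funM => //; exact: measurable_mu.
by apply: measurable_funM => //; apply: measurable_funM => //; exact: measurable_v.
Qed.

Definition exp_bound : R := expR (log_laplace_bound m0 K T theta).

Lemma exp_phi_le k w : (k <= n)%N -> expR (phi k w) <= exp_bound.
Proof.
move=> kn; rewrite ler_expR; apply: le_trans (ler_norm _) _.
by apply: log_laplace_le => //; exact: ukT.
Qed.

(** The partial derivative of [log_laplace] with respect to [theta 0 j]. *)
Definition log_laplace_dir (j : 'I_J) (k : nat) (w : Omega) : R := - mu j k w + theta 0 j * v j k w.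

(** First-order coefficient of one step of [log_laplace]. The expansion is exact: the only
    second-order term, [log_laplace_rem], comes from the squared damping factor in the variance. *)
Definition log_laplace_rate (k : nat) (w : Omega) : R :=
  \sum_(j < J) (- theta 0 j * (alpha j 0 (X (u k) w) - gamma j 0 (X (u k) w) * mu j k w)
    + theta 0 j ^+ 2 * (sigma j 0 (X (u k) w) ^+ 2 / 2 - gamma j 0 (X (u k) w) * v j k w)).

Definition log_laplace_rem (k : nat) (w : Omega) : R :=
  \sum_(j < J) (theta 0 j ^+ 2 * (gamma j 0 (X (u k) w) ^+ 2 * v j k w / 2)).

Lemma log_laplaceS k w : phi k.+1 w = phi k w + mesh_size u k * log_laplace_rate k w
  + mesh_size u k ^+ 2 * log_laplace_rem k w.
Proof.
rewrite /log_laplace /log_laplace_rate /log_laplace_rem !mulr_sumr -!big_split/=.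
apply: eq_bigr => j _; by rewrite /euler_mu /euler_v /=; field.
Qed.

(** Large enough for the rate and for the remainder, since [exp_increment] takes a single [Psi]. *)
Definition rate_bound : R := \sum_(j < J) (`|theta 0 j| * (K + K * moment_bound)
  + theta 0 j ^+ 2 * (K ^+ 2 + K * moment_bound + K ^+ 2 * moment_bound)).

Lemma log_laplace_rate_le k w : (k <= n)%N -> `|log_laplace_rate k w| <= rate_bound.
Proof.
move=> kn; apply: le_trans (ler_norm_sum _ _ _) _; apply: ler_sum => j _.
have hm := euler_mu_le j w kn; have /andP[v0 hv] := euler_v_le j w kn.
have /andP[g0 gk] := gK j (X (u k) w); have ak := aK j (X (u k) w); have sk := sK j (X (u k) w).
have A0 := moment_bound_ge0.
apply: le_trans (ler_normD _ _) _; apply: lerD.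
  rewrite normrM normrN; apply: ler_wpM2l => //; apply: le_trans (ler_normB _ _) _; apply: lerD => //.
  by rewrite normrM (ger0_norm g0); exact: ler_pM.
rewrite normrM (ger0_norm (sqr_ge0 _)); apply: ler_wpM2l; first exact: sqr_ge0.
have h1 : 0 <= gamma j 0 (X (u k) w) * v j k w <= K * moment_bound.
  by rewrite mulr_ge0//= ler_pM.
have h2 : 0 <= sigma j 0 (X (u k) w) ^+ 2 <= K ^+ 2.
  by rewrite sqr_ge0/= -(real_normK (num_real (sigma j 0 _))); apply: lerXn2r => //; rewrite nnegrE.
have h3 : 0 <= K ^+ 2 * moment_bound by rewrite mulr_ge0// sqr_ge0.
case/andP: h1 => h1 h1'; case/andP: h2 => h2 h2'.
by rewrite ler_norml; apply/andP; split; lra.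
Qed.

Lemma log_laplace_rem_le k w : (k <= n)%N -> `|log_laplace_rem k w| <= rate_bound.
Proof.
move=> kn; apply: le_trans (ler_norm_sum _ _ _) _; apply: ler_sum => j _.
have /andP[v0 hv] := euler_v_le j w kn.
have /andP[g0 gk] := gK j (X (u k) w).
have A0 := moment_bound_ge0.
have h2 : gamma j 0 (X (u k) w) ^+ 2 <= K ^+ 2 by apply: lerXn2r => //; rewrite nnegrE.
rewrite normrM (ger0_norm (sqr_ge0 _)) -[leLHS]add0r; apply: lerD.
  by rewrite mulr_ge0// addr_ge0// mulr_ge0.
apply: ler_wpM2l; first exact: sqr_ge0.
have h3 : 0 <= gamma j 0 (X (u k) w) ^+ 2 * v j k w <= K ^+ 2 * moment_bound.
  by rewrite mulr_ge0 ?sqr_ge0//= ler_pM// sqr_ge0.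
have h4 : 0 <= K ^+ 2 by exact: sqr_ge0.
have h5 : 0 <= K * moment_bound by exact: mulr_ge0.
case/andP: h3 => h3 h3'.
by rewrite ger0_norm; lra.
Qed.

Lemma rate_bound_ge0 : 0 <= rate_bound.
Proof.
have A0 := moment_bound_ge0; apply: sumr_ge0 => j _.
apply: addr_ge0; apply: mulr_ge0 => //; first by rewrite addr_ge0// mulr_ge0.
  exact: sqr_ge0.
by apply: addr_ge0; [apply: addr_ge0; [exact: sqr_ge0|exact: mulr_ge0]|rewrite mulr_ge0// sqr_ge0].
Qed.

Lemma log_laplace_dir_le j k w : (k <= n)%N ->
  `|log_laplace_dir j k w| <= (1 + `|theta 0 j|) * moment_bound.
Proof.
move=> kn; apply: le_trans (ler_normD _ _) _; rewrite normrN mulrDl mul1r; apply: lerD.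
  exact: euler_mu_le.
have /andP[v0 hv] := euler_v_le j w kn.
by rewrite normrM (ger0_norm v0) ler_wpM2l.
Qed.

Definition euler_transform (k : nat) (i : 'I_d) : R :=
  \int[P]_w (expR (phi k w) * (X (u k) w == i)%:R).

Definition euler_transform_dir (j : 'I_J) (k : nat) (i : 'I_d) : R :=
  \int[P]_w (log_laplace_dir j k w * expR (phi k w) * (X (u k) w == i)%:R).

(** Right-hand side of the differential equation at grid level, with [euler_transform_dir] as the
    [theta]-derivative. *)
Definition euler_generator (k : nat) (i : 'I_d) : R :=
  \sum_(l < d) Q l i * euler_transform k l
  - \sum_(j < J) (theta 0 j * alpha j 0 i - 2^-1 * theta 0 j ^+ 2 * sigma j 0 i ^+ 2) * euler_transform k i
  - \sum_(j < J) theta 0 j * gamma j 0 i * euler_transform_dir j k i.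

Let chi1 k (i : 'I_d) w : 0 <= ((X (u k) w == i)%:R : R) <= 1.
Proof. by case: (_ == _); rewrite ?lexx ?ler01. Qed.

Lemma measurable_exp_phi k : measurable_fun setT (fun w => expR (phi k w)).
Proof. by apply: measurableT_comp => //; exact: measurable_phi. Qed.

Lemma measurable_dir j k : measurable_fun setT (log_laplace_dir j k).
Proof.
apply: measurable_funD; first by apply: measurable_funN; exact: measurable_mu.
by apply: measurable_funM => //; exact: measurable_v.
Qed.

Lemma measurable_rate k : measurable_fun setT (log_laplace_rate k).
Proof.
apply: measurable_sum => j.
have mX (f : 'I_d -> R) := measurable_chain_fun hX f (uk0 k).
apply: measurable_funD; apply: measurable_funM => //.
  apply: measurable_funB; first exact: (mX (fun i => alpha j 0 i)).
  by apply: measurable_funM; [exact: (mX (fun i => gamma j 0 i))|exact: measurable_mu].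
apply: measurable_funB; first exact: (mX (fun i => sigma j 0 i ^+ 2 / 2)).
by apply: measurable_funM; [exact: (mX (fun i => gamma j 0 i))|exact: measurable_v].
Qed.

Lemma exp_bound_ge0 : 0 <= exp_bound. Proof. exact: expR_ge0. Qed.

Lemma chi_bound (V : Omega -> R) c k i w : `|V w| <= c -> `|V w * (X (u k) w == i)%:R| <= c.
Proof.
move=> Vc; rewrite normrM; have /andP[x0 x1] := chi1 k i w.
by rewrite (ger0_norm x0); apply: le_trans Vc; rewrite ler_piMr.
Qed.

Lemma exp_phi_norm k w : (k <= n)%N -> `|expR (phi k w)| <= exp_bound.
Proof. by move=> kn; rewrite ger0_norm ?expR_ge0//; exact: exp_phi_le. Qed.

Lemma exp_phi_mul_norm (V : Omega -> R) c k w : (k <= n)%N -> `|V w| <= c ->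
  `|V w * expR (phi k w)| <= c * exp_bound.
Proof. by move=> kn Vc; rewrite normrM; apply: ler_pM => //; exact: exp_phi_norm. Qed.

Lemma euler_transform_le k i : (k <= n)%N -> `|euler_transform k i| <= exp_bound.
Proof.
move=> kn; apply: norm_Rintegral_le_cst.
- by apply: measurable_funM; [exact: measurable_exp_phi|exact: measurable_chi].
- exact: exp_bound_ge0.
- by move=> w; apply: (chi_bound (V := fun w => expR (phi k w))); exact: exp_phi_norm.
Qed.

(** The equation takes its form here: on [X (u k) = i], each term of the rate is [- (theta alpha -
    theta^2 sigma^2 / 2) - theta gamma (- mu + theta v)], and the last bracket is the derivative of
    [log_laplace]. *)
Lemma euler_generatorE k i : (k <= n)%N -> euler_generator k i =
  \sum_(l < d) Q l i * euler_transform k l +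
  \int[P]_w (log_laplace_rate k w * expR (phi k w) * (X (u k) w == i)%:R).
Proof.
move=> kn; rewrite /euler_generator -addrA; congr (_ + _).
pose F w := expR (phi k w) * (X (u k) w == i)%:R.
pose D j w := log_laplace_dir j k w * expR (phi k w) * (X (u k) w == i)%:R.
have mF : measurable_fun setT F.
  by apply: measurable_funM; [exact: measurable_exp_phi|exact: measurable_chi].
have mD j : measurable_fun setT (D j).
  apply: measurable_funM; last exact: measurable_chi.
  by apply: measurable_funM; [exact: measurable_dir|exact: measurable_exp_phi].
have bF : bounded_rv F.
  exists exp_bound => w; apply: (chi_bound (V := fun w => expR (phi k w))); exact: exp_phi_norm.
have bD j : bounded_rv (D j).
  exists ((1 + `|theta 0 j|) * moment_bound * exp_bound) => w.
  apply: (chi_bound (V := fun w => log_laplace_dir j k w * expR (phi k w))).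
  by apply: exp_phi_mul_norm => //; exact: log_laplace_dir_le.
have bZ (c : R) (V : Omega -> R) : bounded_rv V -> bounded_rv (fun w => c * V w).
  by move=> bV; apply: (bounded_rvM (V := fun=> c)) => //; exists `|c|.
have bB (V W : Omega -> R) : bounded_rv V -> bounded_rv W -> bounded_rv (fun w => V w - W w).
  move=> [c Vc] [c' Wc]; exists (c + c') => w; apply: le_trans (ler_normB _ _) _; exact: lerD.
pose a j := theta 0 j * alpha j 0 i - 2^-1 * theta 0 j ^+ 2 * sigma j 0 i ^+ 2.
pose b j := theta 0 j * gamma j 0 i.
rewrite -opprD -big_split/= -sumrN.
transitivity (\sum_(j < J) \int[P]_w (- (a j * F w) - b j * D j w)).
  apply: eq_bigr => j _; rewrite -RintegralB_bounded.
  - rewrite -RintegralZ_bounded// opprD; congr (_ - _).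
    rewrite -[LHS]mulNr RintegralZ_bounded//.
    by congr Rintegral; apply/funext => w; rewrite mulNr.
  - by apply: measurable_funN; exact: measurable_funM.
  - exact: measurable_funM.
  - have [c hc] := bZ (a j) F bF; exists c => w; rewrite normrN; exact: hc.
  - exact: bZ.
rewrite Rintegral_sum_bounded.
- apply: eq_Rintegral => w _; rewrite /log_laplace_rate !mulr_suml; apply: eq_bigr => j _.
  rewrite /F /D /a /b /log_laplace_dir; case: eqP => [->|_]; last by rewrite !mulr0 subr0 oppr0.
  by field.
- by move=> j; apply: measurable_funB; [apply: measurable_funN|]; exact: measurable_funM.
- move=> j; apply: bB; last exact: bZ.
  have [c hc] := bZ (a j) F bF; exists c => w; rewrite normrN; exact: hc.
Qed.

Variable Cj : R.
Hypothesis hCj : forall k, (k < n)%N ->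
  fine (P (jump_event X (u k) (u k.+1))) <= Cj * mesh_size u k.

Let mesh_ge0 k : 0 <= mesh_size u k. Proof. by rewrite subr_ge0. Qed.

(** The two indicators differ only on the jump event of the cell. *)
Lemma jump_change (V : Omega -> R) (c : R) k i : (k < n)%N -> measurable_fun setT V -> 0 <= c ->
  (forall w, `|V w| <= c) ->
  `|\int[P]_w (V w * (X (u k.+1) w == i)%:R - V w * (X (u k) w == i)%:R)| <= c * Cj * mesh_size u k.
Proof.
move=> kn mV c0 Vc.
have mj := measurable_jump_event hX (uk0 k) (uk0 k.+1).
apply: (@le_trans _ _ (c * fine (P (jump_event X (u k) (u k.+1))))); last first.
  by rewrite -mulrA ler_wpM2l// hCj.
apply: norm_Rintegral_le => //.
- by apply: measurable_funB; apply: measurable_funM => //; exact: measurable_chi.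
- move=> w; rewrite indicE; case: (boolP (w \in _)) => [_|/negP hw].
    rewrite mulr1 -mulrBr normrM; apply: le_trans (Vc w); rewrite ler_piMr//.
    by do 2 case: (_ == _); rewrite ?subrr ?subr0 ?sub0r ?normrN ?normr1 ?normr0.
  rewrite mulr0; suff -> : X (u k.+1) w = X (u k) w by rewrite subrr normr0.
  by apply/eqP/negPn/negP => ne; apply: hw; exact/mem_set.
Qed.

Lemma step_lipschitz (V V' : Omega -> R) (c : R) k i : (k < n)%N ->
  measurable_fun setT V -> measurable_fun setT V' -> 0 <= c ->
  (forall w, `|V w| <= c) -> (forall w, `|V' w - V w| <= c * mesh_size u k) ->
  `|\int[P]_w (V' w * (X (u k.+1) w == i)%:R) - \int[P]_w (V w * (X (u k) w == i)%:R)|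
  <= c * (1 + Cj) * mesh_size u k.
Proof.
move=> kn mV mV' c0 Vc VV.
have V'c w : `|V' w| <= c * mesh_size u k + c.
  have -> : V' w = (V' w - V w) + V w by rewrite subrK.
  by apply: le_trans (ler_normD _ _) _; exact: lerD.
have mc k' i' := measurable_chi k' i'.
have bV k' i' : bounded_rv (fun w => V w * (X (u k') w == i')%:R).
  by exists c => w; exact: (chi_bound (V := V)).
have bV' k' i' : bounded_rv (fun w => V' w * (X (u k') w == i')%:R).
  by exists (c * mesh_size u k + c) => w; exact: (chi_bound (V := V')).
have -> : \int[P]_w (V' w * (X (u k.+1) w == i)%:R) - \int[P]_w (V w * (X (u k) w == i)%:R) =
    (\int[P]_w (V' w * (X (u k.+1) w == i)%:R) - \int[P]_w (V w * (X (u k.+1) w == i)%:R)) +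
    (\int[P]_w (V w * (X (u k.+1) w == i)%:R) - \int[P]_w (V w * (X (u k) w == i)%:R)).
  by rewrite addrA subrK.
rewrite !RintegralB_bounded//; try exact: measurable_funM.
have -> : c * (1 + Cj) * mesh_size u k = c * mesh_size u k + c * Cj * mesh_size u k by ring.
apply: le_trans (ler_normD _ _) _; apply: lerD.
  apply: norm_Rintegral_le_cst.
  - by apply: measurable_funB; exact: measurable_funM.
  - exact: mulr_ge0.
  - move=> w; rewrite -mulrBl; exact: (chi_bound (V := fun w => V' w - V w)).
exact: jump_change.
Qed.

Hypothesis eta1 : eta <= 1.

Let mesh1 k : `|mesh_size u k| <= 1.
Proof. by rewrite ger0_norm//; apply: le_trans eta1; case: hu. Qed.

Definition step_const : R := exp_increment_const exp_bound rate_bound.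

Lemma step_const_ge0 : 0 <= step_const.
Proof. by apply: exp_increment_const_ge0; [exact: exp_bound_ge0|exact: rate_bound_ge0]. Qed.

Lemma exp_phi_step k w : (k < n)%N ->
  `|expR (phi k.+1 w) - expR (phi k w) - mesh_size u k * (log_laplace_rate k w * expR (phi k w))|
    <= step_const * mesh_size u k ^+ 2 /\
  `|expR (phi k.+1 w) - expR (phi k w)| <= step_const * mesh_size u k.
Proof.
move=> kn; have kn' := ltnW kn.
have := exp_increment (log_laplaceS k w) (mesh1 k) (log_laplace_rate_le w kn')
  (log_laplace_rem_le w kn') (exp_phi_le w kn').
by rewrite [`|mesh_size u k|]ger0_norm.
Qed.

Section OneStep.
Variables (p : R -> 'M[R]_d) (e : R) (k : nat).
Hypothesis kn : (k < n)%N.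
Hypothesis p_near : forall l i, `|p (mesh_size u k) l i - 1%:M l i - mesh_size u k * Q l i| <= e * mesh_size u k.
Hypothesis p_markov : forall l i,
  \int[P]_w (expR (phi k w) * (X (u k) w == l)%:R * (X (u k.+1) w == i)%:R) =
  p (mesh_size u k) l i * euler_transform k l.

(** Three errors: Taylor remainder of the exponential ([T1]), the state moved from the right to the
    left end of the cell in the rate term ([T2]), and the semigroup replaced by its generator after
    the Markov property ([T3], one term per state). *)
Lemma euler_step i :
  `|euler_transform k.+1 i - euler_transform k i - mesh_size u k * euler_generator k i| <=
  mesh_size u k * ((step_const + rate_bound * exp_bound * Cj) * mesh_size u k + d%:R * e * exp_bound).
Proof.
have kn' := ltnW kn; set dt := mesh_size u k.
have dt0 : 0 <= dt by exact: mesh_ge0.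
pose F w := expR (phi k w); pose F' w := expR (phi k.+1 w).
pose G w := log_laplace_rate k w * F w.
pose V w := F' w - F w - dt * G w.
have mF : measurable_fun setT F by exact: measurable_exp_phi.
have mF' : measurable_fun setT F' by exact: measurable_exp_phi.
have mG : measurable_fun setT G by apply: measurable_funM => //; exact: measurable_rate.
have mV : measurable_fun setT V.
  by apply: measurable_funB; [exact: measurable_funB|exact: measurable_funM].
have Vle w : `|V w| <= step_const * dt ^+ 2 by have [] := exp_phi_step w kn.
have Gle w : `|G w| <= rate_bound * exp_bound.
  by apply: exp_phi_mul_norm => //; exact: log_laplace_rate_le.
have F'le w : `|F' w| <= exp_bound by exact: exp_phi_norm.
have Fle w : `|F w| <= exp_bound by exact: exp_phi_norm.
have b_chi (H : Omega -> R) c k' : (forall w, `|H w| <= c) -> bounded_rv (fun w => H w * (X (u k') w == i)%:R).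
  by move=> Hc; exists c => w; exact: (chi_bound (V := H)).
have m_chi (H : Omega -> R) k' : measurable_fun setT H -> measurable_fun setT (fun w => H w * (X (u k') w == i)%:R).
  by move=> mH; apply: measurable_funM => //; exact: measurable_chi.
have T1 : `|\int[P]_w (V w * (X (u k.+1) w == i)%:R)| <= step_const * dt ^+ 2.
  apply: norm_Rintegral_le_cst.
  - exact: m_chi.
  - by apply: mulr_ge0; [exact: step_const_ge0|exact: sqr_ge0].
  - by move=> w; exact: (chi_bound (V := V)).
have RE0 : 0 <= rate_bound * exp_bound.
  by apply: mulr_ge0; [exact: rate_bound_ge0|exact: exp_bound_ge0].
have T2 := jump_change i kn mG RE0 Gle.
have split_l : \int[P]_w (F w * (X (u k.+1) w == i)%:R) = \sum_l p dt l i * euler_transform k l.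
  transitivity (\sum_l \int[P]_w (F w * (X (u k) w == l)%:R * (X (u k.+1) w == i)%:R)); last first.
    by apply: eq_bigr => l _; exact: p_markov.
  rewrite Rintegral_sum_bounded.
  - apply: eq_Rintegral => w _; rewrite -mulr_suml -mulr_sumr.
    rewrite (bigD1 (X (u k) w))//= eqxx big1 ?addr0 ?mulr1// => l ne.
    by rewrite eq_sym (negbTE ne).
  - by move=> l; apply: m_chi; apply: measurable_funM => //; exact: measurable_chi.
  - move=> l; apply: (b_chi _ exp_bound) => w; exact: (chi_bound (V := F)).
have T3 : `|\int[P]_w (F w * (X (u k.+1) w == i)%:R) - euler_transform k i
    - dt * \sum_l Q l i * euler_transform k l| <= dt * (d%:R * e * exp_bound).
  have -> : euler_transform k i = \sum_l (1%:M : 'M[R]_d) l i * euler_transform k l.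
    rewrite (bigD1 i)//= mxE eqxx mul1r big1 ?addr0// => l ne.
    by rewrite mxE (negbTE ne) mul0r.
  rewrite split_l mulr_sumr -!sumrB; apply: le_trans (ler_norm_sum _ _ _) _.
  have -> : dt * (d%:R * e * exp_bound) = \sum_(l < d) (e * dt * exp_bound).
    by rewrite sumr_const card_ord -[RHS]mulr_natl; ring.
  apply: ler_sum => l _.
  have -> : p dt l i * euler_transform k l - 1%:M l i * euler_transform k l - dt * (Q l i * euler_transform k l)
    = (p dt l i - 1%:M l i - dt * Q l i) * euler_transform k l by ring.
  by rewrite normrM; apply: ler_pM => //; exact: euler_transform_le.
have bG' := b_chi G _ k.+1 Gle; have bG := b_chi G _ k Gle.
have bF := b_chi F _ k.+1 Fle; have bF' := b_chi F' _ k.+1 F'le.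
have VE : \int[P]_w (V w * (X (u k.+1) w == i)%:R) = euler_transform k.+1 i
    - \int[P]_w (F w * (X (u k.+1) w == i)%:R) - dt * \int[P]_w (G w * (X (u k.+1) w == i)%:R).
  rewrite RintegralZ_bounded//; last exact: m_chi.
  rewrite [euler_transform _ _ - _]RintegralB_bounded//; try exact: m_chi.
  rewrite RintegralB_bounded.
  - by apply: eq_Rintegral => w _; rewrite -/(F' w) /V; ring.
  - by apply: measurable_funB; exact: m_chi.
  - by apply: measurable_funM => //; exact: m_chi.
  - move: bF bF' => [c hc] [c' hc']; exists (c' + c) => w.
    exact: le_trans (ler_normB _ _) (lerD (hc' w) (hc w)).
  - by apply: (bounded_rvM (V := fun=> dt)) => //; exists `|dt|.
rewrite -RintegralB_bounded// in T2; try exact: m_chi.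
rewrite euler_generatorE//.
have -> : euler_transform k.+1 i - euler_transform k i -
    dt * (\sum_(l < d) Q l i * euler_transform k l + \int[P]_w (G w * (X (u k) w == i)%:R)) =
  \int[P]_w (V w * (X (u k.+1) w == i)%:R)
  + dt * (\int[P]_w (G w * (X (u k.+1) w == i)%:R) - \int[P]_w (G w * (X (u k) w == i)%:R))
  + (\int[P]_w (F w * (X (u k.+1) w == i)%:R) - euler_transform k i
    - dt * \sum_l Q l i * euler_transform k l).
  by rewrite VE; ring.
apply: le_trans (ler_normD _ _) _; apply: le_trans (lerD (ler_normD _ _) (lexx _)) _.
rewrite [`|dt * _|]normrM (ger0_norm dt0).
have T2' := ler_wpM2l dt0 T2.
apply: le_trans (lerD (lerD T1 T2') T3) _.
by rewrite le_eqVlt; apply/orP; left; apply/eqP; rewrite -/dt; ring.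
Qed.

End OneStep.

Definition transform_lip : R := (exp_bound + step_const) * (1 + Cj).

Lemma euler_transform_lip k i : (k < n)%N ->
  `|euler_transform k.+1 i - euler_transform k i| <= transform_lip * mesh_size u k.
Proof.
move=> kn; have kn' := ltnW kn.
apply: (step_lipschitz (V := fun w => expR (phi k w)) (V' := fun w => expR (phi k.+1 w))) => //.
- exact: measurable_exp_phi.
- exact: measurable_exp_phi.
- by apply: addr_ge0; [exact: exp_bound_ge0|exact: step_const_ge0].
- by move=> w; apply: le_trans (exp_phi_norm w kn') _; rewrite lerDl step_const_ge0.
- move=> w; have [_ h] := exp_phi_step w kn; apply: le_trans h _.
  by rewrite ler_wpM2r// lerDr exp_bound_ge0.
Qed.

Definition dir_lip (j : 'I_J) : R :=
  (K + K * moment_bound + `|theta 0 j| * (2 * K * moment_bound + K ^+ 2)).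

Lemma log_laplace_dir_lip j k w : (k < n)%N ->
  `|log_laplace_dir j k.+1 w - log_laplace_dir j k w| <= dir_lip j * mesh_size u k.
Proof.
move=> kn; have kn' := ltnW kn.
have hm := euler_mu_le j w kn'; have /andP[v0 hv] := euler_v_le j w kn'.
have /andP[g0 gk] := gK j (X (u k) w); have ak := aK j (X (u k) w); have sk := sK j (X (u k) w).
have A0 := moment_bound_ge0.
set dt := mesh_size u k; have dt0 : 0 <= dt by exact: mesh_ge0.
set g := gamma j 0 (X (u k) w) in g0 gk *; set a := alpha j 0 (X (u k) w) in ak *.
set s := sigma j 0 (X (u k) w) in sk *.
have gdt : 0 <= g * dt <= 1.
  by rewrite mulr_ge0//=; apply: le_trans (meshK k); rewrite ler_wpM2r.
have -> : log_laplace_dir j k.+1 w - log_laplace_dir j k w =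
    - (dt * (a - g * mu j k w)) + theta 0 j * (dt * (s ^+ 2 - g * (2 - g * dt) * v j k w)).
  rewrite /log_laplace_dir /euler_mu /euler_v /= -/g -/a -/s -/dt; ring.
apply: le_trans (ler_normD _ _) _; rewrite normrN /dir_lip [leRHS]mulrDl; apply: lerD.
  rewrite normrM (ger0_norm dt0) mulrC ler_wpM2r//; apply: le_trans (ler_normB _ _) _; apply: lerD => //.
  by rewrite normrM (ger0_norm g0); exact: ler_pM.
rewrite normrM -[leRHS]mulrA; apply: ler_wpM2l => //; rewrite normrM (ger0_norm dt0) mulrC ler_wpM2r//.
case/andP: gdt => q0 q1.
have h1 : 0 <= g * (2 - g * dt) * v j k w <= 2 * K * moment_bound.
  rewrite !mulr_ge0//=; last lra.
  apply: ler_pM => //; first by rewrite mulr_ge0//; lra.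
  rewrite mulrC; apply: ler_pM => //; lra.
have h2 : 0 <= s ^+ 2 <= K ^+ 2.
  by rewrite sqr_ge0/= -(real_normK (num_real s)); apply: lerXn2r => //; rewrite nnegrE.
case/andP: h1 => h1 h1'; case/andP: h2 => h2 h2'.
by rewrite ler_norml; apply/andP; split; lra.
Qed.

Definition transform_dir_lip (j : 'I_J) : R :=
  ((1 + `|theta 0 j|) * moment_bound * (exp_bound + step_const) + dir_lip j * exp_bound) * (1 + Cj).

Lemma euler_transform_dir_lip j k i : (k < n)%N ->
  `|euler_transform_dir j k.+1 i - euler_transform_dir j k i| <= transform_dir_lip j * mesh_size u k.
Proof.
move=> kn; have kn' := ltnW kn.
pose D k w := log_laplace_dir j k w * expR (phi k w).
have A0 := moment_bound_ge0; have E0 := exp_bound_ge0; have S0 := step_const_ge0.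
have t0 : 0 <= (1 + `|theta 0 j|) * moment_bound by rewrite mulr_ge0// addr_ge0.
have L0 : 0 <= dir_lip j.
  by rewrite /dir_lip !addr_ge0 ?mulr_ge0// addr_ge0 ?sqr_ge0// !mulr_ge0.
have mD k' : measurable_fun setT (D k').
  by apply: measurable_funM; [exact: measurable_dir|exact: measurable_exp_phi].
have LE0 : 0 <= dir_lip j * exp_bound by exact: mulr_ge0.
have tE0 : 0 <= (1 + `|theta 0 j|) * moment_bound * exp_bound by exact: mulr_ge0.
have tS0 : 0 <= (1 + `|theta 0 j|) * moment_bound * step_const by exact: mulr_ge0.
apply: (step_lipschitz (V := D k) (V' := D k.+1)) => //.
- by rewrite mulrDr !addr_ge0.
- move=> w; apply: (@le_trans _ _ ((1 + `|theta 0 j|) * moment_bound * exp_bound)).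
    by apply: exp_phi_mul_norm => //; exact: log_laplace_dir_le.
  by rewrite [_ * (exp_bound + step_const)]mulrDr -addrA lerDl addr_ge0.
- move=> w; have [_ h] := exp_phi_step w kn; have h' := log_laplace_dir_lip j w kn.
  have -> : D k.+1 w - D k w = (log_laplace_dir j k.+1 w - log_laplace_dir j k w) * expR (phi k.+1 w)
     + log_laplace_dir j k w * (expR (phi k.+1 w) - expR (phi k w)) by rewrite /D; ring.
  have dt0 := mesh_ge0 k; set dt := mesh_size u k in dt0 h h' *.
  apply: le_trans (ler_normD _ _) _; rewrite !normrM.
  have q1 : `|log_laplace_dir j k.+1 w - log_laplace_dir j k w| * `|expR (phi k.+1 w)| <= dir_lip j * dt * exp_bound.
    by apply: ler_pM => //; exact: exp_phi_norm.
  have q2 : `|log_laplace_dir j k w| * `|expR (phi k.+1 w) - expR (phi k w)| <=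
      (1 + `|theta 0 j|) * moment_bound * (step_const * dt).
    by apply: ler_pM => //; exact: log_laplace_dir_le.
  apply: le_trans (lerD q1 q2) _; rewrite -subr_ge0.
  set t := (1 + _) * _ in tE0 *.
  have -> : (t * (exp_bound + step_const) + dir_lip j * exp_bound) * dt -
    (dir_lip j * dt * exp_bound + t * (step_const * dt)) = t * exp_bound * dt by ring.
  exact: mulr_ge0.
Qed.

Definition generator_lip (i : 'I_d) : R :=
  \sum_(l < d) `|Q l i| * transform_lip
  + \sum_(j < J) `|theta 0 j * alpha j 0 i - 2^-1 * theta 0 j ^+ 2 * sigma j 0 i ^+ 2| * transform_lip
  + \sum_(j < J) `|theta 0 j * gamma j 0 i| * transform_dir_lip j.

(** Allows the generator of every cell between two indices to be replaced by its value at a single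
    index. *)
Lemma euler_generator_lip k i : (k < n)%N ->
  `|euler_generator k.+1 i - euler_generator k i| <= generator_lip i * mesh_size u k.
Proof.
move=> kn; rewrite /euler_generator /generator_lip.
have wsum (I : finType) (a x y b : I -> R) : (forall l, `|x l - y l| <= b l * mesh_size u k) ->
    `|\sum_l a l * x l - \sum_l a l * y l| <= (\sum_l `|a l| * b l) * mesh_size u k.
  move=> h; rewrite -sumrB mulr_suml; apply: le_trans (ler_norm_sum _ _ _) _; apply: ler_sum => l _.
  by rewrite -mulrBr normrM -mulrA ler_wpM2l.
have h1 := wsum _ (fun l => Q l i) _ _ (fun=> transform_lip) (fun l => euler_transform_lip l kn).
have h2 := wsum _ (fun j => theta 0 j * alpha j 0 i - 2^-1 * theta 0 j ^+ 2 * sigma j 0 i ^+ 2) _ _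
  (fun=> transform_lip) (fun j : 'I_J => euler_transform_lip i kn).
have h3 := wsum _ (fun j => theta 0 j * gamma j 0 i) _ _ transform_dir_lip
  (fun j => euler_transform_dir_lip j i kn).
set a1 := \sum_(l < d) Q l i * euler_transform k.+1 l in h1 *.
set a2 := \sum_(l < d) Q l i * euler_transform k l in h1 *.
set b1 := \sum_(j < J) _ * euler_transform k.+1 i in h2 *.
set b2 := \sum_(j < J) _ * euler_transform k i in h2 *.
set c1 := \sum_(j < J) _ * euler_transform_dir j k.+1 i in h3 *.
set c2 := \sum_(j < J) _ * euler_transform_dir j k i in h3 *.
have -> : a1 - b1 - c1 - (a2 - b2 - c2) = (a1 - a2) - (b1 - b2) - (c1 - c2) by ring.
rewrite !mulrDl; apply: le_trans (ler_normB _ _) _; apply: lerD => //.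
by apply: le_trans (ler_normB _ _) _; exact: lerD.
Qed.

(** [log_laplace] is quadratic in [theta 0 j], so its expansion in [h] is exact, with second-order
    coefficient [v / 2]; the resulting constant is independent of the grid. *)
Lemma euler_transform_diff j k i h : (k <= n)%N -> `|h| <= 1 ->
  `|\int[P]_w (expR (log_laplace X alpha gamma sigma m0 u (theta + h *: delta_mx 0 j) k w)
       * (X (u k) w == i)%:R) - euler_transform k i - h * euler_transform_dir j k i| <=
  exp_increment_const exp_bound ((1 + `|theta 0 j|) * moment_bound) * h ^+ 2.
Proof.
move=> kn h1; set th := theta + h *: delta_mx 0 j; set C := exp_increment_const _ _.
have A0 := moment_bound_ge0; have E0 := exp_bound_ge0.
have C0 : 0 <= C by apply: exp_increment_const_ge0 => //; rewrite mulr_ge0// addr_ge0.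
pose F w := expR (phi k w); pose F' w := expR (log_laplace X alpha gamma sigma m0 u th k w).
pose D w := log_laplace_dir j k w * F w.
have thE w : log_laplace X alpha gamma sigma m0 u th k w =
    phi k w + h * log_laplace_dir j k w + h ^+ 2 * (v j k w / 2).
  rewrite /log_laplace (bigD1 j)//= [in RHS](bigD1 j)//= /th !mxE !eqxx mulr1.
  rewrite (eq_bigr (fun l => - (theta 0 l * mu l k w) + theta 0 l ^+ 2 * v l k w / 2)).
    by rewrite /log_laplace_dir; field.
  by move=> l /negbTE ne; rewrite !mxE ne andbF mulr0 addr0.
have inc w : `|F' w - F w - h * D w| <= C * h ^+ 2.
  have [|||//] := exp_increment (E := exp_bound) (Psi := (1 + `|theta 0 j|) * moment_bound) (thE w) h1.
  - exact: log_laplace_dir_le.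
  - have /andP[v0 hv] := euler_v_le j w kn.
    rewrite ger0_norm ?divr_ge0// mulrDl mul1r.
    have : 0 <= `|theta 0 j| * moment_bound by exact: mulr_ge0.
    lra.
  - exact: exp_phi_le.
have mF : measurable_fun setT F by exact: measurable_exp_phi.
have mD : measurable_fun setT D by apply: measurable_funM => //; exact: measurable_dir.
have mF' : measurable_fun setT F'.
  apply: measurableT_comp => //; rewrite (_ : log_laplace _ _ _ _ _ _ _ _ = (fun w =>
     phi k w + h * log_laplace_dir j k w + h ^+ 2 * (v j k w / 2))); last exact/funext.
  apply: measurable_funD; first apply: measurable_funD.
  - exact: measurable_phi.
  - by apply: measurable_funM => //; exact: measurable_dir.
  - by apply: measurable_funM => //; apply: measurable_funM => //; exact: measurable_v.
have Fle w : `|F w| <= exp_bound by exact: exp_phi_norm.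
have Dle w : `|D w| <= (1 + `|theta 0 j|) * moment_bound * exp_bound.
  by apply: exp_phi_mul_norm => //; exact: log_laplace_dir_le.
have F'le w : `|F' w| <= C * h ^+ 2 + exp_bound + `|h| * ((1 + `|theta 0 j|) * moment_bound * exp_bound).
  have -> : F' w = (F' w - F w - h * D w) + F w + h * D w by ring.
  apply: le_trans (ler_normD _ _) _; apply: lerD; last by rewrite normrM ler_wpM2l.
  by apply: le_trans (ler_normD _ _) _; exact: lerD.
have b_chi (H : Omega -> R) c : (forall w, `|H w| <= c) -> bounded_rv (fun w => H w * (X (u k) w == i)%:R).
  by move=> Hc; exists c => w; exact: (chi_bound (V := H)).
have m_chi (H : Omega -> R) : measurable_fun setT H -> measurable_fun setT (fun w => H w * (X (u k) w == i)%:R).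
  by move=> mH; apply: measurable_funM => //; exact: measurable_chi.
have bF := b_chi F _ Fle; have bD := b_chi D _ Dle; have bF' := b_chi F' _ F'le.
rewrite RintegralZ_bounded//; last exact: m_chi.
rewrite [X in `|X - _|]RintegralB_bounded//; try exact: m_chi.
rewrite RintegralB_bounded.
- apply: norm_Rintegral_le_cst.
  + apply: measurable_funB; first by apply: measurable_funB; exact: m_chi.
    by apply: measurable_funM => //; exact: m_chi.
  + by rewrite mulr_ge0// sqr_ge0.
  + move=> w; rewrite mulrA -!mulrBl.
    exact: (chi_bound (V := fun w => F' w - F w - h * D w)).
- by apply: measurable_funB; exact: m_chi.
- by apply: measurable_funM => //; exact: m_chi.
- move: bF bF' => [c hc] [c' hc']; exists (c' + c) => w.
  exact: le_trans (ler_normB _ _) (lerD (hc' w) (hc w)).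
- by apply: (bounded_rvM (V := fun=> h)) => //; exists `|h|.
Qed.

End OneGrid.

End EulerStep.

(** * Passage to the limit *)

Section RealLemmas.
Context {R : realType}.

(** The index [c] is free in [[a, b]] so that the rate may be read at either end. *)
Lemma telescoped_increment (x y u : nat -> R) (C e : R) (a b c : nat) : (a <= c <= b)%N ->
  (forall k, u k <= u k.+1) -> 0 <= C ->
  (forall k, (k < b)%N -> `|x k.+1 - x k - mesh_size u k * y k| <= mesh_size u k * e) ->
  (forall k, (k < b)%N -> `|y k.+1 - y k| <= C * mesh_size u k) ->
  `|x b - x a - (u b - u a) * y c| <= (u b - u a) * (e + C * (u b - u a)).
Proof.
move=> /andP[ac cb] u_mono C0 hx hy.
have ab := leq_trans ac cb.
have lip k l : (k <= l)%N -> (l <= b)%N -> `|y l - y k| <= C * (u l - u k).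
  move=> kl lb; have -> : y l - y k = \sum_(k <= i < l) (y i.+1 - y i) by rewrite telescope_sumr.
  have -> : u l - u k = \sum_(k <= i < l) (u i.+1 - u i) by rewrite telescope_sumr.
  rewrite mulr_sumr; apply: le_trans (ler_norm_sum _ _ _) _.
  rewrite !big_nat; apply: ler_sum => i /andP[_ il]; apply: hy; exact: leq_trans il lb.
have mono k l : (k <= l)%N -> u k <= u l := grid_mono u_mono (l := l).
have lip_c k : (a <= k)%N -> (k <= b)%N -> `|y k - y c| <= C * (u b - u a).
  move=> ak kb; have [kc|/ltnW ck] := leqP k c.
    rewrite distrC; apply: le_trans (lip _ _ kc cb) _.
    by rewrite ler_wpM2l// lerB// mono.
  apply: le_trans (lip _ _ ck kb) _.
  by rewrite ler_wpM2l// lerB// mono.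
have uE : u b - u a = \sum_(a <= k < b) mesh_size u k by rewrite telescope_sumr.
have -> : x b - x a - (u b - u a) * y c =
    \sum_(a <= k < b) (x k.+1 - x k - mesh_size u k * y k + mesh_size u k * (y k - y c)).
  have -> : x b - x a = \sum_(a <= k < b) (x k.+1 - x k) by rewrite telescope_sumr.
  rewrite uE mulr_suml -sumrB; apply: eq_bigr => k _; ring.
rewrite [leRHS]mulrC {2}uE mulr_sumr; apply: le_trans (ler_norm_sum _ _ _) _.
rewrite !big_nat; apply: ler_sum => k /andP[ak kb].
have m0 : 0 <= mesh_size u k by rewrite subr_ge0.
apply: le_trans (ler_normD _ _) _; rewrite [leRHS]mulrDl; apply: lerD.
  by rewrite [leRHS]mulrC; exact: hx.
rewrite normrM (ger0_norm m0) [leLHS]mulrC; apply: ler_wpM2r => //.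
by apply: lip_c => //; exact: ltnW.
Qed.

(** Every [d_ n] is within [C |h|] of a difference quotient that converges for fixed [h]; small [h]
    makes [d_] Cauchy, and the bound passes to the limit. *)
Lemma cvg_second_order (f_ : nat -> R -> R) (f : R -> R) (d_ : nat -> R) (C : R) : 0 <= C ->
  (forall h, f_ n h @[n --> \oo] --> f h) ->
  (forall n h, `|h| <= 1 -> `|f_ n h - f_ n 0 - h * d_ n| <= C * h ^+ 2) ->
  exists2 D, d_ n @[n --> \oo] --> D &
    forall h, `|h| <= 1 -> `|f h - f 0 - h * D| <= C * h ^+ 2.
Proof.
move=> C0 ff hd.
have cd : cvgn d_.
  apply: cauchy_cvg; apply: cauchy_exP => e e0.
  pose h := Num.min 1 (e / 4 / (1 + C)).
  have C1 : 0 < 1 + C by rewrite ltr_pwDl.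
  have h0 : 0 < h by rewrite lt_min ltr01 !divr_gt0.
  have h1 : `|h| <= 1 by rewrite gtr0_norm// ge_min lexx.
  have Ch : C * h <= e / 4.
    apply: (@le_trans _ _ ((1 + C) * h)); first by rewrite ler_wpM2r ?(ltW h0)// lerDr.
    by rewrite mulrC -ler_pdivlMr// ge_min lexx orbT.
  exists (h^-1 * (f h - f 0)).
  have q : h^-1 * (f_ n h - f_ n 0) @[n --> \oo] --> h^-1 * (f h - f 0).
    by apply: cvgM; [exact: cvg_cst|exact: cvgB].
  move/cvgrPdist_lt : q => /(_ (e / 2)); rewrite divr_gt0// => /(_ isT).
  apply: filterS => n hn; rewrite /ball/=.
  have hdn := hd n h h1.
  have -> : h^-1 * (f h - f 0) - d_ n = (h^-1 * (f h - f 0) - h^-1 * (f_ n h - f_ n 0))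
     + h^-1 * (f_ n h - f_ n 0 - h * d_ n) by field; rewrite gt_eqF.
  apply: le_lt_trans (ler_normD _ _) _.
  have h2 : `|h^-1 * (f_ n h - f_ n 0 - h * d_ n)| <= e / 4.
    rewrite normrM gtr0_norm ?invr_gt0// ler_pdivrMl//; apply: le_trans hdn _.
    by rewrite expr2 mulrCA; apply: ler_wpM2l Ch; exact: ltW.
  apply: lt_le_trans (ltr_leD hn h2) _; lra.
exists (limn d_) => // h h1.
have lhs : `|f_ n h - f_ n 0 - h * d_ n| @[n --> \oo] --> `|f h - f 0 - h * limn d_|.
  apply: cvg_norm; apply: cvgB; first exact: cvgB.
  by apply: cvgM => //; exact: cvg_cst.
apply: (ler_cvg_to lhs (cvg_cst (C * h ^+ 2))).
by apply: nearW => n; exact: hd.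
Qed.

Lemma col_norm_le d (A : 'cV[R]_d) (e : R) : 0 <= e -> (forall i, `|A i 0| <= e) -> `|A| <= e.
Proof.
move=> e0 h; rewrite [leLHS]/Num.Def.normr/= mx_normrE; apply: bigmax_le => //= -[i k] _ /=.
by rewrite (ord1 k).
Qed.

Lemma cvg_quotient_col d (F : set_system R) {FF : Filter F} (f : R -> 'cV[R]_d) (l : 'cV[R]_d)
    (C : R) : 0 <= C ->
  (forall e, 0 < e -> \forall h \near F, `|h| <= e) ->
  (\forall h \near F, h != 0 /\ forall i, `|f h i 0 - h * l i 0| <= C * h ^+ 2) ->
  h^-1 *: f h @[h --> F] --> l.
Proof.
move=> C0 F0 hf; apply/cvgrPdist_le => e e0.
have C1 : 0 < 1 + C by rewrite ltr_pwDl.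
have eC : 0 < e / (1 + C) by rewrite divr_gt0.
apply: filterS2 (F0 _ eC) hf => h he [h0 hi].
apply: col_norm_le => [|i]; first exact: ltW.
rewrite !mxE; have -> : l i 0 - h^-1 * f h i 0 = - (h^-1 * (f h i 0 - h * l i 0)) by field.
rewrite normrN normrM normfV ler_pdivrMl ?normr_gt0//; apply: le_trans (hi i) _.
rewrite -(real_normK (num_real h)) expr2 mulrCA; apply: ler_wpM2l => //.
apply: (@le_trans _ _ ((1 + C) * `|h|)); first by rewrite ler_wpM2r// lerDr.
by rewrite mulrC -ler_pdivlMr.
Qed.

End RealLemmas.

Section EulerIncrement.
Context {disp : measure_display} {Omega : measurableType disp} {R : realType}.
Variables (P : probability Omega R) (d J : nat) (Q : 'M[R]_d) (X : R -> Omega -> 'I_d).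
Hypothesis hX : markov_chain P Q X.
Variables (alpha gamma sigma : 'I_J -> 'rV[R]_d) (m0 : 'rV[R]_J).
Variable K : R.
Hypotheses (K0 : 0 <= K) (aK : forall j i, `|alpha j 0 i| <= K)
  (gK : forall j i, 0 <= gamma j 0 i <= K) (sK : forall j i, `|sigma j 0 i| <= K).
Variables (T : R) (theta : 'rV[R]_J).
Hypothesis T0 : 0 <= T.

Lemma euler_markov : exists p, transition_semigroup Q p /\
  forall u eta n, fine_grid K T u eta n -> forall k l i, (k < n)%N ->
  \int[P]_w (expR (log_laplace X alpha gamma sigma m0 u theta k w) * (X (u k) w == l)%:R
     * (X (u k.+1) w == i)%:R) =
  p (mesh_size u k) l i * euler_transform P X alpha gamma sigma m0 theta u k l.
Proof.
have [p [hp mk]] := chain_markov_fun hX; exists p; split=> // u eta n hu k l i kn.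
have [u0 u_mono _ _ _] := hu.
have uk0 m := grid_ge0 u0 u_mono m.
pose F w := expR (log_laplace X alpha gamma sigma m0 u theta k w).
(* The scheme at index [k] reads the chain only at indices below [k], hence in the past of [u k]. *)
have adX (f : 'I_d -> R) m : (m < k)%N -> measurable_fun [set: g_sigma_algebraType
    (\bigcup_(v in `[0, u k]) preimage_set_system setT (X v) setT)] (fun w => f (X (u m) w)).
  move=> mk' _ C mC; rewrite setTI; apply: sub_sigma_algebra; exists (u m).
    by rewrite /= in_itv/= uk0 (grid_mono u_mono (ltnW mk')).
  by exists (f @^-1` C) => //; rewrite setTI.
have adF : measurable_fun [set: g_sigma_algebraType
    (\bigcup_(v in `[0, u k]) preimage_set_system setT (X v) setT)] F.
  apply: measurableT_comp => //; apply: measurable_sum => j; apply: measurable_funD.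
    by apply: measurable_funN; apply: measurable_funM => //; exact: measurable_euler_mean.
  by apply: measurable_funM => //; apply: measurable_funM => //; exact: measurable_euler_var.
have F0 w : 0 <= F w by exact: expR_ge0.
have := mk (u k) (u k.+1) F l i (uk0 k) (u_mono k) adF F0.
have e1 w : (F w * \1_(X (u k) @^-1` [set l] `&` X (u k.+1) @^-1` [set i]) w)%:E =
    (F w * (X (u k) w == l)%:R * (X (u k.+1) w == i)%:R)%:E.
  congr EFin; rewrite -mulrA; congr (_ * _); rewrite indicE in_setI.
  have e v m : (w \in X v @^-1` [set m]) = (X v w == m).
    by apply/idP/eqP => [/set_mem//|h]; exact/mem_set.
  by rewrite !e -natrM mulnb.
have e2 w : (F w * \1_(X (u k) @^-1` [set l]) w)%:E = (F w * (X (u k) w == l)%:R)%:E.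
  congr EFin; congr (_ * _); rewrite indicE.
  have -> : (w \in X (u k) @^-1` [set l]) = (X (u k) w == l) => //.
  by apply/idP/eqP => [/set_mem//|h]; exact/mem_set.
under eq_integral do rewrite e1; under [in RHS]eq_integral do rewrite e2.
move=> h; rewrite /euler_transform /Rintegral h fineM//.
have mFl : measurable_fun setT (fun w => F w * (X (u k) w == l)%:R).
  apply: measurable_funM; first exact: (measurable_exp_phi hX alpha gamma sigma m0 theta hu).
  exact: (measurable_chi hX hu).
apply: (@integrable_fin_num _ _ _ P setT) => //.
apply: bounded_integrable => //; exists (exp_bound m0 K T theta) => w.
rewrite normrM; apply: (@le_trans _ _ `|F w|); first by rewrite ler_piMr//; case: (_ == _); rewrite ?normr1 ?normr0.
by apply: (exp_phi_norm X m0 K0 aK gK sK theta hu w); exact: ltnW.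
Qed.

(** [C] is fixed before [e]; only the admissible mesh depends on [e]. Refining the grid therefore
    removes [e] and leaves [C] untouched. *)
Lemma euler_increment (i : 'I_d) : exists2 C, 0 <= C & forall e, 0 < e ->
  exists2 eta0, 0 < eta0 & forall u n, fine_grid K T u eta0 n -> forall a b c,
    (a <= c <= b)%N -> (b <= n)%N ->
    `|euler_transform P X alpha gamma sigma m0 theta u b i
      - euler_transform P X alpha gamma sigma m0 theta u a i
      - (u b - u a) * euler_generator P Q X alpha gamma sigma m0 theta u c i|
    <= (u b - u a) * (e + C * (u b - u a)).
Proof.
have [p [hp mk]] := euler_markov.
have [Cj [dlj dlj0 [Cj0 jump]]] := jump_event_rate hX.
pose E := exp_bound m0 K T theta.
pose S := step_const m0 K T theta; pose rb := rate_bound m0 K T theta.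
have E0 : 0 <= E by exact: exp_bound_ge0.
have S0 : 0 <= S by exact: step_const_ge0.
have rb0 : 0 <= rb by exact: rate_bound_ge0.
pose C := generator_lip Q alpha gamma sigma m0 K T theta Cj i.
exists (Num.max 0 C); first by rewrite le_max lexx.
move=> e e0; pose C1 := S + rb * E * Cj.
have C10 : 0 <= C1 by rewrite addr_ge0// !mulr_ge0// ltW.
have C1' : 0 < 1 + C1 by rewrite ltr_pwDl.
have dE : 0 < 1 + d%:R * E by rewrite ltr_pwDl// mulr_ge0.
(* Half of [e] absorbs the generator error summed over the states; the other half absorbs the term
   proportional to the mesh. *)
pose e' := e / 2 / (1 + d%:R * E).
have e'0 : 0 < e' by rewrite !divr_gt0.
have [dl dl0 gen] := semigroup_generator_le hp e'0.
pose eta0 := Num.min (Num.min 1 dlj) (Num.min dl (e / 2 / (1 + C1))).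
exists eta0; first by rewrite !lt_min ltr01 dlj0 dl0 !divr_gt0.
move=> u n hu a b c acb bn; have [u0 u_mono mesh _ _] := hu.
have mesh0 k : 0 <= mesh_size u k by rewrite subr_ge0.
have meshle k (x : R) : eta0 <= x -> mesh_size u k <= x by exact: le_trans.
have eta1 : eta0 <= 1 by rewrite !ge_min lexx.
have etaj : eta0 <= dlj by rewrite !ge_min lexx orbT.
have etad : eta0 <= dl by rewrite !ge_min lexx !orbT.
have etae : eta0 <= e / 2 / (1 + C1) by rewrite !ge_min lexx !orbT.
have hCj k : (k < n)%N -> fine (P (jump_event X (u k) (u k.+1))) <= Cj * mesh_size u k.
  move=> _; have uk := grid_ge0 u0 u_mono k; have uk1 := grid_ge0 u0 u_mono k.+1.
  rewrite -lee_fin fineK; first by apply: jump => //; exact: meshle.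
  by apply: fin_num_measure; exact: (measurable_jump_event hX).
apply: (@telescoped_increment R (fun k => euler_transform P X alpha gamma sigma m0 theta u k i)
  (fun k => euler_generator P Q X alpha gamma sigma m0 theta u k i) u (Num.max 0 C) e a b c acb u_mono).
- by rewrite le_max lexx.
- move=> k kb; have kn := leq_trans kb bn.
  have := euler_step hX K0 aK gK sK T0 hu hCj eta1 kn (e := e') (p := p).
  move=> /(_ m0 theta (fun l m => gen _ (mesh0 k) (meshle k _ etad) l m) (fun l m => mk u eta0 n hu k l m kn) i).
  move=> h; apply: le_trans h _; apply: ler_wpM2l => //.
  have h1 : C1 * mesh_size u k <= e / 2.
    apply: (@le_trans _ _ ((1 + C1) * mesh_size u k)); first by rewrite ler_wpM2r// lerDr.
    by rewrite mulrC -ler_pdivlMr//; exact: meshle.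
  have h2 : d%:R * e' * E <= e / 2.
    have -> : d%:R * e' * E = e' * (d%:R * E) by ring.
    apply: (@le_trans _ _ (e' * (1 + d%:R * E))); first by rewrite ler_wpM2l ?(ltW e'0)// lerDr.
    by rewrite /e' divfK// gt_eqF.
  rewrite -/E -/S -/rb -/C1; lra.
- move=> k kb; have kn := leq_trans kb bn.
  have h := euler_generator_lip hX m0 K0 aK gK sK theta T0 hu hCj eta1 i kn.
  by apply: le_trans h _; rewrite ler_wpM2r// le_max lexx orbT.
Qed.

End EulerIncrement.

Lemma derive_col (R : realType) (J d : nat) (f : 'rV[R]_J -> 'cV[R]_d) (a v : 'rV[R]_J)
    (l : 'cV[R]_d) (C : R) : 0 <= C ->
  (forall h i, `|h| <= 1 -> `|f (a + h *: v) i 0 - f a i 0 - h * l i 0| <= C * h ^+ 2) ->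
  derivable f a v /\ 'D_v f a = l.
Proof.
move=> C0 hf.
have small (e : R) : 0 < e -> \forall h \near (0 : R)^', `|h| <= e.
  by move=> e0; near=> h; near: h; exact: dnbhs0_le.
have lim : (fun h => h^-1 *: ((f \o shift a) (h *: v) - f a)) @ 0^' --> l.
  apply: (cvg_quotient_col (C := C)) => //.
  near=> h; split; first by near: h; exact: nbhs_dnbhs_neq.
  move=> i; rewrite !mxE /= [h *: v + a]addrC; apply: hf; near: h; exact: small.
split; first by apply/cvg_ex; exists l.
exact: cvg_lim lim.
Unshelve. all: by end_near.
Qed.

Section Limits.
Context {disp : measure_display} {Omega : measurableType disp} {R : realType}.
Variables (P : probability Omega R) (d J : nat) (Q : 'M[R]_d).
Variables (X : R -> Omega -> 'I_d) (B : 'I_J -> R -> {RV P >-> R}).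
Hypothesis hX : markov_chain P Q X.
Hypothesis hB : forall j, brownian_motion (B j).
Hypothesis hXB : mutual_independence P (chain_and_noises X B `[0, +oo[).
Variables (alpha gamma sigma : 'I_J -> 'rV[R]_d) (m0 : 'rV[R]_J) (M : 'I_J -> R -> {RV P >-> R}).
Hypothesis hM : forall j, modulated_OU (natural_filtration X B) X (B j)
                      (alpha j) (gamma j) (sigma j) (m0 0 j) (M j).
Variable K : R.
Hypotheses (K0 : 0 <= K) (aK : forall j i, `|alpha j 0 i| <= K)
  (gK : forall j i, 0 <= gamma j 0 i <= K) (sK : forall j i, `|sigma j 0 i| <= K).

Notation G u theta c := (euler_transform P X alpha gamma sigma m0 theta u c).
Notation dG u theta j c := (euler_transform_dir P X alpha gamma sigma m0 theta u j c).
Notation LG u theta c := (euler_generator P Q X alpha gamma sigma m0 theta u c).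

Let g := transform X M.

Definition transform_generator (theta : 'rV[R]_J) (r : R) (i : 'I_d) : R :=
  \sum_(l < d) Q l i * g theta r l 0
  - \sum_(j < J) (theta 0 j * alpha j 0 i - 2^-1 * theta 0 j ^+ 2 * sigma j 0 i ^+ 2) * g theta r i 0
  - \sum_(j < J) theta 0 j * gamma j 0 i * ('D_(delta_mx 0 j) (g ^~ r) theta) i 0.

Section AlongGrids.
Variables (T : R) (u : nat -> nat -> R) (c n : nat -> nat) (r : R).
Hypotheses (T0 : 0 <= T) (hu : forall k, fine_grid K T (u k) (T / (4 ^ k)%:R) (n k))
  (cn : forall k, (c k <= n k)%N).
Hypothesis Glim : forall theta i, G (u k) theta (c k) i @[k --> \oo] --> g theta r i 0.

(** Differentiability and the value of the derivative come together, as limits of the uniform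
    second-order expansions of the Euler transforms. *)
Lemma transform_derivable theta (j : 'I_J) : derivable (g ^~ r) theta (delta_mx 0 j) /\
  forall i, dG (u k) theta j (c k) i @[k --> \oo] --> ('D_(delta_mx 0 j) (g ^~ r) theta) i 0.
Proof.
pose C := exp_increment_const (exp_bound m0 K T theta) ((1 + `|theta 0 j|) * moment_bound m0 K T).
have C0 : 0 <= C.
  apply: exp_increment_const_ge0; first exact: exp_bound_ge0.
  by apply: mulr_ge0; [exact: addr_ge0|exact: moment_bound_ge0].
have /choice[D hD] : forall i, exists D, dG (u k) theta j (c k) i @[k --> \oo] --> D /\
    forall h, `|h| <= 1 -> `|g (theta + h *: delta_mx 0 j) r i 0 - g theta r i 0 - h * D| <= C * h ^+ 2.
  move=> i.
  have [||D dD hD] := @cvg_second_order R (fun k h => G (u k) (theta + h *: delta_mx 0 j) (c k) i)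
    (fun h => g (theta + h *: delta_mx 0 j) r i 0) (fun k => dG (u k) theta j (c k) i) C C0.
  - by move=> h; exact: Glim.
  - move=> k h h1; have := euler_transform_diff hX m0 K0 aK gK sK theta T0 (hu k) j i (cn k) h1.
    by rewrite scale0r addr0.
  exists D; split=> // h h1; have := hD h h1; by rewrite scale0r addr0.
have [|der DE] := @derive_col R J d (g ^~ r) theta (delta_mx 0 j) (\col_i D i) C C0.
  by move=> h i h1; rewrite [(\col_i0 D i0) i 0]mxE; have [_] := hD i; exact.
by split=> // i; rewrite DE [(\col_i0 D i0) i 0]mxE; have [] := hD i.
Qed.

Lemma euler_generator_cvg theta i :
  LG (u k) theta (c k) i @[k --> \oo] --> transform_generator theta r i.
Proof.
apply: cvgB; first apply: cvgB.
- by apply: cvg_big => [|l _]; [exact: add_continuous|apply: cvgM; [exact: cvg_cst|exact: Glim]].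
- by apply: cvg_big => [|l _]; [exact: add_continuous|apply: cvgM; [exact: cvg_cst|exact: Glim]].
- apply: cvg_big => [|j _]; [exact: add_continuous|apply: cvgM; first exact: cvg_cst].
  by have [_] := transform_derivable theta j; exact.
Qed.

End AlongGrids.

(** The same grids approximate the transform at [s], at their middle index, and at [t], at their
    last one. *)
Lemma euler_approx_pair (T : R) : 0 <= T -> exists p : nat, (0 < p)%N /\
  forall s t, 0 <= s -> s <= t -> t <= T ->
    let N k := (p * 4 ^ k)%N in let u k := two_point_grid s t (N k) in
    [/\ forall k, fine_grid K T (u k) (T / (4 ^ k)%:R) (N k + N k)%N,
        forall theta i, P.-integrable setT (EFin \o transform_integrand X M theta t i),
        forall theta i, G (u k) theta (N k) i @[k --> \oo] --> g theta s i 0 &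
        forall theta i, G (u k) theta (N k + N k)%N i @[k --> \oo] --> g theta t i 0].
Proof.
move=> T0; have [dl dl0 approx] := transform_approx hX hB hXB hM K0 aK gK sK T0.
have K1 : 0 < 1 + K by rewrite ltr_pwDl.
pose m := Num.min dl (1 + K)^-1.
have m_gt0 : 0 < m by rewrite lt_min dl0 invr_gt0.
(* The factor [p] brings all meshes below the threshold [m] from [k = 0] on; the powers of [4] make
   them shrink. *)
pose p := (Num.truncn (T / m)).+1; exists p; split=> // s t s0 st tT N u.
have t0 := le_trans s0 st.
have p0 : 0 < p%:R :> R by rewrite ltr0n.
have Tp : T / p%:R <= m.
  rewrite ler_pdivrMr// mulrC -ler_pdivrMr//; apply: ltW.
  by have /andP[_] := truncn_itv (divr_ge0 T0 (ltW m_gt0)).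
have N0 k : (0 < N k)%N by rewrite muln_gt0 expn_gt0.
have mesh k l : mesh_size (u k) l <= T / p%:R / (4 ^ k)%:R.
  have [_ h] := two_point_grid_mesh s0 st (N0 k) l; apply: le_trans h _.
  by rewrite natrM invfM mulrA !ler_wpM2r// invr_ge0.
have f4 k : 1 <= (4 ^ k)%:R :> R by rewrite ler1n expn_gt0.
have mesh4 k l : mesh_size (u k) l <= T / (4 ^ k)%:R.
  apply: le_trans (mesh k l) _; rewrite ler_wpM2r ?invr_ge0// ler_piMr//.
  by rewrite invf_le1// ler1n.
have meshm k l : mesh_size (u k) l <= m.
  apply: le_trans (mesh k l) _; apply: le_trans Tp; rewrite ler_piMr ?divr_ge0//.
  by rewrite invf_le1 ?f4// (lt_le_trans ltr01).
have meshdl k l : mesh_size (u k) l <= dl by apply: le_trans (meshm k l) _; rewrite ge_min lexx.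
have u_0 k : u k 0%N = 0 by exact: two_point_grid0.
have u_mono k l : u k l <= u k l.+1 by exact: two_point_grid_mono.
have us k : u k (N k) = s by exact: two_point_grid_mid.
have ut k : u k (N k + N k)%N = t by exact: two_point_grid_end.
have meshK k l : K * mesh_size (u k) l <= 1.
  have m0' : 0 <= mesh_size (u k) l by rewrite subr_ge0.
  have h : mesh_size (u k) l <= (1 + K)^-1 by apply: le_trans (meshm k l) _; rewrite ge_min lexx orbT.
  have : (1 + K) * mesh_size (u k) l <= 1 by rewrite -ler_pdivlMl// mulr1.
  rewrite mulrDl mul1r; lra.
have As := approx u N s u_0 u_mono mesh4 meshdl us (le_trans st tT).
have At := approx u (fun k => (N k + N k)%N) t u_0 u_mono mesh4 meshdl ut tT.
split.
- by move=> k; split=> //; rewrite ut.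
- by move=> theta i; have [] := At theta i.
- move=> theta i; have [_ h] := As theta i.
  by rewrite /euler_transform; under eq_fun do rewrite us.
- move=> theta i; have [_ h] := At theta i.
  by rewrite /euler_transform; under eq_fun do rewrite ut.
Qed.

(** The pair is taken with [s = t]: the second half of each grid consists of empty cells. *)
Lemma transform_integrable theta t i : 0 <= t ->
  P.-integrable setT (EFin \o transform_integrand X M theta t i).
Proof.
move=> t0; have [p [_ h]] := euler_approx_pair t0.
by have [_ + _ _] := h t t t0 (lexx _) (lexx _); exact.
Qed.

Lemma transform_derivable_at theta t j : 0 <= t ->
  derivable (g ^~ t) theta (delta_mx 0 j).
Proof.
move=> t0; have [p [_ h]] := euler_approx_pair t0.
have [hu _ Gs _] := h t t t0 (lexx _) (lexx _).
by have [] := transform_derivable t0 hu (fun k => leq_addr _ _) Gs theta j.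
Qed.

Lemma transform_increment theta (T : R) i : 0 <= T -> exists2 C, 0 <= C &
  forall s t, 0 <= s -> s <= t -> t <= T ->
  `|g theta t i 0 - g theta s i 0 - (t - s) * transform_generator theta s i| <= C * (t - s) ^+ 2 /\
  `|g theta t i 0 - g theta s i 0 - (t - s) * transform_generator theta t i| <= C * (t - s) ^+ 2.
Proof.
move=> T0; have [p [p0 pair]] := euler_approx_pair T0.
have [C C0 inc] := euler_increment hX m0 K0 aK gK sK theta T0 i.
exists C => // s t s0 st tT.
have [] := pair s t s0 st tT.
pose N k := (p * 4 ^ k)%N; pose u k := two_point_grid s t (N k).
move=> hu0 _ Gs0 Gt0.
have hu k : fine_grid K T (u k) (T / (4 ^ k)%:R) (N k + N k)%N := hu0 k.
have Gs th m : G (u k) th (N k) m @[k --> \oo] --> g th s m 0 := Gs0 th m.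
have Gt th m : G (u k) th (N k + N k)%N m @[k --> \oo] --> g th t m 0 := Gt0 th m.
have N0 k : (0 < N k)%N by rewrite muln_gt0 p0 expn_gt0.
have us k : u k (N k) = s by exact: two_point_grid_mid.
have ut k : u k (N k + N k)%N = t by exact: two_point_grid_end.
have ts0 : 0 <= t - s by rewrite subr_ge0.
have Ls : LG (u k) theta (N k) i @[k --> \oo] --> transform_generator theta s i.
  by apply: (euler_generator_cvg T0 hu) => // k; exact: leq_addr.
have Lt : LG (u k) theta (N k + N k)%N i @[k --> \oo] --> transform_generator theta t i.
  exact: (euler_generator_cvg T0 hu).
have lim (c : nat -> nat) (l : R) : (forall k, (N k <= c k <= N k + N k)%N) ->
    LG (u k) theta (c k) i @[k --> \oo] --> l ->
    `|g theta t i 0 - g theta s i 0 - (t - s) * l| <= C * (t - s) ^+ 2.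
  move=> hc hl; apply/ler_addgt0Pr => e e0.
  have ts1 : 0 < 1 + (t - s) by rewrite ltr_pwDl.
  pose e' := e / (1 + (t - s)).
  have e'0 : 0 < e' by rewrite divr_gt0.
  have [eta0 eta00 heta] := inc e' e'0.
  have cl : `|G (u k) theta (N k + N k)%N i - G (u k) theta (N k) i - (t - s) * LG (u k) theta (c k) i|
      @[k --> \oo] --> `|g theta t i 0 - g theta s i 0 - (t - s) * l|.
    apply: cvg_norm; apply: cvgB; first by apply: cvgB; [exact: Gt|exact: Gs].
    by apply: cvgM; [exact: cvg_cst|exact: hl].
  apply: (@le_trans _ _ ((t - s) * (e' + C * (t - s)))).
    apply: (ler_cvg_to cl (cvg_cst ((t - s) * (e' + C * (t - s))))).
    apply: filterS (natr_expn4_gt (T / eta0)) => k k4.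
    have hu1 : fine_grid K T (u k) eta0 (N k + N k).
      have [h1 h2 h3 h4 h5] := hu k; split=> // q; apply: le_trans (h3 q) _.
      by rewrite ler_pdivrMr ?ltr0n ?expn_gt0// mulrC -ler_pdivrMr// ltW.
    by have := heta (u k) _ hu1 _ _ _ (hc k) (leqnn _); rewrite us ut.
  have -> : (t - s) * (e' + C * (t - s)) = C * (t - s) ^+ 2 + e' * (t - s) by ring.
  rewrite lerD2l; apply: (@le_trans _ _ (e' * (1 + (t - s)))).
    by rewrite ler_wpM2l ?(ltW e'0)// lerDr.
  by rewrite divfK// gt_eqF.
by split; [apply: lim Ls => k|apply: lim Lt => k]; rewrite leqnn leq_addr.
Qed.

End Limits.

Theorem mainTheorem9 (R : realType) (disp : measure_display)
    (Omega : measurableType disp) (P : probability Omega R) (d J : nat)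
    (Q : 'M[R]_d) (X : R -> Omega -> 'I_d) (B : 'I_J -> R -> {RV P >-> R})
    (alpha gamma sigma : 'I_J -> 'rV[R]_d) (m0 : 'rV[R]_J)
    (M : 'I_J -> R -> {RV P >-> R})
    (hX : markov_chain P Q X)
    (hB : forall j, brownian_motion (B j))
    (hXB : mutual_independence P (chain_and_noises X B `[0, +oo[))
    (hgamma : forall j i, 0 < gamma j 0 i)
    (hM : forall j, modulated_OU (natural_filtration X B) X (B j)
                      (alpha j) (gamma j) (sigma j) (m0 0 j) (M j)) :
  let g := transform X M in
  forall (theta : 'rV[R]_J) (t : R), 0 <= t ->
    [/\ forall i, P.-integrable setT (EFin \o transform_integrand X M theta t i),
        forall j, derivable (g ^~ t) theta (delta_mx 0 j) &
        is_derive_ge0 (g theta) t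
          (Q^T *m g theta t
           - \sum_(j < J) (theta 0 j *: diag_mx (alpha j)
               - (2^-1 * theta 0 j ^+ 2) *:
                   diag_mx (map_mx (fun x => x ^+ 2) (sigma j))) *m g theta t
           - \sum_(j < J) theta 0 j *:
               (diag_mx (gamma j) *m 'D_(delta_mx 0 j) (g ^~ t) theta))].
Proof.
move=> g theta t t0.
(* One crude bound for all coefficients, available because there are finitely many. *)
pose K := \sum_(j < J) \sum_(i < d) (`|alpha j 0 i| + `|gamma j 0 i| + `|sigma j 0 i|).
have term0 j i : 0 <= `|alpha j 0 i| + `|gamma j 0 i| + `|sigma j 0 i| by rewrite !addr_ge0.
have K0 : 0 <= K by do 2 (apply: sumr_ge0 => ? _).
have bnd j i : `|alpha j 0 i| + `|gamma j 0 i| + `|sigma j 0 i| <= K.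
  apply: (@le_trans _ _ (\sum_(k < d) (`|alpha j 0 k| + `|gamma j 0 k| + `|sigma j 0 k|))).
    by rewrite (bigD1 i)//= lerDl sumr_ge0.
  by rewrite /K (bigD1 j)//= lerDl; do 2 (apply: sumr_ge0 => ? _).
have aK j i : `|alpha j 0 i| <= K by apply: le_trans (bnd j i); rewrite -addrA lerDl addr_ge0.
have sK j i : `|sigma j 0 i| <= K by apply: le_trans (bnd j i); rewrite lerDr addr_ge0.
have gK j i : 0 <= gamma j 0 i <= K.
  rewrite ltW ?hgamma//=; apply: le_trans (ler_norm _) _; apply: le_trans (bnd j i).
  by rewrite addrAC lerDr addr_ge0.
split.
- by move=> i; exact: (transform_integrable hX hB hXB hM K0 aK gK sK).
- by move=> j; exact: (transform_derivable_at hX hB hXB hM K0 aK gK sK).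
set l := (X in is_derive_ge0 _ _ X).
have lE i : l i 0 = transform_generator Q X alpha gamma sigma M theta t i.
  rewrite /l !mxE !summxE /transform_generator; congr (_ - _ - _).
  - by apply: eq_bigr => k _; rewrite mxE.
  - apply: eq_bigr => j _; rewrite mulmxBl -!scalemxAl !mul_diag_mx !mxE; ring.
  - by apply: eq_bigr => j _; rewrite mul_diag_mx !mxE mulrA.
(* Horizon [t + 1] leaves room for increments with [|h| <= 1]. *)
have T0 : 0 <= t + 1 by rewrite addr_ge0.
have /choice[C hC] : forall i, exists C, 0 <= C /\ forall s r, 0 <= s -> s <= r -> r <= t + 1 ->
    `|g theta r i 0 - g theta s i 0 - (r - s) * transform_generator Q X alpha gamma sigma M theta s i| <= C * (r - s) ^+ 2 /\
    `|g theta r i 0 - g theta s i 0 - (r - s) * transform_generator Q X alpha gamma sigma M theta r i| <= C * (r - s) ^+ 2.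
  move=> i; have [C C0 hC] := transform_increment hX hB hXB hM K0 aK gK sK theta i T0.
  by exists C.
have C0 i : 0 <= C i by have [] := hC i.
have le_sum i : C i <= \sum_i C i by rewrite (bigD1 i)//= lerDl sumr_ge0.
have small (e : R) : 0 < e -> \forall h \near within [set h | 0 <= t + h] (0 : R)^', `|h| <= e.
  by move=> e0; rewrite near_withinE; apply: filterS (dnbhs0_le e0) => h.
apply: (cvg_quotient_col (f := fun h => g theta (t + h) - g theta t) (C := \sum_i C i)) => //.
  exact: sumr_ge0.
have ne0 : \forall h \near within [set h | 0 <= t + h] (0 : R)^', h != 0.
  by rewrite near_withinE; apply: filterS (nbhs_dnbhs_neq (0 : R)) => h.
have pos : \forall h \near within [set h | 0 <= t + h] (0 : R)^', 0 <= t + h.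
  by rewrite near_withinE; apply: nearW => h.
apply: filterS3 (small _ ltr01) ne0 pos => h h1 h0 th; split=> // i.
apply: (@le_trans _ _ (C i * h ^+ 2)); last by rewrite ler_wpM2r ?sqr_ge0.
rewrite lE.
have -> : (g theta (t + h) - g theta t) i 0 = g theta (t + h) i 0 - g theta t i 0.
  by rewrite [LHS]mxE [X in _ + X]mxE.
have [_ {}hC] := hC i; move: h1; rewrite ler_norml => /andP[hl hr].
(* For [h >= 0] the generator is read at the left end of [[t, t + h]], for [h < 0] at the right end
   of [[t + h, t]]; in both cases that end is [t]. *)
have [hp|hn] := leP 0 h.
  have [] := hC t (t + h) t0; rewrite ?lerDl// ?lerD2l//.
  have -> : t + h - t = h by ring.
  by move=> hi _; exact: hi.
have tht : t + h <= t by rewrite gerDl ltW.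
have tt1 : t <= t + 1 by rewrite lerDl.
have [] := hC (t + h) t th tht tt1.
set x := g theta t i 0; set y := g theta (t + h) i 0 => _.
have -> : t - (t + h) = - h by ring.
rewrite sqrrN => hx; rewrite -normrN; set z := transform_generator _ _ _ _ _ _ _ _ _ in hx *.
by have -> : - (y - x - h * z) = x - y - - h * z by ring.
Qed.
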